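(* Suppose the convexity/local regularity, global regularity, and conditional observation assumptions listed in the context hold. Choose $\vartheta\in(0,1/4)$ and $\tau_0\ge1$, set $$a:=\tfrac34+\vartheta,\qquad b:=\tfrac12+\vartheta,$$ and choose the step sequences $$\alpha_k:=\alpha_0(1+k/\tau_0)^{-a},\qquad \gamma_k:=\gamma_0(1+k/\tau_0)^{-b}\qquad(k\ge0),$$ with $0<\alpha_0\le1/\kappa$ and $0<\gamma_0\le1$. Let $(x_k,u_k,y_k)_{k\ge0}$ be generated by the iteration $$\begin{aligned}\lambda_k&:=P_D(u_k+Dy_k),\qquad d_k:=\lambda_k-u_k,\\ x_{k+1}&:=x_k-\alpha_k(\hat g_k+\hat J_k^\top\lambda_k),\\ u_{k+1}&:=u_k+\kappa\alpha_kd_k,\\ y_{k+1}&:=(1-\gamma_k)y_k+\gamma_k\hat c_{k+1},\end{aligned}$$ and let $e_k:=y_k-c(x_k)$. Then $$\sup_{k\ge0}\mathbb{E}\bigl[\|x_k\|^2+\|u_k\|^2+\|e_k\|^2\bigr]<\infty,$$ and the sequence $(x_k,u_k,y_k)$ is almost surely bounded. There is a random KKT point $(x^\infty,u^\infty)\in\mathcal{Z}^\star$ such that, almost surely, $$(x_k,u_k)\to(x^\infty,u^\infty),\qquad e_k\to0,\qquad \lambda_k\to u^\infty .$$ Moreover, $\mathbb{E}\|e_k\|^2\to0$, and $\mathcal{R}(x_k,u_k)\to0$ almost surely.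
   Context: Setting. $n,m$ are positive integers; $f:\mathbb{R}^n\to\mathbb{R}$; $c:\mathbb{R}^n\to\mathbb{R}^m$ with Jacobian $J_c(x)\in\mathbb{R}^{m\times n}$; $\mathcal{K}\subseteq\mathbb{R}^m$ is a nonempty closed convex cone with dual cone $\mathcal{C}:=\mathcal{K}^*:=\{u\in\mathbb{R}^m:\langle u,v\rangle\ge0\ \forall v\in\mathcal{K}\}$. The problem is to minimize $f(x)$ subject to $c(x)\in-\mathcal{K}$. The map $c$ is $\mathcal{K}$-convex if $\langle u,c(\cdot)\rangle$ is convex for every $u\in\mathcal{C}$. The KKT set is $$\mathcal{Z}^\star:=\{(x,u)\in\mathbb{R}^n\times\mathbb{R}^m:\nabla f(x)+J_c(x)^\top u=0,\ c(x)\in-\mathcal{K},\ u\in\mathcal{C},\ \langle u,c(x)\rangle=0\}.$$ Fix a symmetric positive definite matrix $D\in\mathbb{R}^{m\times m}$ and $\kappa>0$. Write $\|v\|_M^2:=v^\top Mv$; unsubscripted vector norms are Euclidean and matrix norms are the induced operator norms. Define $$P_D(w):=\arg\min_{v\in\mathcal{C}}\tfrac12\|v-w\|_{D^{-1}}^2,\quad \lambda(x,u):=P_D(u+Dc(x)),\quad d(x,u):=\lambda(x,u)-u,$$ $$G(x,u):=\nabla f(x)+J_c(x)^\top\lambda(x,u),\qquad \mathcal{R}(x,u):=\|G(x,u)\|^2+\|d(x,u)\|^2.$$ Convexity/local regularity assumption: $f$ is convex, $c$ is $\mathcal{K}$-convex, both are continuously differentiable, $\nabla f$ and $J_c$ are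 locally Lipschitz, and $\mathcal{Z}^\star$ is nonempty. Global regularity assumption: there are finite constants $L_f,M_c,L_J\ge0$ such that for all $x,z\in\mathbb{R}^n$: $\|\nabla f(x)-\nabla f(z)\|\le L_f\|x-z\|$, $\|J_c(x)\|\le M_c$, $\|J_c(x)-J_c(z)\|\le L_J\|x-z\|$. Conditional observation assumption: on a probability space, $\mathcal{F}_k$ ($k\ge0$) is the $\sigma$-algebra of information available before the derivative observations at iteration $k$; it contains the initial states $(x_0,u_0,y_0)$ and all previous observations, and $(x_k,u_k,y_k)$ is $\mathcal{F}_k$-measurable. Write $\mathbb{E}_k[\cdot]:=\mathbb{E}[\cdot\mid\mathcal{F}_k]$. There are fixed positive integers $B_g,B_J,B_c$ (sample counts) and finite constants $\sigma_g,\sigma_J,\sigma_c\ge0$ such that for every $k$ the random observations $\hat g_k\in\mathbb{R}^n$, $\hat J_k\in\mathbb{R}^{m\times n}$ satisfy $$\mathbb{E}_k\hat g_k=\nabla f(x_k),\quad \mathbb{E}_k\|\hat g_k-\nabla f(x_k)\|^2\le\sigma_g^2/B_g,\quad \mathbb{E}_k\hat J_k=J_c(x_k),\quad \mathbb{E}_k\|\hat J_k-J_c(x_k)\|^2\le\sigma_J^2/B_J.$$ ($\hat g_k$ and $\hat J_k$ may be correlated.) Let $\mathcal{F}_k^+$ be the $\sigma$-algebra obtained by adding $\hat g_k,\hat J_k$ and the resulting $x_{k+1},u_{k+1}$ to $\mathcal{F}_k$. The constraint observation is $\hat c_{k+1}:=c(x_{k+1})+\varepsilon_{k+1}\in\mathbb{R}^m$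 with $$\mathbb{E}[\varepsilon_{k+1}\mid\mathcal{F}_k^+]=0,\qquad \mathbb{E}[\|\varepsilon_{k+1}\|^2\mid\mathcal{F}_k^+]\le\sigma_c^2/B_c,$$ and $\hat c_{k+1}$ is then included in $\mathcal{F}_{k+1}$ (so $\mathcal{F}_k\subseteq\mathcal{F}_k^+\subseteq\mathcal{F}_{k+1}$). The initial states satisfy $\mathbb{E}[\|x_0\|^2+\|u_0\|^2+\|y_0\|^2]<\infty$ and $u_0\in\mathcal{C}$ almost surely. *)

(* Defs.v *)
From HB Require Import structures.
From mathcomp Require Import all_boot all_order all_algebra.
From mathcomp Require Import all_classical all_reals all_analysis.

Set Implicit Arguments.
Unset Strict Implicit.
Unset Printing Implicit Defensive.

Import Order.TTheory GRing.Theory Num.Theory.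
Import numFieldNormedType.Exports.

Local Open Scope classical_set_scope.
Local Open Scope ring_scope.

(** * Euclidean geometry of column vectors *)

Definition dotcv (R : realType) (n : nat) (u v : 'cV[R]_n) : R :=
  (u^T *m v) 0 0.

(* The library norm on matrices is the max norm, hence a separate Euclidean
   norm. Both induce the library topology of ['cV[R]_n], which is the one used
   for continuity, differentiability, closedness and limits. *)
Definition enorm (R : realType) (n : nat) (v : 'cV[R]_n) : R :=
  Num.sqrt (dotcv v v).

Definition wnorm2 (R : realType) (n : nat) (M : 'M[R]_n) (v : 'cV[R]_n) : R :=
  (v^T *m M *m v) 0 0.

(* The supremum is over a nonempty bounded set, so [sup] is not a default. *)
Definition opnorm (R : realType) (m n : nat) (M : 'M[R]_(m, n)) : R :=
  sup [set enorm (M *m v) | v in [set v : 'cV[R]_n | enorm v <= 1]].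

Definition sym_posdef (R : realType) (n : nat) (M : 'M[R]_n) : Prop :=
  M^T = M /\ forall v : 'cV[R]_n, v != 0 -> 0 < wnorm2 M v.

(** * Derivatives *)

Definition gradient (R : realType) (n : nat) (f : 'cV[R]_n -> R)
    (x : 'cV[R]_n) : 'cV[R]_n :=
  \col_j 'D_(delta_mx j 0) f x.

(* The library's [jacobian] acts on row vectors and is the transpose of the
   usual one. *)
Definition jacobian_cv (R : realType) (m n : nat) (c : 'cV[R]_n -> 'cV[R]_m)
    (x : 'cV[R]_n) : 'M[R]_(m, n) :=
  \matrix_(i, j) ('D_(delta_mx j 0) c x) i 0.

Definition locally_lipschitz (R : realType) (n p q : nat)
    (N : 'M[R]_(p, q) -> R) (g : 'cV[R]_n -> 'M[R]_(p, q)) : Prop :=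
  forall x : 'cV[R]_n, exists L : R,
    \forall y \near x & z \near x, N (g y - g z) <= L * enorm (y - z).

(** * The conic program *)

Definition closed_convex_cone (R : realType) (m : nat) (K : set 'cV[R]_m) :
    Prop :=
  [/\ K !=set0, closed K, convex_set K &
      forall (t : R) v, 0 <= t -> K v -> K (t *: v)].

Definition dual_cone (R : realType) (m : nat) (K : set 'cV[R]_m) :
    set 'cV[R]_m :=
  [set u | forall v, K v -> 0 <= dotcv u v].

Definition cone_convex (R : realType) (n m : nat) (K : set 'cV[R]_m)
    (c : 'cV[R]_n -> 'cV[R]_m) : Prop :=
  forall u, dual_cone K u -> convex_function setT (fun x => dotcv u (c x)).

Definition KKT (R : realType) (n m : nat) (f : 'cV[R]_n -> R)
    (c : 'cV[R]_n -> 'cV[R]_m) (K : set 'cV[R]_m) :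
    set ('cV[R]_n * 'cV[R]_m) :=
  [set z | [/\ gradient f z.1 + (jacobian_cv c z.1)^T *m z.2 = 0,
               K (- c z.1), dual_cone K z.2 & dotcv z.2 (c z.1) = 0]].

(* [xget] picks a minimiser; when [D] is symmetric positive definite and [K] is
   a closed convex cone it exists and is unique, so [0] is never used. *)
Definition proj (R : realType) (m : nat) (D : 'M[R]_m) (K : set 'cV[R]_m)
    (w : 'cV[R]_m) : 'cV[R]_m :=
  xget 0 [set v | dual_cone K v /\
    forall v', dual_cone K v' ->
      2^-1 * wnorm2 (invmx D) (v - w) <= 2^-1 * wnorm2 (invmx D) (v' - w)].

Definition multiplier (R : realType) (n m : nat) (c : 'cV[R]_n -> 'cV[R]_m)
    (K : set 'cV[R]_m) (D : 'M[R]_m) (x : 'cV[R]_n) (u : 'cV[R]_m) :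
    'cV[R]_m :=
  proj D K (u + D *m c x).

Definition dual_step (R : realType) (n m : nat) (c : 'cV[R]_n -> 'cV[R]_m)
    (K : set 'cV[R]_m) (D : 'M[R]_m) (x : 'cV[R]_n) (u : 'cV[R]_m) :
    'cV[R]_m :=
  multiplier c K D x u - u.

Definition primal_step (R : realType) (n m : nat) (f : 'cV[R]_n -> R)
    (c : 'cV[R]_n -> 'cV[R]_m) (K : set 'cV[R]_m) (D : 'M[R]_m)
    (x : 'cV[R]_n) (u : 'cV[R]_m) : 'cV[R]_n :=
  gradient f x + (jacobian_cv c x)^T *m multiplier c K D x u.

Definition residual (R : realType) (n m : nat) (f : 'cV[R]_n -> R)
    (c : 'cV[R]_n -> 'cV[R]_m) (K : set 'cV[R]_m) (D : 'M[R]_m)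
    (x : 'cV[R]_n) (u : 'cV[R]_m) : R :=
  enorm (primal_step f c K D x u) ^+ 2 + enorm (dual_step c K D x u) ^+ 2.

Definition convex_local_regularity (R : realType) (n m : nat)
    (f : 'cV[R]_n -> R) (c : 'cV[R]_n -> 'cV[R]_m) (K : set 'cV[R]_m) : Prop :=
  [/\ convex_function setT f /\ cone_convex K c,
      (forall x, differentiable f x) /\ continuous (gradient f),
      (forall x, differentiable c x) /\ continuous (jacobian_cv c),
      locally_lipschitz (@enorm R n) (gradient f) /\
        locally_lipschitz (@opnorm R m n) (jacobian_cv c)
    & KKT f c K !=set0].

Definition global_regularity (R : realType) (n m : nat)
    (f : 'cV[R]_n -> R) (c : 'cV[R]_n -> 'cV[R]_m) : Prop :=
  exists Lf Mc LJ : R,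
    [/\ [/\ 0 <= Lf, 0 <= Mc & 0 <= LJ],
        forall x z, enorm (gradient f x - gradient f z) <= Lf * enorm (x - z),
        forall x, opnorm (jacobian_cv c x) <= Mc
      & forall x z,
          opnorm (jacobian_cv c x - jacobian_cv c z) <= LJ * enorm (x - z)].

(** * Sub-sigma-algebras and conditional expectation *)

Definition sub_sigma_algebra_of (d : measure_display) (T : measurableType d)
    (F : set (set T)) : Prop :=
  sigma_algebra setT F /\ F `<=` measurable.

(* The events determined by a random matrix (or vector): the preimages of the
   Borel sets under its entries. *)
Definition mx_events (R : realType) (T : Type) (p q : nat)
    (X : T -> 'M[R]_(p, q)) : set (set T) :=
  [set A | exists i j,
    preimage_set_system [set: T] (fun w => X w i j) measurable A].

Definition mx_measurable (R : realType) (T : Type) (p q : nat)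
    (F : set (set T)) (X : T -> 'M[R]_(p, q)) : Prop :=
  mx_events X `<=` F.

(* [Y] is a version of E[X | F]. *)
Definition is_cond_exp (R : realType) (d : measure_display)
    (T : measurableType d) (P : probability T R) (F : set (set T))
    (X Y : T -> R) : Prop :=
  [/\ P.-integrable setT (EFin \o X),
      P.-integrable setT (EFin \o Y),
      preimage_set_system [set: T] Y measurable `<=` F
    & forall A, F A -> (\int[P]_(w in A) (Y w)%:E = \int[P]_(w in A) (X w)%:E)%E].

Definition is_cond_exp_mx (R : realType) (d : measure_display)
    (T : measurableType d) (P : probability T R) (F : set (set T))
    (p q : nat) (X Y : T -> 'M[R]_(p, q)) : Prop :=
  forall i j, is_cond_exp P F (fun w => X w i j) (fun w => Y w i j).

(* E[X | F] <= b almost surely. *)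
Definition cond_exp_le (R : realType) (d : measure_display)
    (T : measurableType d) (P : probability T R) (F : set (set T))
    (X : T -> R) (b : R) : Prop :=
  exists2 Y : T -> R, is_cond_exp P F X Y & {ae P, forall w, Y w <= b}.

(** * Stochastic observations *)

(* The sigma-algebra generated by [F k], the derivative observations of
   iteration [k] and the resulting [x k.+1], [u k.+1]. *)
Definition Fplus (R : realType) (T : Type) (n m : nat)
    (F : nat -> set (set T))
    (ghat : nat -> T -> 'cV[R]_n) (Jhat : nat -> T -> 'M[R]_(m, n))
    (x : nat -> T -> 'cV[R]_n) (u : nat -> T -> 'cV[R]_m) (k : nat) :
    set (set T) :=
  <<s F k `|` mx_events (ghat k) `|` mx_events (Jhat k)
          `|` mx_events (x k.+1) `|` mx_events (u k.+1) >>.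

(* [chat k.+1] is the constraint observation made at iteration [k]; [chat 0]
   plays no role. *)
Record conditional_observation (R : realType) (d : measure_display)
    (T : measurableType d) (P : probability T R) (n m : nat)
    (f : 'cV[R]_n -> R) (c : 'cV[R]_n -> 'cV[R]_m) (K : set 'cV[R]_m)
    (Bg BJ Bc : nat) (sigmag sigmaJ sigmac : R) (F : nat -> set (set T))
    (ghat : nat -> T -> 'cV[R]_n) (Jhat : nat -> T -> 'M[R]_(m, n))
    (chat : nat -> T -> 'cV[R]_m)
    (x : nat -> T -> 'cV[R]_n) (u y : nat -> T -> 'cV[R]_m) : Prop := {
  obs_counts : [/\ (0 < Bg)%N, (0 < BJ)%N & (0 < Bc)%N] ;
  obs_sigmas : [/\ 0 <= sigmag, 0 <= sigmaJ & 0 <= sigmac] ;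
  obs_sigma_algebra : forall k, sub_sigma_algebra_of (F k) ;
  obs_adapted : forall k,
    [/\ mx_measurable (F k) (x k), mx_measurable (F k) (u k)
      & mx_measurable (F k) (y k)] ;
  obs_filtration : forall k, Fplus F ghat Jhat x u k `<=` F k.+1 ;
  obs_chat : forall k, mx_measurable (F k.+1) (chat k.+1) ;
  obs_g_mean : forall k,
    is_cond_exp_mx P (F k) (ghat k) (fun w => gradient f (x k w)) ;
  obs_g_var : forall k,
    cond_exp_le P (F k) (fun w => enorm (ghat k w - gradient f (x k w)) ^+ 2)
      (sigmag ^+ 2 / Bg%:R) ;
  obs_J_mean : forall k,
    is_cond_exp_mx P (F k) (Jhat k) (fun w => jacobian_cv c (x k w)) ;
  obs_J_var : forall k,
    cond_exp_le P (F k)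
      (fun w => opnorm (Jhat k w - jacobian_cv c (x k w)) ^+ 2)
      (sigmaJ ^+ 2 / BJ%:R) ;
  obs_c_mean : forall k,
    is_cond_exp_mx P (Fplus F ghat Jhat x u k)
      (fun w => chat k.+1 w - c (x k.+1 w)) (fun=> 0) ;
  obs_c_var : forall k,
    cond_exp_le P (Fplus F ghat Jhat x u k)
      (fun w => enorm (chat k.+1 w - c (x k.+1 w)) ^+ 2)
      (sigmac ^+ 2 / Bc%:R) ;
  obs_init_moment :
    ('E_P[fun w => (enorm (x 0 w) ^+ 2 + enorm (u 0 w) ^+ 2
                    + enorm (y 0 w) ^+ 2)%R] < +oo)%E ;
  obs_init_dual : {ae P, forall w, dual_cone K (u 0%N w)}
}.

(** * The algorithm *)

Definition power_step (R : realType) (s0 tau0 r : R) (k : nat) : R :=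
  s0 * (1 + k%:R / tau0) `^ (- r).

Definition tracked_multiplier (R : realType) (T : Type) (m : nat)
    (K : set 'cV[R]_m) (D : 'M[R]_m) (u y : nat -> T -> 'cV[R]_m) (k : nat)
    (w : T) : 'cV[R]_m :=
  proj D K (u k w + D *m y k w).

Definition generated_by_iteration (R : realType) (T : Type) (n m : nat)
    (K : set 'cV[R]_m) (D : 'M[R]_m) (kappa : R) (alpha gamma : nat -> R)
    (ghat : nat -> T -> 'cV[R]_n) (Jhat : nat -> T -> 'M[R]_(m, n))
    (chat : nat -> T -> 'cV[R]_m)
    (x : nat -> T -> 'cV[R]_n) (u y : nat -> T -> 'cV[R]_m) : Prop :=
  forall k w,
    let lambda := tracked_multiplier K D u y k w in
    [/\ x k.+1 w = x k w - alpha k *: (ghat k w + (Jhat k w)^T *m lambda),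
        u k.+1 w = u k w + (kappa * alpha k) *: (lambda - u k w)
      & y k.+1 w = (1 - gamma k) *: y k w + gamma k *: chat k.+1 w].

Definition tracking_error (R : realType) (T : Type) (n m : nat)
    (c : 'cV[R]_n -> 'cV[R]_m) (x : nat -> T -> 'cV[R]_n)
    (y : nat -> T -> 'cV[R]_m) (k : nat) (w : T) : 'cV[R]_m :=
  y k w - c (x k w).

(* Main.v *)
Require Import Defs.
From HB Require Import structures.
From mathcomp Require Import all_boot all_order all_algebra.
From mathcomp Require Import all_classical all_reals all_analysis.
From mathcomp Require Import measurable_realfun ring lra.

Set Implicit Arguments.
Unset Strict Implicit.
Unset Printing Implicit Defensive.

Import Order.TTheory GRing.Theory Num.Theory.
Import numFieldNormedType.Exports.

Local Open Scope classical_set_scope.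
Local Open Scope ring_scope.

(** Fix a KKT pair [(xs, us)] and weigh the distance to it by
    [lyap rho = |x - xs|^2 + kappa^-1 |u - us|_{D^-1}^2 + rho |y - c x|^2].
    In one iteration (lemma [lyap_step]) the projection inequality of the dual
    update and the convexity of the Lagrangian produce the same coupling term
    [<lam - us, c x>] with opposite signs.  What is left of it is its tracking
    error [<lam - us, y - c x>], which Young's inequality with weight
    [alpha / gamma] splits between the contraction [gamma |y - c x|^2] of the
    averaging step and a remainder of size [alpha^2 / gamma].  So, up to terms
    that are linear in the noise, the energy decreases by
    [alpha |lam - u|_{D^-1}^2 + gamma / 2 |y - c x|^2], apart from a relative
    error [O(alpha^2 / gamma + gamma^2)].  The exponents [3/4 + vt] and
    [1/2 + vt] make this error summable, with exponents [1 + vt] and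
    [1 + 2 vt], while the sums of [alpha] and of [gamma] diverge.

    Integrated over events known before the iteration, the linear noise terms
    vanish, and the energy is an almost supermartingale: its mean is bounded,
    it converges almost surely, and the decreases are summable in mean
    ([energy_convergence], from [robbins_siegmund]).  Running this with the
    weights [rho = 1] and [rho = 2] and subtracting shows that [|y - c x|^2]
    converges, almost surely and in mean; since its [gamma]-weighted sum is
    finite and the sum of [gamma] diverges, the limit is [0].

    The energy decrease contains the dual step but not the gradient
    [G = grad f x + (J_c x)^T u] of the Lagrangian.  The latter is obtained
    from the descent of the Lagrangian itself ([lagrangian_step]).  The dual
    update can increase the Lagrangian, to first order by
    [kappa alpha |lam - u| |c x|]; on the event that the states have stayed below a
    level [N], this is at most [alpha delta] plus a [delta]-dependent multiple
    of the summable [alpha |lam - u|^2], for every [delta > 0].  Adding a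
    multiple of the energy makes the Lagrangian nonnegative, so a telescoping
    sum bounds the [alpha]-weighted sum of the means of [|G|^2] by a constant
    plus [delta] times the sum of [alpha].  Hence the means of
    [|G|^2 + |lam - u|_{D^-1}^2] on that event are small infinitely often, and
    almost surely the stationarity measure has lower limit [0]
    ([frequently_stationary]).

    All this holds almost surely for all pairs of a countable dense subset of
    the KKT set at once.  On such a trajectory a subsequence with vanishing
    stationarity measure has a cluster point, which is a KKT pair because
    complementarity is the fixed-point equation of the projection
    ([proj_fixP]).  The energies relative to dense pairs near this cluster
    point converge to small limits, so the whole sequence converges to it
    ([trajectory_cvg]), and the remaining conclusions follow by continuity. *)

(** * Euclidean geometry of column vectors *)

Definition sqn (R : realType) (n : nat) (v : 'cV[R]_n) : R := dotcv v v.

Section Euclid.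
Context {R : realType}.

Lemma dotcvE n (u v : 'cV[R]_n) : dotcv u v = \sum_i u i 0 * v i 0.
Proof. by rewrite /dotcv mxE; apply: eq_bigr => i _; rewrite mxE. Qed.

Lemma dotcvC n (u v : 'cV[R]_n) : dotcv u v = dotcv v u.
Proof. by rewrite !dotcvE; apply: eq_bigr => i _; rewrite mulrC. Qed.

Lemma dotcvDr n (u v w : 'cV[R]_n) : dotcv u (v + w) = dotcv u v + dotcv u w.
Proof. by rewrite /dotcv mulmxDr mxE. Qed.

Lemma dotcvDl n (u v w : 'cV[R]_n) : dotcv (v + w) u = dotcv v u + dotcv w u.
Proof. by rewrite !(dotcvC _ u) dotcvDr. Qed.

Lemma dotcvZr n (u v : 'cV[R]_n) a : dotcv u (a *: v) = a * dotcv u v.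
Proof. by rewrite /dotcv -scalemxAr mxE. Qed.

Lemma dotcvZl n (u v : 'cV[R]_n) a : dotcv (a *: u) v = a * dotcv u v.
Proof. by rewrite dotcvC dotcvZr dotcvC. Qed.

Lemma dotcvNr n (u v : 'cV[R]_n) : dotcv u (- v) = - dotcv u v.
Proof. by rewrite -scaleN1r dotcvZr mulN1r. Qed.

Lemma dotcvNl n (u v : 'cV[R]_n) : dotcv (- u) v = - dotcv u v.
Proof. by rewrite dotcvC dotcvNr dotcvC. Qed.

Lemma dotcv0r n (u : 'cV[R]_n) : dotcv u 0 = 0.
Proof. by rewrite /dotcv mulmx0 mxE. Qed.

Lemma dotcv0l n (u : 'cV[R]_n) : dotcv 0 u = 0.
Proof. by rewrite dotcvC dotcv0r. Qed.

Definition dotcv_lin := (dotcvDr, dotcvDl, dotcvNr, dotcvNl, dotcvZr, dotcvZl).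

Lemma dotcv_mulmxr n p (u : 'cV[R]_n) (M : 'M[R]_(n, p)) v :
  dotcv u (M *m v) = dotcv (M^T *m u) v.
Proof. by rewrite /dotcv trmx_mul trmxK mulmxA. Qed.

Lemma dotcv_mulmxl n p (u : 'cV[R]_n) (M : 'M[R]_(p, n)) v :
  dotcv (M *m u) v = dotcv u (M^T *m v).
Proof. by rewrite dotcv_mulmxr trmxK. Qed.

Lemma trmxB n p (A B : 'M[R]_(n, p)) : (A - B)^T = A^T - B^T.
Proof. by apply/matrixP => i j; rewrite !mxE. Qed.

Lemma sqnE n (v : 'cV[R]_n) : sqn v = \sum_i v i 0 ^+ 2.
Proof. by rewrite /sqn dotcvE; apply: eq_bigr => i _; rewrite expr2. Qed.

Lemma sqn_ge0 n (v : 'cV[R]_n) : 0 <= sqn v.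
Proof. by rewrite sqnE; apply: sumr_ge0 => i _; exact: sqr_ge0. Qed.

Lemma sqn_enorm n (v : 'cV[R]_n) : enorm v ^+ 2 = sqn v.
Proof. by rewrite /enorm sqr_sqrtr // sqn_ge0. Qed.

Lemma enorm_ge0 n (v : 'cV[R]_n) : 0 <= enorm v.
Proof. exact: sqrtr_ge0. Qed.

Lemma sqn0 n : sqn (0 : 'cV[R]_n) = 0. Proof. exact: dotcv0r. Qed.

Lemma sqnN n (v : 'cV[R]_n) : sqn (- v) = sqn v.
Proof. by rewrite /sqn dotcvNr dotcvNl opprK. Qed.

Lemma sqnZ n a (v : 'cV[R]_n) : sqn (a *: v) = a ^+ 2 * sqn v.
Proof. by rewrite /sqn dotcvZr dotcvZl mulrA. Qed.

Lemma sqnD n (u v : 'cV[R]_n) : sqn (u + v) = sqn u + 2 * dotcv u v + sqn v.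
Proof. by rewrite /sqn !dotcv_lin (dotcvC v u); ring. Qed.

Lemma sqnB n (u v : 'cV[R]_n) : sqn (u - v) = sqn u - 2 * dotcv u v + sqn v.
Proof. by rewrite sqnD sqnN dotcvNr; ring. Qed.

Lemma sqnBC n (u v : 'cV[R]_n) : sqn (u - v) = sqn (v - u).
Proof. by rewrite -sqnN opprB. Qed.

Lemma sqn_eq0 n (v : 'cV[R]_n) : sqn v = 0 -> v = 0.
Proof.
rewrite sqnE => /eqP; rewrite psumr_eq0 => [/allP h|i _]; last exact: sqr_ge0.
apply/colP => i; rewrite mxE; apply/eqP.
by have := h i (mem_index_enum i); rewrite implyTb sqrf_eq0.
Qed.

Lemma dotcv_le n (u v : 'cV[R]_n) (t : R) :
  0 < t -> 2 * dotcv u v <= t * sqn u + t^-1 * sqn v.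
Proof.
move=> t0; have := sqn_ge0 (t *: u - v).
rewrite sqnB sqnZ dotcvZl => h.
have -> : t * sqn u + t^-1 * sqn v =
   t^-1 * (t ^+ 2 * sqn u - 2 * (t * dotcv u v) + sqn v) + 2 * dotcv u v.
  by field; rewrite gt_eqF.
by rewrite lerDr mulr_ge0 // invr_ge0 ltW.
Qed.

Lemma dotcv_le1 n (u v : 'cV[R]_n) : 2 * dotcv u v <= sqn u + sqn v.
Proof. by have := dotcv_le u v ltr01; rewrite invr1 !mul1r. Qed.

Lemma sqnD_le n (u v : 'cV[R]_n) : sqn (u + v) <= 2 * sqn u + 2 * sqn v.
Proof. by rewrite sqnD; have := dotcv_le1 u v; lra. Qed.

Lemma sqnB_le n (u v : 'cV[R]_n) : sqn (u - v) <= 2 * sqn u + 2 * sqn v.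
Proof. by have := sqnD_le u (- v); rewrite sqnN. Qed.

Lemma sqn_tri n (u v w : 'cV[R]_n) :
  sqn (u - w) <= 2 * sqn (u - v) + 2 * sqn (v - w).
Proof. by have := sqnD_le (u - v) (v - w); rewrite addrA subrK. Qed.

Lemma wnorm2E n (M : 'M[R]_n) v : wnorm2 M v = dotcv v (M *m v).
Proof. by rewrite /wnorm2 /dotcv mulmxA. Qed.

Lemma dotcv_sym n (M : 'M[R]_n) u v : M^T = M ->
  dotcv u (M *m v) = dotcv v (M *m u).
Proof. by move=> Ms; rewrite dotcv_mulmxr Ms dotcvC. Qed.

Lemma wnorm2D n (M : 'M[R]_n) u v : M^T = M ->
  wnorm2 M (u + v) = wnorm2 M u + 2 * dotcv u (M *m v) + wnorm2 M v.
Proof.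
move=> Ms; rewrite !wnorm2E mulmxDr !dotcv_lin (dotcv_sym v u Ms); ring.
Qed.

Lemma wnorm2Z n (M : 'M[R]_n) a v : wnorm2 M (a *: v) = a ^+ 2 * wnorm2 M v.
Proof. by rewrite !wnorm2E -scalemxAr !dotcv_lin; ring. Qed.

Lemma wnorm2N n (M : 'M[R]_n) v : wnorm2 M (- v) = wnorm2 M v.
Proof. by rewrite -scaleN1r wnorm2Z sqrrN expr1n mul1r. Qed.

(** The discriminant of the nonnegative quadratic [wnorm2 M (s *: u + v)] in
    [s]; [M = 1] is the Euclidean case. *)
Lemma wnorm2_CS n (M : 'M[R]_n) u v : M^T = M ->
  (forall w, 0 <= wnorm2 M w) ->
  dotcv u (M *m v) ^+ 2 <= wnorm2 M u * wnorm2 M v.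
Proof.
move=> Ms M0; set b := dotcv _ _; set a := wnorm2 M u; set c := wnorm2 M v.
have key s : 0 <= s ^+ 2 * a + 2 * s * b + c.
  have := M0 (s *: u + v); rewrite wnorm2D // wnorm2Z dotcvZl -/a -/b -/c.
  by rewrite mulrA.
have [a0|a0] := eqVneq a 0.
  have [b0|b0] := eqVneq b 0; first by rewrite b0 a0 expr0n mul0r.
  (* The quadratic degenerates to a nonconstant affine map, negative here. *)
  have := key (- (c + 1) / (2 * b)); rewrite a0.
  have -> : 2 * (- (c + 1) / (2 * b)) * b = - (c + 1) by field.
  lra.
have ap : 0 < a by rewrite lt_neqAle eq_sym a0 M0.
have := key (- b / a).
have -> : (- b / a) ^+ 2 * a + 2 * (- b / a) * b + c = (a * c - b ^+ 2) / a.
  by field.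
by rewrite pmulr_lge0 ?invr_gt0 // subr_ge0.
Qed.

Lemma wnorm21 n (v : 'cV[R]_n) : wnorm2 1%:M v = sqn v.
Proof. by rewrite wnorm2E mul1mx. Qed.

Lemma dotcv_CS2 n (u v : 'cV[R]_n) : dotcv u v ^+ 2 <= sqn u * sqn v.
Proof.
rewrite -!wnorm21 -[X in dotcv u X]mul1mx; apply: wnorm2_CS => [|w].
  exact: trmx1.
by rewrite wnorm21 sqn_ge0.
Qed.

Lemma dotcv_CS n (u v : 'cV[R]_n) : `|dotcv u v| <= enorm u * enorm v.
Proof.
rewrite -ler_sqr ?nnegrE ?mulr_ge0 ?enorm_ge0 //.
by rewrite exprMn !sqn_enorm real_normK ?num_real // dotcv_CS2.
Qed.

Lemma enorm_le_sqn n (v : 'cV[R]_n) b : 0 <= b ->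
  (enorm v <= b) = (sqn v <= b ^+ 2).
Proof. by move=> b0; rewrite -sqn_enorm ler_sqr ?nnegrE ?enorm_ge0. Qed.

Lemma enorm_scale_le n (t : R) (v : 'cV[R]_n) : 0 <= t -> t <= 1 ->
  enorm (t *: v) <= enorm v.
Proof.
move=> t0 t1; rewrite enorm_le_sqn ?enorm_ge0 // sqnZ sqn_enorm.
by rewrite ler_piMl ?sqn_ge0 // expr_le1.
Qed.

Lemma enormD n (u v : 'cV[R]_n) : enorm (u + v) <= enorm u + enorm v.
Proof.
rewrite enorm_le_sqn ?addr_ge0 ?enorm_ge0 // sqnD sqrrD !sqn_enorm.
have := le_trans (ler_norm _) (dotcv_CS u v); lra.
Qed.

Lemma coord_le_enorm n (v : 'cV[R]_n) i : `|v i 0| <= enorm v.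
Proof.
rewrite -ler_sqr ?nnegrE ?enorm_ge0 // sqn_enorm sqnE real_normK ?num_real //.
by rewrite (bigD1 i) //= lerDl; apply: sumr_ge0 => j _; exact: sqr_ge0.
Qed.

Lemma sqr_coord_le n (v : 'cV[R]_n) i : v i 0 ^+ 2 <= sqn v.
Proof.
by rewrite -[v i 0 ^+ 2]real_normK ?num_real // -sqn_enorm ler_sqr
  ?nnegrE ?enorm_ge0 // coord_le_enorm.
Qed.

(** ** The operator norm *)

Lemma has_sup_opnorm m n (M : 'M[R]_(m, n)) :
  has_sup [set enorm (M *m v) | v in [set v : 'cV[R]_n | enorm v <= 1]].
Proof.
split.
  by exists (enorm (M *m 0)), 0 => //=; rewrite /enorm -/(sqn 0) sqn0 sqrtr0.
exists (\sum_i enorm ((row i M)^T) + \sum_i enorm ((row i M)^T)^+2 + 1).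
move=> _ [v /= v1 <-].
set a := \sum_i _; set b := \sum_i _.
have a0 : 0 <= a by apply: sumr_ge0 => i _; exact: enorm_ge0.
have b0 : 0 <= b by apply: sumr_ge0 => i _; exact: sqr_ge0.
rewrite enorm_le_sqn ?addr_ge0 //.
apply: (@le_trans _ _ b); last by nra.
rewrite sqnE; apply: ler_sum => i _.
have -> : (M *m v) i 0 = dotcv (row i M)^T v.
  by rewrite dotcvE mxE; apply: eq_bigr => j _; rewrite !mxE.
apply: (le_trans (dotcv_CS2 _ _)); rewrite sqn_enorm ler_piMr ?sqn_ge0 //.
by rewrite -sqn_enorm expr_le1 ?enorm_ge0.
Qed.

Lemma opnorm_ge0 m n (M : 'M[R]_(m, n)) : 0 <= opnorm M.
Proof.
apply: le_trans (enorm_ge0 (M *m 0)) _.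
apply: sup_upper_bound; first exact: has_sup_opnorm.
by exists 0 => //=; rewrite /enorm -/(sqn 0) sqn0 sqrtr0.
Qed.

Lemma opnormP m n (M : 'M[R]_(m, n)) v : enorm (M *m v) <= opnorm M * enorm v.
Proof.
have [v0|v0] := eqVneq (enorm v) 0.
  have -> : v = 0 by apply: sqn_eq0; rewrite -sqn_enorm v0 expr0n.
  by rewrite mulmx0 /enorm -!/(sqn 0) !sqn0 sqrtr0 mulr0.
have vp : 0 < enorm v by rewrite lt_neqAle eq_sym v0 enorm_ge0.
have eZ p a (w : 'cV[R]_p) : 0 <= a -> enorm (a *: w) = a * enorm w.
  move=> a0; rewrite /enorm -!/(sqn _) sqnZ sqrtrM ?sqr_ge0 //.
  by rewrite sqrtr_sqr ger0_norm.
have : enorm (M *m ((enorm v)^-1 *: v)) <= opnorm M.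
  apply: sup_upper_bound; first exact: has_sup_opnorm.
  by exists ((enorm v)^-1 *: v) => //=; rewrite eZ ?invr_ge0 ?enorm_ge0 // mulVf.
rewrite -scalemxAr eZ ?invr_ge0 ?enorm_ge0 // => h.
by rewrite -ler_pdivrMr // mulrC.
Qed.

Lemma sqn_mulmx m n (M : 'M[R]_(m, n)) v :
  sqn (M *m v) <= opnorm M ^+ 2 * sqn v.
Proof.
by rewrite -!sqn_enorm -exprMn ler_sqr ?nnegrE ?mulr_ge0 ?enorm_ge0
   ?opnorm_ge0 // opnormP.
Qed.

Lemma sqn_trmulmx m n (M : 'M[R]_(m, n)) v :
  sqn (M^T *m v) <= opnorm M ^+ 2 * sqn v.
Proof.
set w := M^T *m v.
have h : sqn w <= enorm v * (opnorm M * enorm w).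
  rewrite {1}/sqn {1}/w dotcv_mulmxl trmxK.
  apply: (le_trans (ler_norm _)); apply: (le_trans (dotcv_CS _ _)).
  by rewrite ler_wpM2l ?enorm_ge0 ?opnormP.
rewrite -!sqn_enorm -exprMn ler_sqr ?nnegrE ?mulr_ge0 ?enorm_ge0 ?opnorm_ge0 //.
have [w0|w0] := eqVneq (enorm w) 0.
  by rewrite w0 mulr_ge0 ?enorm_ge0 ?opnorm_ge0.
have wp : 0 < enorm w by rewrite lt_neqAle eq_sym w0 enorm_ge0.
rewrite -(ler_pM2r wp) -expr2 sqn_enorm; apply: (le_trans h).
by rewrite mulrCA mulrA.
Qed.

(** Lets the entries of a random matrix inherit the conditional variance bound
    that is given for its operator norm. *)
Lemma coord_le_opnorm m n (M : 'M[R]_(m, n)) i j : `|M i j| <= opnorm M.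
Proof.
have := opnormP M (delta_mx j 0).
have -> : enorm (delta_mx j 0 : 'cV[R]_n) = 1.
  rewrite /enorm -/(sqn _) sqnE (bigD1 j) //= big1 => [|k kj].
    by rewrite !mxE !eqxx addr0 expr1n sqrtr1.
  by rewrite !mxE (negbTE kj) expr0n.
rewrite mulr1 => h; apply: le_trans h; rewrite -colE.
by have := coord_le_enorm (col j M) i; rewrite mxE.
Qed.

Lemma wnorm2_le n (M : 'M[R]_n) v : wnorm2 M v <= opnorm M * sqn v.
Proof.
rewrite wnorm2E; apply: le_trans (ler_norm _) _.
apply: le_trans (dotcv_CS _ _) _.
rewrite -sqn_enorm expr2 mulrCA ler_wpM2l ?enorm_ge0 // opnormP //.
Qed.

(** ** Symmetric positive definite matrices *)

Lemma spd_ge0 n (M : 'M[R]_n) v : sym_posdef M -> 0 <= wnorm2 M v.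
Proof.
move=> [_ M0]; have [->|/M0/ltW//] := eqVneq v 0.
by rewrite wnorm2E dotcv0l.
Qed.

Lemma spd_unit n (M : 'M[R]_n) : sym_posdef M -> M \in unitmx.
Proof.
move=> [Ms M0]; rewrite -row_free_unit -kermx_eq0; apply/eqP/row_matrixP => i.
rewrite row0; set r := row i _.
have rM : r *m M = 0 by apply/sub_kermxP; exact: row_sub.
apply: contrapT => /eqP r0.
have : r^T != 0 by apply: contra_neq r0 => h; rewrite -[r]trmxK h trmx0.
by move=> /M0; rewrite /wnorm2 trmxK rM mul0mx mxE ltxx.
Qed.

Lemma spd_inv n (M : 'M[R]_n) : sym_posdef M -> sym_posdef (invmx M).
Proof.
move=> spd; have Mu := spd_unit spd; case: (spd) => Ms M0.
split; first by rewrite trmx_inv Ms.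
move=> v v0; rewrite wnorm2E.
have vE : v = M *m (invmx M *m v) by rewrite mulmxA mulmxV // mul1mx.
rewrite {1}vE dotcvC -wnorm2E; apply: M0.
by apply: contra_neq v0 => h; rewrite vE h mulmx0.
Qed.

Lemma spd1 n : sym_posdef (1%:M : 'M[R]_n).
Proof.
split; first exact: trmx1.
move=> v v0; rewrite wnorm21 lt_neqAle sqn_ge0 andbT eq_sym.
by apply: contra_neq v0 => /sqn_eq0.
Qed.

(** Cauchy--Schwarz for [M] bounds [|v|^4] by [wnorm2 M v] times the quadratic
    form of the inverse, so a bound on the inverse gives coercivity of [M]. *)
Lemma spd_coercive n (M : 'M[R]_n) v : sym_posdef M ->
  sqn v <= opnorm (invmx M) * wnorm2 M v.
Proof.
move=> spd; have [Ms _] := spd; have Mu := spd_unit spd.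
set w := invmx M *m v.
have wE : M *m w = v by rewrite mulmxA mulmxV // mul1mx.
have := wnorm2_CS v w Ms (fun _ => spd_ge0 _ spd).
rewrite wE -/(sqn v) => h.
have h2 : wnorm2 M w <= opnorm (invmx M) * sqn v.
  by rewrite wnorm2E wE dotcvC -wnorm2E; exact: wnorm2_le.
have [v0|v0] := eqVneq (sqn v) 0.
  by rewrite v0 mulr_ge0 ?opnorm_ge0 ?spd_ge0.
have vp : 0 < sqn v by rewrite lt_neqAle eq_sym v0 sqn_ge0.
rewrite -(ler_pM2r vp) -expr2; apply: (le_trans h).
by rewrite -mulrA mulrCA ler_wpM2l ?spd_ge0.
Qed.

(** ** Compatibility with the topology of column vectors *)

Lemma coord_le_norm m n (M : 'M[R]_(m, n)) i j : `|M i j| <= `|M|.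
Proof.
by rewrite [leRHS]/Num.Def.normr /= mx_normrE; apply/bigmax_geP; right; exists (i, j).
Qed.

Lemma norm_le_coord m n (M : 'M[R]_(m, n)) b :
  0 <= b -> (forall i j, `|M i j| <= b) -> `|M| <= b.
Proof.
move=> b0 h; rewrite [leLHS]/Num.Def.normr /= mx_normrE; apply/bigmax_leP; split=> //.
Qed.

Lemma norm_le_enorm n (v : 'cV[R]_n) : `|v| <= enorm v.
Proof.
apply: norm_le_coord; first exact: enorm_ge0.
by move=> i j; rewrite ord1; exact: coord_le_enorm.
Qed.

Lemma cvg_sumr (I J : Type) (r : seq J) (F : set_system I) (FF : Filter F)
  (h : J -> I -> R) (l : J -> R) :
  (forall j, h j x @[x --> F] --> l j) ->
  (\sum_(j <- r) h j x) @[x --> F] --> \sum_(j <- r) l j.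
Proof.
move=> hl; elim: r => [|a r IH].
  by under eq_fun do rewrite big_nil; rewrite big_nil; exact: cvg_cst.
under eq_fun do rewrite big_cons; rewrite big_cons.
by apply: cvgD; [exact: hl|exact: IH].
Qed.

Lemma cvg_mxP (I : Type) (F : set_system I) (FF : Filter F) m n
    (h : I -> 'M[R]_(m, n)) (l : 'M[R]_(m, n)) :
  (forall i j, h x i j @[x --> F] --> l i j) -> h x @[x --> F] --> l.
Proof.
move=> H; apply/cvgrPdist_le => e e0.
have : \forall x \near F, forall ij : 'I_m * 'I_n,
    `|l ij.1 ij.2 - h x ij.1 ij.2| <= e.
  apply: filter_forall => -[i j] /=.
  by move/cvgrPdist_le: (H i j) => /(_ e e0).
apply: filterS => x Hx; apply: norm_le_coord; first exact: ltW.
by move=> i j; rewrite !mxE; exact: (Hx (i, j)).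
Qed.

Lemma cvg_coord (I : Type) (F : set_system I) (FF : Filter F) m n
    (h : I -> 'M[R]_(m, n)) (l : 'M[R]_(m, n)) i j :
  h x @[x --> F] --> l -> h x i j @[x --> F] --> l i j.
Proof.
move=> H; apply/cvgrPdist_le => e e0.
move/cvgrPdist_le: H => /(_ e e0); apply: filterS => x.
by apply: le_trans; have := coord_le_norm (l - h x) i j; rewrite !mxE.
Qed.

Lemma cvg_mulmx (I : Type) (F : set_system I) (FF : Filter F) m n p
    (g : I -> 'M[R]_(m, n)) (h : I -> 'M[R]_(n, p)) (k : 'M[R]_(m, n)) (l : 'M[R]_(n, p)) :
  g x @[x --> F] --> k -> h x @[x --> F] --> l ->
  g x *m h x @[x --> F] --> k *m l.
Proof.
move=> gk hl; apply: cvg_mxP => i j.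
rewrite mxE; under eq_fun do rewrite mxE.
by apply: cvg_sumr => u; apply: cvgM; exact: cvg_coord.
Qed.

Lemma cvg_trmx (I : Type) (F : set_system I) (FF : Filter F) m n
    (h : I -> 'M[R]_(m, n)) (l : 'M[R]_(m, n)) :
  h x @[x --> F] --> l -> (h x)^T @[x --> F] --> l^T.
Proof.
move=> hl; apply: cvg_mxP => i j; rewrite mxE; under eq_fun do rewrite mxE.
exact: cvg_coord.
Qed.

Lemma cvg_dotcv (I : Type) (F : set_system I) (FF : Filter F) n
    (g h : I -> 'cV[R]_n) (k l : 'cV[R]_n) :
  g x @[x --> F] --> k -> h x @[x --> F] --> l ->
  dotcv (g x) (h x) @[x --> F] --> dotcv k l.
Proof.
by move=> gk hl; apply: cvg_coord; apply: cvg_mulmx => //; exact: cvg_trmx.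
Qed.

Lemma cvg_sqn (I : Type) (F : set_system I) (FF : Filter F) n
    (g : I -> 'cV[R]_n) (k : 'cV[R]_n) :
  g x @[x --> F] --> k -> sqn (g x) @[x --> F] --> sqn k.
Proof. by move=> gk; exact: cvg_dotcv. Qed.

Lemma cvg_sqnP (I : Type) (F : set_system I) (FF : Filter F) n
    (g : I -> 'cV[R]_n) (k : 'cV[R]_n) :
  (sqn (g x - k) @[x --> F] --> 0) -> (g x @[x --> F] --> k).
Proof.
move=> H; apply/cvgrPdist_le => e e0.
move/cvgrPdist_le: H => /(_ (e ^+ 2) (exprn_gt0 _ e0)); apply: filterS => x.
rewrite sub0r normrN ger0_norm ?sqn_ge0 // => h.
apply: le_trans (norm_le_enorm _) _.
by rewrite (enorm_le_sqn _ (ltW e0)) sqnBC.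
Qed.

Lemma cvg_sqn0 (I : Type) (F : set_system I) (FF : Filter F) n
    (g : I -> 'cV[R]_n) (k : 'cV[R]_n) :
  (g x @[x --> F] --> k) -> (sqn (g x - k) @[x --> F] --> 0).
Proof.
move=> gk; rewrite -(sqn0 n) -(subrr k).
by apply: cvg_sqn; apply: cvgB => //; exact: cvg_cst.
Qed.

Lemma cvg_wnorm2 (I : Type) (F : set_system I) (FF : Filter F) n M
    (g : I -> 'cV[R]_n) (k : 'cV[R]_n) :
  g x @[x --> F] --> k -> wnorm2 M (g x) @[x --> F] --> wnorm2 M k.
Proof.
move=> gk; rewrite wnorm2E; under eq_fun do rewrite wnorm2E.
apply: cvg_dotcv => //; apply: cvg_mulmx => //; exact: cvg_cst.
Qed.

(** Heine--Borel for row vectors, carried over by transposition. *)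
Lemma bounded_closed_compact_cV n (A : set 'cV[R]_n) M :
  (forall v, A v -> enorm v <= M) -> closed A -> compact A.
Proof.
move=> AM Acl.
have ct p q : continuous (@trmx R p q) by move=> x; apply: (@cvg_trmx _ (nbhs x) _ p q id).
have -> : A = @trmx R 1 n @` [set v : 'rV[R]_n | A v^T].
  apply/seteqP; split=> [v Av|_ [v Av <-]] //.
  by exists v^T; rewrite /= ?trmxK.
apply: continuous_compact; first by apply: continuous_subspaceT; exact: ct.
apply: bounded_closed_compact.
  exists M; split; first exact: num_real.
  move=> N MN v /= /AM vM; apply: norm_le_coord.
    exact: le_trans (enorm_ge0 _) (le_trans vM (ltW MN)).
  move=> i j; rewrite ord1; apply: le_trans (le_trans vM (ltW MN)).
  by have := coord_le_enorm v^T j; rewrite mxE.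
by apply: closed_comp => // x _; exact: ct.
Qed.

Lemma bounded_seq_cluster n (v : nat -> 'cV[R]_n) M :
  (forall k, enorm (v k) <= M) ->
  exists p, forall e j, 0 < e -> exists2 k, (j <= k)%N & sqn (v k - p) < e.
Proof.
move=> vM.
have cA : compact [set v : 'cV[R]_n | enorm v <= M].
  apply: (@bounded_closed_compact_cV _ _ M) => //.
  have M0 := le_trans (enorm_ge0 _) (vM 0%N).
  under eq_set do rewrite enorm_le_sqn //.
  apply: (@closed_comp _ _ (@sqn R n) [set x | x <= M ^+ 2]).
    by move=> x _; apply: (@cvg_sqn _ (nbhs x) _ _ id).
  exact: closed_le.
have FA : (v @ \oo) [set v : 'cV[R]_n | enorm v <= M].
  by exists 0%N => // k _; exact: vM.
have [p [_ clp]] := cA (v @ \oo) _ FA.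
exists p => e j e0.
have [||_ [[k jk <-] kp]] := clp (v @` [set k | (j <= k)%N])
    [set w | sqn (w - p) < e].
- by exists j => // k jk; exists k.
- have H : sqn (w - p) @[w --> (p : 'cV[R]_n)] --> (0 : R).
    exact: (@cvg_sqn0 _ (nbhs p) _ _ id).
  move/cvgrPdist_lt: H => h.
  apply: filterS (h e e0) => w.
  by rewrite sub0r normrN ger0_norm ?sqn_ge0.
by exists k.
Qed.

End Euclid.

(** * First-order calculus *)

Section Calculus.
Context {R : realType} {n : nat}.
Implicit Types (f : 'cV[R]_n -> R) (x v z : 'cV[R]_n).

Lemma derive_gradient f x v : differentiable f x ->
  'D_v f x = dotcv (gradient f x) v.
Proof.
move=> df; rewrite deriveE // dotcvE.
have vE : v = \sum_j v j 0 *: delta_mx j 0.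
  rewrite {1}(matrix_sum_delta v); apply: eq_bigr => i _.
  by rewrite big_ord1.
rewrite {1}vE linear_sum; apply: eq_bigr => j _.
by rewrite linearZ /= mxE deriveE // mulrC.
Qed.

Lemma is_derive_line f x v (t : R) : (forall y, differentiable f y) ->
  is_derive t 1 (fun s : R => f (x + s *: v)) (dotcv (gradient f (x + t *: v)) v).
Proof.
move=> df; set g := fun s : R => _; set y := x + t *: v.
have dv : derivable f y v by exact: diff_derivable.
(* Both difference quotients are the same function of the increment. *)
have E : (fun h : R => h^-1 *: ((g \o shift t) (h *: 1) - g t)) =
         (fun h : R => h^-1 *: ((f \o shift y) (h *: v) - f y)).
  apply/funext => h; congr (_ *: (f _ - _)).
  by apply/colP => i; rewrite !mxE /= [h *: 1]mulr1; ring.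
apply: DeriveDef; first by rewrite /derivable E.
by rewrite /derive E -derive_gradient.
Qed.

Lemma mean_value f x v : (forall y, differentiable f y) ->
  exists2 t, 0 <= t <= 1 & f (x + v) - f x = dotcv (gradient f (x + t *: v)) v.
Proof.
move=> df; pose g (s : R) := f (x + s *: v).
have dg (s : R) : is_derive s 1 g (dotcv (gradient f (x + s *: v)) v).
  exact: is_derive_line.
have gc : {within `[0, 1], continuous g}.
  apply: derivable_within_continuous => s _.
  by have [] := dg s.
have [t tI] := @MVT R g (fun t => dotcv (gradient f (x + t *: v)) v) 0 1 ltr01
  (fun s _ => dg s) gc.
rewrite /g scale1r scale0r addr0 subr0 mulr1 => ->; exists t => //.
by move: tI; rewrite in_itv /= => /andP[/ltW -> /ltW ->].
Qed.

(** The difference quotients along [z - x] are bounded by [f z - f x]. *)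
Lemma convex_gradient_le f x z : differentiable f x ->
  convex_function setT f -> f x + dotcv (gradient f x) (z - x) <= f z.
Proof.
move=> df cf; rewrite -derive_gradient // addrC -lerBrDr.
have dv : derivable f x (z - x) by exact: diff_derivable.
have dr : (fun h => h^-1 *: ((f \o shift x) (h *: (z - x)) - f x)) @ 0^'+
    --> 'D_(z - x) f x.
  move=> A /dv; rewrite /= /nbhs /= /at_right /dnbhs /within /=.
  by apply: filterS => h hA h0; apply: hA; rewrite gt_eqF.
apply: (cvgr_to_le dr); near=> h.
have h0 : 0 < h by near: h; exact: nbhs_right_gt.
have h1 : h <= 1 by near: h; exact: nbhs_right_le.
rewrite /= [_ *: _]mulrC ler_pdivrMr // mulrC.
have hI : 0 <= h <= 1 by rewrite h1 ltW.
pose t : {i01 R} := Itv01 (ltW h0) h1.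
have := cf t z x; rewrite !inE => /(_ I I).
have -> : conv t (z : convex_lmodType _) x = h *: (z - x) + x :> 'cV[R]_n.
  by rewrite /conv /= /unstable.onem; apply/colP => i; rewrite !mxE; ring.
by rewrite convRE /= /unstable.onem; lra.
Unshelve. all: by end_near. Qed.

End Calculus.

Section VectorCalculus.
Context {R : realType} {n m : nat}.
Variable c : 'cV[R]_n -> 'cV[R]_m.
Hypothesis dc : forall x, differentiable c x.

Lemma differentiable_dotcv u x : differentiable (fun y => dotcv u (c y)) x.
Proof.
rewrite (_ : (fun y => _) = \sum_i (fun y => u i 0 * c y i 0)); last first.
  by apply/funext => y; rewrite fct_sumE dotcvE.
apply: differentiable_sum => i.
apply: (@differentiableM _ _ (cst (u i 0)) (fun y => c y i 0)).
  exact: differentiable_cst.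
apply: (@differentiable_comp _ _ _ _ c (fun M : 'cV[R]_m => M i 0)) => //.
exact: differentiable_coord.
Qed.

Lemma derive_coord v x i : 'D_v (fun y => c y i 0) x = ('D_v c x) i 0.
Proof.
have dcv : derivable c x v by exact: diff_derivable.
apply: cvg_lim => //.
rewrite (_ : (fun h => _) =
    fun h => (h^-1 *: ((c \o shift x) (h *: v) - c x)) i 0); last first.
  by apply/funext => h; rewrite !mxE.
exact: cvg_coord dcv.
Qed.

Lemma gradient_dotcv u x :
  gradient (fun y => dotcv u (c y)) x = (jacobian_cv c x)^T *m u.
Proof.
have dci i : differentiable (fun y => c y i 0) x.
  apply: (@differentiable_comp _ _ _ _ c (fun M : 'cV[R]_m => M i 0)) => //.
  exact: differentiable_coord.
apply/colP => j; rewrite !mxE.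
rewrite (_ : (fun y => _) = \sum_i (u i 0 \*: (fun y => c y i 0))); last first.
  by apply/funext => y; rewrite fct_sumE dotcvE.
rewrite derive_sum => [|i]; last first.
  by apply: derivableZ; exact: diff_derivable.
apply: eq_bigr => i _; rewrite !mxE deriveZ; last exact: diff_derivable.
by rewrite derive_coord [_ *: _]mulrC.
Qed.

(** The mean value theorem fails for vector-valued maps; pairing with a fixed
    [u] recovers it, at a point that depends on [u]. *)
Lemma mean_value_dotcv u x v : exists2 t, 0 <= t <= 1 &
  dotcv u (c (x + v) - c x) = dotcv u (jacobian_cv c (x + t *: v) *m v).
Proof.
have [t tI h] := mean_value x v (differentiable_dotcv u).
exists t => //; rewrite dotcvDr dotcvNr h gradient_dotcv dotcv_mulmxl.
by rewrite trmxK.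
Qed.

(** The mean value theorem paired with the increment itself. *)
Lemma lipschitz_of_jacobian M : 0 <= M ->
  (forall x, opnorm (jacobian_cv c x) <= M) ->
  forall x z, sqn (c x - c z) <= M ^+ 2 * sqn (x - z).
Proof.
move=> M0 hM x z; set w := c x - c z.
have [t _ h] := mean_value_dotcv w z (x - z).
have : sqn w <= enorm w * (M * enorm (x - z)).
  rewrite {1}/sqn {2}/w; move: h.
  rewrite [X in c X - _](_ : z + (x - z) = x); last by rewrite addrC subrK.
  move=> ->.
  apply: (le_trans (ler_norm _)); apply: (le_trans (dotcv_CS _ _)).
  rewrite ler_wpM2l ?enorm_ge0 //; apply: (le_trans (opnormP _ _)).
  by rewrite ler_wpM2r ?enorm_ge0.
rewrite -!sqn_enorm -exprMn ler_sqr ?nnegrE ?mulr_ge0 ?enorm_ge0 //.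
have [->|w0] := eqVneq (enorm w) 0; first by rewrite mulr_ge0 ?enorm_ge0.
by rewrite expr2 ler_pM2l // lt_neqAle eq_sym w0 enorm_ge0.
Qed.

End VectorCalculus.

(** * Cones and projections *)

(* [proj] also names the projections of a product topology. *)
Local Notation proj := Defs.proj.

Section Projection.
Context {R : realType} {m : nat}.
Implicit Types (C K : set 'cV[R]_m) (M : 'M[R]_m) (u v w p : 'cV[R]_m).

(** Coercivity of [M] confines the minimisation to a bounded sublevel set. *)
Lemma projection_exists C M w : sym_posdef M -> C !=set0 -> closed C ->
  exists2 p, C p & forall v, C v -> wnorm2 M (p - w) <= wnorm2 M (v - w).
Proof.
move=> spd [v0 Cv0] Ccl; set q := fun v => wnorm2 M (v - w).
have qc : continuous q.
  move=> v; apply: (@cvg_wnorm2 _ _ (nbhs v) _ _ M (fun v => v - w)).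
  by apply: cvgB; [exact: cvg_id|exact: cvg_cst].
pose A := C `&` [set v | q v <= q v0].
have Acp : compact A.
  apply: (@bounded_closed_compact_cV _ _ _
            (enorm w + Num.sqrt (opnorm (invmx M) * q v0))).
    move=> v [_ /= qv]; rewrite -[v in enorm v](subrK w) addrC.
    apply: (le_trans (enormD _ _)); rewrite lerD2l /enorm ler_wsqrtr //.
    apply: le_trans (spd_coercive _ spd) _.
    by rewrite ler_wpM2l ?opnorm_ge0.
  apply: closedI => //.
  apply: (@closed_comp _ _ q [set x | x <= q v0]); last exact: closed_le.
  by move=> x _; exact: qc.
have A0 : A !=set0 by exists v0; split=> //=.
have [p pA pmin] := compact_EVT_min A0 Acp (continuous_subspaceT qc).
move: pA; rewrite inE => -[Cp qp]; exists p => // v Cv.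
have [qv|qv] := leP (q v) (q v0); last by apply: le_trans qp (ltW qv).
by apply: pmin; rewrite inE.
Qed.

(** First-order optimality: [p + t (v - p)] is a competitor for small [t]. *)
Lemma projection_VI C M w p : M^T = M ->
  (forall v t, C v -> 0 <= t <= 1 -> C (p + t *: (v - p))) ->
  (forall v, C v -> wnorm2 M (p - w) <= wnorm2 M (v - w)) ->
  forall v, C v -> 0 <= dotcv (v - p) (M *m (p - w)).
Proof.
move=> Ms Cc pmin v Cv; set b := dotcv _ _; set a := wnorm2 M (v - p).
have key t : 0 <= t <= 1 -> 0 <= t * (t * a + 2 * b).
  move=> tI; have := pmin _ (Cc v t Cv tI).
  rewrite addrAC (addrC (p - w)) (wnorm2D (t *: _)) // wnorm2Z dotcvZl -/a -/b => h.
  by rewrite [X in 0 <= X](_ : _ = t ^+ 2 * a + 2 * (t * b)); [lra|ring].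
rewrite leNgt; apply/negP => b0.
have [a0|a0] := leP a (- b).
  by have := key 1; rewrite ler01 lexx => /(_ isT); lra.
have ap : 0 < a by lra.
have tI : 0 <= - b / a <= 1.
  apply/andP; split; first by apply: divr_ge0; lra.
  by rewrite ler_pdivrMr // mul1r ltW.
have := key _ tI; rewrite divfK ?gt_eqF // => h.
have : 0 < - b / a by rewrite divr_gt0 // oppr_gt0.
by move=> /pmulr_rge0 e; move: h; rewrite e; lra.
Qed.

Lemma dual_coneD K u v : dual_cone K u -> dual_cone K v -> dual_cone K (u + v).
Proof. by move=> Ku Kv w Kw; rewrite dotcvDl addr_ge0 ?Ku ?Kv. Qed.

Lemma dual_coneZ K t u : 0 <= t -> dual_cone K u -> dual_cone K (t *: u).
Proof. by move=> t0 Ku w Kw; rewrite dotcvZl mulr_ge0 ?Ku. Qed.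

Lemma dual_cone0 K : dual_cone K 0.
Proof. by move=> w _; rewrite dotcv0l. Qed.

Lemma closed_dual_cone K : closed (dual_cone K).
Proof.
have -> : dual_cone K = \bigcap_(v in K) [set u | 0 <= dotcv u v].
  by apply/seteqP; split.
apply: closed_bigI => v _.
apply: (@closed_comp _ _ (fun u => dotcv u v) [set x | 0 <= x]).
  move=> u _; apply: (@cvg_dotcv _ _ (nbhs u) _ _ id (cst v)).
    exact: cvg_id.
  exact: cvg_cst.
exact: closed_ge.
Qed.

(** The bipolar theorem: if [q] is the projection of [p] on [K], then [q - p]
    lies in the dual cone and is orthogonal to [q], so [<q - p, p>] is both
    nonnegative and equal to [- |q - p|^2]. *)
Lemma bipolar K p : closed_convex_cone K ->
  (forall v, dual_cone K v -> 0 <= dotcv v p) -> K p.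
Proof.
move=> [[v0 Kv0] Kcl Kc Ks] hp.
have K0 : K !=set0 by exists v0.
have [q Kq qmin] := projection_exists p (spd1 m) K0 Kcl.
have vi := projection_VI (trmx1 _ _) _ qmin.
have {}vi : forall v, K v -> 0 <= dotcv (v - q) (q - p).
  move=> v Kv; rewrite -[q - p]mul1mx; apply: vi => // {v Kv} v t Kv.
  move=> /andP[t0 t1]; pose s : {i01 R} := Itv01 t0 t1.
  have := Kc v q s; rewrite !inE => /(_ Kv Kq).
  rewrite /conv /= /unstable.onem; congr K.
  by apply/colP => i; rewrite !mxE; ring.
have q0 : dotcv q (q - p) = 0.
  apply/eqP; rewrite eq_le; apply/andP; split.
    have := vi (0 *: v0) (Ks _ _ (lexx _) Kv0).
    by rewrite scale0r sub0r dotcvNl oppr_ge0.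
  have := vi (2 *: q) (Ks _ _ (ler0n _ _) Kq).
  by rewrite -[X in _ - X]scale1r -scalerBl dotcvZl; lra.
have dq : dual_cone K (q - p).
  by move=> v Kv; have := vi v Kv; rewrite dotcvDl dotcvNl q0 subr0 dotcvC.
have /sqn_eq0/eqP : sqn (q - p) = 0.
  apply/eqP; rewrite eq_le sqn_ge0 andbT /sqn dotcvDr dotcvNr.
  by rewrite (dotcvC _ q) q0 sub0r oppr_le0; exact: hp.
by rewrite subr_eq0 => /eqP <-.
Qed.

Section Proj.
Variables (D : 'M[R]_m) (K : set 'cV[R]_m).
Hypothesis (spd : sym_posdef D).
Let M := invmx D.
Let spdM : sym_posdef M := spd_inv spd.
Let Ms : M^T = M := proj1 spdM.

Lemma projP w : dual_cone K (proj D K w) /\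
  forall v, dual_cone K v ->
    0 <= dotcv (v - proj D K w) (M *m (proj D K w - w)).
Proof.
have K0 : dual_cone K !=set0 by exists (0 : 'cV[R]_m); exact: dual_cone0.
have [p Cp pmin] := projection_exists w spdM K0 (@closed_dual_cone K).
have : exists p, [set v | dual_cone K v /\ forall v', dual_cone K v' ->
   2^-1 * wnorm2 (invmx D) (v - w) <= 2^-1 * wnorm2 (invmx D) (v' - w)] p.
  by exists p; split => // v Kv; rewrite ler_pM2l ?invr_gt0 //; exact: pmin.
move=> /(xgetPex 0) []; rewrite -/(proj D K w) => Kp {}pmin; split=> // v' Kv'.
apply: (@projection_VI (dual_cone K)) => // v.
  move=> t Kv /andP[t0 t1].
  have -> : proj D K w + t *: (v - proj D K w) =
            t *: v + (1 - t) *: proj D K w.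
    by apply/colP => i; rewrite !mxE; ring.
  by apply: dual_coneD; apply: dual_coneZ => //; rewrite subr_ge0.
by move=> /pmin; rewrite ler_pM2l ?invr_gt0.
Qed.

(** Add the variational inequalities of the two projections, each tested at the
    other. *)
Lemma proj_nonexpansive w w' :
  wnorm2 M (proj D K w - proj D K w') <= wnorm2 M (w - w').
Proof.
have [Kp vp] := projP w; have [Kq vq] := projP w'.
set p := proj D K w in Kp vp *; set q := proj D K w' in Kq vq *.
have h1 := vp _ Kq; have h2 := vq _ Kp.
have := spd_ge0 ((p - q) - (w - w')) spdM.
rewrite wnorm2D // wnorm2N mulmxN dotcvNr.
have -> : dotcv (p - q) (M *m (w - w')) = wnorm2 M (p - q) +
  dotcv (q - p) (M *m (p - w)) + dotcv (p - q) (M *m (q - w')).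
  rewrite wnorm2E -(opprB p q) dotcvNl -dotcvNr -!dotcvDr -mulmxN -!mulmxDr.
  by congr (dotcv _ (_ *m _)); apply/colP => i; rewrite !mxE; ring.
lra.
Qed.

Lemma proj_unique w p : dual_cone K p ->
  (forall v, dual_cone K v -> 0 <= dotcv (v - p) (M *m (p - w))) ->
  proj D K w = p.
Proof.
move=> Kp vi; have [Kq viq] := projP w; set q := proj D K w in Kq viq *.
have h1 := vi _ Kq; have h2 := viq _ Kp.
apply/eqP; rewrite -subr_eq0; apply/eqP/sqn_eq0.
apply/eqP; rewrite eq_le sqn_ge0 andbT.
apply: le_trans (spd_coercive (q - p) spdM) _.
rewrite mulr_ge0_le0 ?opnorm_ge0 //.
have -> : wnorm2 M (q - p) = - (dotcv (q - p) (M *m (p - w)) +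
   dotcv (p - q) (M *m (q - w))).
  rewrite wnorm2E -(opprB q p) dotcvNl -dotcvNr -!dotcvDr -mulmxN -!mulmxDr.
  rewrite -dotcvNr -mulmxN.
  by congr (dotcv _ (_ *m _)); apply/colP => i; rewrite !mxE; ring.
lra.
Qed.

Lemma proj_lipschitz w w' : sqn (proj D K w - proj D K w') <=
  opnorm D * opnorm (invmx D) * sqn (w - w').
Proof.
apply: le_trans (spd_coercive _ spdM) _; rewrite invmxK -mulrA.
rewrite ler_wpM2l ?opnorm_ge0 //; apply: le_trans (proj_nonexpansive _ _) _.
exact: wnorm2_le.
Qed.

Lemma cvg_proj (I : Type) (F : set_system I) (FF : Filter F)
    (g : I -> 'cV[R]_m) (k : 'cV[R]_m) :
  g x @[x --> F] --> k -> proj D K (g x) @[x --> F] --> proj D K k.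
Proof.
move=> gk; apply: cvg_sqnP.
have h : opnorm D * opnorm (invmx D) * sqn (g x - k) @[x --> F] --> (0 : R).
  rewrite -(mulr0 (opnorm D * opnorm (invmx D))).
  by apply: cvgM; [exact: cvg_cst|exact: cvg_sqn0].
apply: (squeeze_cvgr _ (cvg_cst 0) h).
by apply: nearW => x; rewrite sqn_ge0 proj_lipschitz.
Qed.

(** Complementarity is the fixed-point equation of the projected multiplier
    update: [u] is the projection of [u + D c] exactly when [u] and [- c] are
    orthogonal elements of the dual cone and of the cone. *)
Lemma proj_fixP u z : closed_convex_cone K ->
  proj D K (u + D *m z) = u <->
  [/\ K (- z), dual_cone K u & dotcv u z = 0].
Proof.
move=> cK; have MD : M *m D = 1%:M by rewrite mulVmx // spd_unit.
have ME p : M *m (p - (p + D *m z)) = - z.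
  by rewrite opprD addNKr mulmxN mulmxA MD mul1mx.
split=> [pu|[Kz Ku uz]].
  have [] := projP (u + D *m z); rewrite pu ME => Ku vi.
  have uz : dotcv u z = 0.
    apply/eqP; rewrite eq_le; apply/andP; split.
      have := vi (2 *: u) (dual_coneZ (ler0n _ _) Ku).
      rewrite -[X in _ - X]scale1r -scalerBl dotcvZl dotcvNr; lra.
    have := vi 0 (@dual_cone0 K).
    by rewrite sub0r dotcvNl dotcvNr opprK.
  split=> //; apply: bipolar => // v Kv.
  by have := vi v Kv; rewrite dotcvDl dotcvNl (dotcvNr u) uz oppr0 subr0.
apply: proj_unique => // v Kv; rewrite ME dotcvDl dotcvNl (dotcvNr u) uz.
by rewrite oppr0 subr0; exact: Kv.
Qed.

End Proj.
End Projection.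

(** * Random vectors and conditional moments *)

(** Real-valued analogue of [mx_measurable], stated with preimages so that it
    makes sense for a sigma-algebra that is not carried by the type. *)
Definition fmeas (R : realType) (T : Type) (F : set (set T)) (Y : T -> R) :=
  preimage_set_system [set: T] Y measurable `<=` F.

Section Fmeas.
Context {R : realType} {d : measure_display} {T : measurableType d}.
Variable F : set (set T).
Hypothesis sF : sigma_algebra setT F.
Let TF := g_sigma_algebraType F.

Lemma fmeasP (Y : T -> R) : fmeas F Y <-> measurable_fun setT (Y : TF -> R).
Proof.
have FE := sigma_algebra_id sF.
split=> [h _ B mB|h _ [B mB <-]].
  by rewrite /measurable /= FE; apply: h; exists B.
by have := h measurableT B mB; rewrite /measurable /= FE.
Qed.

Lemma sigma_algebra_setC A : F A -> F (~` A).
Proof. by case: sF => _ h _ FA; rewrite -setTD; exact: h. Qed.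

Lemma sigma_algebra_setI A B : F A -> F B -> F (A `&` B).
Proof.
by move=> FA FB; have := @measurableI _ TF A B;
  rewrite /measurable /= (sigma_algebra_id sF); apply.
Qed.

Lemma sigma_algebra_setU A B : F A -> F B -> F (A `|` B).
Proof.
move=> FA FB; rewrite -(setCK (A `|` B)) setCU.
by apply: sigma_algebra_setC; apply: sigma_algebra_setI; exact: sigma_algebra_setC.
Qed.

Lemma fmeas_set (Y : T -> R) B : fmeas F Y -> measurable B -> F (Y @^-1` B).
Proof. by move=> h mB; apply: h; exists B => //; rewrite setTI. Qed.

Lemma fmeas_cst (k : R) : fmeas F (fun _ => k).
Proof. by apply/fmeasP; exact: measurable_cst. Qed.

Lemma fmeasD (X Y : T -> R) : fmeas F X -> fmeas F Y ->
  fmeas F (fun w => X w + Y w).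
Proof. by move=> /fmeasP mX /fmeasP mY; apply/fmeasP; exact: measurable_funD. Qed.

Lemma fmeasM (X Y : T -> R) : fmeas F X -> fmeas F Y ->
  fmeas F (fun w => X w * Y w).
Proof. by move=> /fmeasP mX /fmeasP mY; apply/fmeasP; exact: measurable_funM. Qed.

Lemma fmeasZ k (X : T -> R) : fmeas F X -> fmeas F (fun w => k * X w).
Proof. by apply: fmeasM; exact: fmeas_cst. Qed.

Lemma fmeasN (X : T -> R) : fmeas F X -> fmeas F (fun w => - X w).
Proof.
move=> h; rewrite (_ : (fun w => _) = fun w => -1 * X w); first exact: fmeasZ.
by apply/funext => w; rewrite mulN1r.
Qed.

Lemma fmeas_sum (I : Type) (r : seq I) (X : I -> T -> R) :
  (forall i, fmeas F (X i)) -> fmeas F (fun w => \sum_(i <- r) X i w).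
Proof.
move=> h; elim: r => [|i r IH].
  by under eq_fun do rewrite big_nil; exact: fmeas_cst.
by under eq_fun do rewrite big_cons; apply: fmeasD.
Qed.

Lemma mx_measurableP (p q : nat) (X : T -> 'M[R]_(p, q)) :
  mx_measurable F X <-> forall i j, fmeas F (fun w => X w i j).
Proof.
split=> [h i j A hA|h A [i [j hA]]]; first by apply: h; exists i, j.
exact: h hA.
Qed.

Lemma mx_measurableD (p q : nat) (X Y : T -> 'M[R]_(p, q)) :
  mx_measurable F X -> mx_measurable F Y -> mx_measurable F (fun w => X w + Y w).
Proof.
move=> /mx_measurableP hX /mx_measurableP hY; apply/mx_measurableP => i j.
by under eq_fun do rewrite mxE; exact: fmeasD.
Qed.

Lemma mx_measurableZ (p q : nat) k (X : T -> 'M[R]_(p, q)) :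
  mx_measurable F X -> mx_measurable F (fun w => k *: X w).
Proof.
move=> /mx_measurableP hX; apply/mx_measurableP => i j.
by under eq_fun do rewrite mxE; exact: fmeasZ.
Qed.

Lemma mx_measurableB (p q : nat) (X Y : T -> 'M[R]_(p, q)) :
  mx_measurable F X -> mx_measurable F Y -> mx_measurable F (fun w => X w - Y w).
Proof.
move=> hX hY; apply: mx_measurableD => //.
by under eq_fun do rewrite -scaleN1r; exact: mx_measurableZ.
Qed.

Lemma mx_measurable_cst (p q : nat) (A : 'M[R]_(p, q)) :
  mx_measurable F (fun _ => A).
Proof. by apply/mx_measurableP => i j; exact: fmeas_cst. Qed.

Lemma mx_measurableBc (p q : nat) (X : T -> 'M[R]_(p, q)) (A : 'M[R]_(p, q)) :
  mx_measurable F X -> mx_measurable F (fun w => X w - A).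
Proof. by move=> hX; apply: mx_measurableB => //; exact: mx_measurable_cst. Qed.

Lemma mx_measurableM (p q r : nat) (X : T -> 'M[R]_(p, q))
    (Y : T -> 'M[R]_(q, r)) :
  mx_measurable F X -> mx_measurable F Y -> mx_measurable F (fun w => X w *m Y w).
Proof.
move=> /mx_measurableP hX /mx_measurableP hY; apply/mx_measurableP => i j.
by under eq_fun do rewrite mxE; apply: fmeas_sum => k; exact: fmeasM.
Qed.

Lemma mx_measurableT (p q : nat) (X : T -> 'M[R]_(p, q)) :
  mx_measurable F X -> mx_measurable F (fun w => (X w)^T).
Proof.
move=> /mx_measurableP hX; apply/mx_measurableP => i j.
by under eq_fun do rewrite mxE; exact: hX.
Qed.

Lemma fmeas_dotcv (n : nat) (X Y : T -> 'cV[R]_n) :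
  mx_measurable F X -> mx_measurable F Y -> fmeas F (fun w => dotcv (X w) (Y w)).
Proof.
move=> hX hY; have /mx_measurableP := mx_measurableM (mx_measurableT hX) hY.
by apply.
Qed.

Lemma fmeas_sqn (n : nat) (X : T -> 'cV[R]_n) :
  mx_measurable F X -> fmeas F (fun w => sqn (X w)).
Proof. by move=> hX; exact: fmeas_dotcv. Qed.

Lemma fmeas_wnorm2 (n : nat) M (X : T -> 'cV[R]_n) :
  mx_measurable F X -> fmeas F (fun w => wnorm2 M (X w)).
Proof.
move=> hX; under eq_fun do rewrite wnorm2E.
by apply: fmeas_dotcv => //; apply: mx_measurableM => //; exact: mx_measurable_cst.
Qed.

Lemma rational_approx n (v : 'cV[R]_n) (r : R) : 0 < r ->
  exists a : 'cV[rat]_n, forall k, `|v k 0 - ratr (a k 0)| < r.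
Proof.
move=> r0; have hq k : exists t : rat, `|v k 0 - ratr t| < r.
  have vr : v k 0 - r < v k 0 + r by lra.
  have [t] := rat_in_itvoo vr; rewrite in_itv /= => tI; exists t.
  by rewrite ltr_norml; lra.
by exists (\col_k sval (cid (hq k))) => k; rewrite mxE; case: cid.
Qed.

(** An open set is the union of the rational balls that it contains, and the
    preimage of a ball of the max norm is a finite intersection. *)
Lemma fmeas_continuous (n : nat) (g : 'cV[R]_n -> R) (X : T -> 'cV[R]_n) :
  continuous g -> mx_measurable F X -> fmeas F (fun w => g (X w)).
Proof.
move=> cg /mx_measurableP hX; apply/fmeasP.
apply: (measurability _ (RGenOpens.measurableE R)).
move=> _ [_ [a [b ->] <-]]; rewrite setTI.
set U := g @^-1` `]a, b[%classic.
have oU : open U by apply: open_comp; [by move=> x _; exact: cg|exact: interval_open].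
pose B (i : 'cV[rat]_n * rat) := [set v : 'cV[R]_n | forall k,
  `|v k 0 - ratr (i.1 k 0)| < ratr i.2].
have -> : (fun w => g (X w)) @^-1` `]a, b[%classic =
    \bigcup_(i in [set i | B i `<=` U]) (X @^-1` B i).
  apply/seteqP; split=> [w Uw|w [i BU Bw]]; last exact: BU.
  pose v := X w; have Uv : U v by [].
  have : nbhs v U by apply: open_nbhs_nbhs.
  move=> /nbhs_ballP[e /= e0 eU].
  have e2 : 0 < e / 2 by lra.
  have [r] := rat_in_itvoo e2.
  rewrite in_itv /= => /andP[r0 re].
  have [q hq] := rational_approx v r0.
  exists (q, r); last by move=> k; exact: hq.
  move=> z /= Bz; apply: eU; rewrite -ball_normE /ball_ /=.
  apply: (@le_lt_trans _ _ (2 * ratr r)); last by lra.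
  apply: norm_le_coord => [|k j]; first by rewrite mulr_ge0 // ltW.
  rewrite ord1 !mxE; have := Bz k; have := hq k.
  by set t := ratr _; rewrite /= !ltr_norml ler_norml; lra.
rewrite bigcup_mkcond; apply: countable_bigcupT_measurable => [|i].
  exact: countableP.
case: ifP => // _.
have -> : X @^-1` B i = \bigcap_(k in [set: 'I_n])
    ((fun w => X w k 0) @^-1` [set y | `|y - ratr (i.1 k 0)| < ratr i.2]).
  by apply/seteqP; split=> w h k; [move=> _|]; exact: h.
apply: fin_bigcap_measurable; first exact: finite_finset.
move=> k _; rewrite /measurable /= (sigma_algebra_id sF).
apply: (fmeas_set (hX k 0)).
have := @measurable_ball R (ratr (i.1 k 0)) (ratr i.2).
congr measurable; apply/seteqP; split=> y; rewrite -ball_normE /ball_ /= distrC //.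
Qed.

Lemma mx_measurable_continuous (n p q : nat) (g : 'cV[R]_n -> 'M[R]_(p, q))
    (X : T -> 'cV[R]_n) :
  continuous g -> mx_measurable F X -> mx_measurable F (fun w => g (X w)).
Proof.
move=> cg hX; apply/mx_measurableP => i j.
apply: (@fmeas_continuous n (fun v => g v i j)) => // v.
exact: (@cvg_coord _ _ (nbhs v) _ p q g (g v) i j (cg v)).
Qed.

End Fmeas.

(** ** Conditional moments *)

Section Expectation.
Context {R : realType} {d : measure_display} {T : measurableType d}.
Variable P : probability T R.
Implicit Types (X Y Z : T -> R) (A B : set T) (F : set (set T)).

Definition L1 X := P.-integrable setT (EFin \o X).

(** Conditional expectations are handled through the integrals over the events
    of the conditioning sigma-algebra: a conditional inequality is a family of
    inequalities between such integrals, which avoids choosing versions. *)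
Definition EA A X : R := \int[P]_(w in A) X w.

Lemma L1_measurable X : L1 X -> measurable_fun setT X.
Proof. by move=> /measurable_int /measurable_EFinP. Qed.

Lemma L1_cst k : L1 (fun _ => k).
Proof. exact: finite_measure_integrable_cst. Qed.

Lemma L1D X Y : L1 X -> L1 Y -> L1 (fun w => X w + Y w).
Proof.
move=> hX hY; have := integrableD measurableT hX hY.
by apply: eq_integrable => // w _ /=; rewrite EFinD.
Qed.

Lemma L1Z k X : L1 X -> L1 (fun w => k * X w).
Proof.
move=> hX; have := integrableZl measurableT k hX.
by apply: eq_integrable => // w _ /=; rewrite EFinM.
Qed.

Lemma L1N X : L1 X -> L1 (fun w => - X w).
Proof.
move=> hX; have := L1Z (-1) hX; apply: eq_integrable => // w _ /=.
by rewrite mulN1r.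
Qed.

Lemma L1B X Y : L1 X -> L1 Y -> L1 (fun w => X w - Y w).
Proof. by move=> hX hY; apply: L1D => //; exact: L1N. Qed.

Lemma L1_sum (I : Type) (r : seq I) (X : I -> T -> R) :
  (forall i, L1 (X i)) -> L1 (fun w => \sum_(i <- r) X i w).
Proof.
move=> h; elim: r => [|i r IH].
  by under eq_fun do rewrite big_nil; exact: L1_cst.
by under eq_fun do rewrite big_cons; apply: L1D.
Qed.

Lemma L1_le X Y : measurable_fun setT X -> L1 Y ->
  (forall w, `|X w| <= Y w) -> L1 X.
Proof.
move=> mX hY XY; apply: (le_integrable measurableT _ _ hY).
  exact/measurable_EFinP.
move=> w _ /=; rewrite lee_fin; apply: le_trans (XY w) _; exact: ler_norm.
Qed.

Lemma L1_ge0_le X Y : measurable_fun setT X -> L1 Y ->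
  (forall w, 0 <= X w <= Y w) -> L1 X.
Proof.
move=> mX hY XY; apply: (L1_le mX hY) => w.
by have /andP[X0 XYw] := XY w; rewrite ger0_norm.
Qed.

Lemma L1_norm X : L1 X -> L1 (fun w => `|X w|).
Proof.
by move=> hX; have := integrable_abse hX; apply: eq_integrable.
Qed.

Section EA.
Variable A : set T.
Hypothesis mA : measurable A.

Lemma L1S X : L1 X -> P.-integrable A (EFin \o X).
Proof. by move=> hX; exact: integrableS hX. Qed.

Lemma EA_EFin X : L1 X -> (EA A X)%:E = (\int[P]_(w in A) (X w)%:E)%E.
Proof. by move=> hX; rewrite fineK //; exact/integrable_fin_num/L1S. Qed.

Lemma EAD X Y : L1 X -> L1 Y -> EA A (fun w => X w + Y w) = EA A X + EA A Y.
Proof. by move=> hX hY; apply: RintegralD => //; exact: L1S. Qed.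

Lemma EAB X Y : L1 X -> L1 Y -> EA A (fun w => X w - Y w) = EA A X - EA A Y.
Proof. by move=> hX hY; apply: RintegralB => //; exact: L1S. Qed.

Lemma EAZ k X : L1 X -> EA A (fun w => k * X w) = k * EA A X.
Proof. by move=> hX; apply: RintegralZl => //; exact: L1S. Qed.

Lemma EA_le X Y : L1 X -> L1 Y -> (forall w, A w -> X w <= Y w) ->
  EA A X <= EA A Y.
Proof. by move=> hX hY h; apply: le_Rintegral => //; exact: L1S. Qed.

Lemma EA_ge0 X : (forall w, 0 <= X w) -> 0 <= EA A X.
Proof. by move=> h; exact: Rintegral_ge0. Qed.

Lemma EA_cst k : EA A (fun _ => k) = k * fine (P A).
Proof. exact: Rintegral_cst. Qed.

Lemma EA_cst_le k : 0 <= k -> EA A (fun _ => k) <= k.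
Proof.
move=> k0; rewrite EA_cst ler_piMr //.
by rewrite -lee_fin fineK ?fin_num_measure // probability_le1.
Qed.

Lemma EA_sum (I : Type) (r : seq I) (X : I -> T -> R) :
  (forall i, L1 (X i)) ->
  EA A (fun w => \sum_(i <- r) X i w) = \sum_(i <- r) EA A (X i).
Proof.
move=> h; elim: r => [|i r IH].
  under eq_fun do rewrite big_nil; rewrite big_nil EA_cst mul0r //.
under eq_fun do rewrite big_cons; rewrite big_cons EAD //; last exact: L1_sum.
by rewrite IH.
Qed.

End EA.

Lemma EA_subset A B X : measurable A -> measurable B -> A `<=` B ->
  L1 X -> (forall w, 0 <= X w) -> EA A X <= EA B X.
Proof.
move=> mA mB AB hX X0; rewrite -lee_fin !EA_EFin //.
apply: ge0_subset_integral => //; last by move=> w _; rewrite lee_fin.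
apply: measurable_funTS; apply/measurable_EFinP; exact: L1_measurable.
Qed.

Lemma EA_setID A B X : measurable A -> measurable B -> L1 X ->
  EA A X = EA (A `&` B) X + EA (A `\` B) X.
Proof.
move=> mA mB hX; rewrite -{1}(setUIDK A B) /EA Rintegral_setU //.
- exact: measurableI.
- exact: measurableD.
- by apply: L1S => //; rewrite setUIDK.
- by rewrite disj_set2E; apply/eqP; rewrite setDE setIACA setICr setI0.
Qed.

Lemma fmeas_measurable F X : sub_sigma_algebra_of F -> fmeas F X ->
  measurable_fun setT X.
Proof.
move=> [_ Fm] FX _ B mB; apply: Fm; apply: FX; by exists B.
Qed.

Import HBNNSimple.

(** A comparison of integrals on all events of [F] extends from indicators to
    nonnegative [F]-measurable weights by monotone approximation. *)
Lemma weighted_le F X1 X2 Z A : sub_sigma_algebra_of F ->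
  measurable_fun setT X1 -> measurable_fun setT X2 ->
  (forall w, 0 <= X1 w) -> (forall w, 0 <= X2 w) ->
  (forall B, F B -> (\int[P]_(w in B) (X1 w)%:E <= \int[P]_(w in B) (X2 w)%:E)%E) ->
  fmeas F Z -> (forall w, 0 <= Z w) -> F A ->
  (\int[P]_(w in A) (Z w * X1 w)%:E <= \int[P]_(w in A) (Z w * X2 w)%:E)%E.
Proof.
move=> [sF Fm] mX1 mX2 X10 X20 X12 /(fmeasP sF) mZ Z0 FA.
have FE := sigma_algebra_id sF; have mA : measurable A by exact: Fm.
pose TF := g_sigma_algebraType F.
have mTF : measurable (A : set TF) by rewrite /measurable /= FE.
have mZA : measurable_fun (A : set TF) (EFin \o Z : TF -> \bar R).
  by apply: measurable_funTS; apply/measurable_EFinP.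
pose h := nnsfun_approx mTF mZA.
have hF n : fmeas F (h n : T -> R) by apply/(fmeasP sF); exact: measurable_funPT.
have mh n : measurable_fun setT (h n : T -> R).
  by apply: fmeas_measurable (hF n).
have cv X : measurable_fun setT X -> (forall w, 0 <= X w) ->
    (\int[P]_(w in A) ((h n w) * X w)%:E @[n --> \oo] -->
       \int[P]_(w in A) (Z w * X w)%:E)%E.
  move=> mX X0.
  have -> : (\int[P]_(w in A) (Z w * X w)%:E =
     \int[P]_(w in A) (limn (fun n => ((h n w) * X w)%:E)))%E.
    apply: eq_integral => w; rewrite inE => Aw; apply/esym/cvg_lim => //.
    under eq_fun do rewrite EFinM; rewrite EFinM.
    apply: cvgeZr => //.
    by apply: (@cvg_nnsfun_approx _ _ _ _ mTF _ mZA _ w Aw) => v _; rewrite lee_fin.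
  apply: cvg_monotone_convergence => //.
  - move=> n; apply: measurable_funTS; apply/measurable_EFinP.
    exact: measurable_funM.
  - by move=> n w _; rewrite lee_fin mulr_ge0.
  - move=> w _ a b ab; rewrite lee_fin ler_wpM2r //.
    have /lefP := @nd_nnsfun_approx _ TF _ _ mTF _ mZA a b ab.
    exact.
apply: (lee_cvg_to (cv _ mX1 X10) (cv _ mX2 X20)); apply: nearW => n.
have simple X : measurable_fun setT X -> (forall w, 0 <= X w) ->
   (\int[P]_(w in A) ((h n w) * X w)%:E = \sum_(y \in range (h n))
       (y%:E * \int[P]_(w in A `&` h n @^-1` [set y]) (X w)%:E))%E.
  move=> mX X0.
  have mi y : measurable (h n @^-1` [set y] : set T).
    by apply: Fm; apply: fmeas_set (hF n) _ => //.
  transitivity (\int[P]_(w in A) (\sum_(y \in range (h n))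
      (y * \1_(h n @^-1` [set y]) w)%:E * (X w)%:E))%E.
    apply: eq_integral => w _; rewrite EFinM.
    rewrite (fimfunE (h n) w) -fsumEFin // ge0_mule_fsuml // => y.
    exact: nnfun_muleindic_ge0.
  rewrite ge0_integral_fsum//.
  - apply: eq_fsbigr => y; rewrite inE => -[t _ <-].
    under eq_integral do rewrite EFinM -muleA.
    rewrite ge0_integralZl ?lee_fin //.
    + congr (_ * _)%E; rewrite integral_mkcondr; apply: eq_integral => w _.
      by rewrite epatch_indic /= muleC.
    + apply: measurable_funTS; apply: emeasurable_funM; apply/measurable_EFinP.
        exact: measurable_indic.
      by [].
    + by move=> w _; rewrite mule_ge0 ?lee_fin.
  - move=> y; apply: measurable_funTS; apply: emeasurable_funM.
      apply/measurable_EFinP; apply: measurable_funM => //.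
    exact/measurable_EFinP.
  - move=> y w _; apply: mule_ge0; last by rewrite lee_fin.
    exact: nnfun_muleindic_ge0.
rewrite (simple _ mX1 X10) (simple _ mX2 X20).
apply: lee_fsum => // y [t _ <-]; rewrite lee_wpmul2l ?lee_fin //.
by apply: X12; apply: (sigma_algebra_setI sF) => //; apply: fmeas_set (hF n) _.
Qed.

(** The weight [Z] is known, so it factors out of the conditional expectation;
    the version [Y] of the latter may exceed [b] on a null set, hence the
    truncation [Num.min (Y w) b]. *)
Lemma cond_exp_le_weighted F X b Z A : sub_sigma_algebra_of F -> 0 <= b ->
  cond_exp_le P F X b -> (forall w, 0 <= X w) ->
  fmeas F Z -> (forall w, 0 <= Z w) -> L1 Z -> F A ->
  L1 (fun w => Z w * X w) /\ EA A (fun w => Z w * X w) <= b * EA A Z.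
Proof.
move=> sF b0 [Y [iX iY FY XY] Yb] X0 FZ Z0 iZ FA; have [sF1 Fm] := sF.
have mX := L1_measurable iX; have mY := L1_measurable iY.
have mZ : measurable_fun setT Z := fmeas_measurable sF FZ.
have key B : F B ->
    (\int[P]_(w in B) (X w)%:E <= \int[P]_(w in B) (cst b w)%:E)%E.
  move=> FB; rewrite -XY //; have mB := Fm _ FB.
  pose Yb' w := Num.min (Y w) b.
  have mYb' : measurable_fun setT Yb' by exact: measurable_minr.
  have iYb' : L1 Yb'.
    apply: (L1_le mYb' (L1D (L1_norm iY) (L1_cst b))) => w.
    rewrite /Yb' /Order.min; case: ifP => _; first by rewrite lerDl.
    by rewrite ger0_norm // lerDr.
  have -> : (\int[P]_(w in B) (Y w)%:E = \int[P]_(w in B) (Yb' w)%:E)%E.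
    apply: ae_eq_integral => //.
    - by apply: measurable_funTS; exact/measurable_EFinP.
    - by apply: measurable_funTS; exact/measurable_EFinP.
    - by move: Yb; apply: filterS => w Yw _; rewrite /Yb' min_l.
  apply: le_integral => //; [exact: (L1S mB iYb')|exact: (L1S mB (L1_cst b))|].
  by move=> w _ /=; rewrite lee_fin /Yb' ge_min lexx orbT.
have comp A' : F A' -> (\int[P]_(w in A') (Z w * X w)%:E <=
    \int[P]_(w in A') (Z w * b)%:E)%E.
  by move=> FA'; exact: (weighted_le (X2 := cst b) sF mX _ X0 _ key FZ Z0 FA').
have iZb : L1 (fun w => Z w * b).
  by under eq_fun do rewrite mulrC; exact: L1Z.
have iZX : L1 (fun w => Z w * X w).
  apply/integrableP; split.
    by apply/measurable_EFinP; exact: measurable_funM.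
  under eq_integral do rewrite /= ger0_norm ?mulr_ge0 //.
  apply: le_lt_trans (comp setT _) _.
    by case: sF1 => h0 hC _; rewrite -(setD0 setT); exact: hC.
  move/integrableP: iZb => [_]; apply: le_lt_trans.
  apply: ge0_le_integral => //.
  - by move=> w _; rewrite lee_fin mulr_ge0.
  - by apply/measurable_EFinP; exact: measurable_funM.
  - by apply/measurable_EFinP; apply: measurableT_comp => //; exact: measurable_funM.
  - by move=> w _; rewrite lee_fin ler_norm.
split=> //; have mA := Fm _ FA.
have -> : b * EA A Z = EA A (fun w => Z w * b).
  by rewrite -EAZ //; apply: eq_Rintegral => w _; rewrite mulrC.
by rewrite -lee_fin !EA_EFin //; exact: comp.
Qed.

Lemma pos_neg_parts F Z : sigma_algebra setT F -> fmeas F Z ->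
  exists Zp Zn, [/\ fmeas F Zp, fmeas F Zn, forall w, 0 <= Zp w <= `|Z w|,
    forall w, 0 <= Zn w <= `|Z w| & forall w, Z w = Zp w - Zn w].
Proof.
move=> sF FZ; exists (fun w => Num.max (Z w) 0), (fun w => Num.max (- Z w) 0).
have FM (Y : T -> R) : fmeas F Y -> fmeas F (fun w => Num.max (Y w) 0).
  move=> FY; apply/(fmeasP sF); apply: measurable_maxr => //.
  exact/(fmeasP sF).
split=> [| |w|w|w]; first exact: FM.
- by apply: FM; exact: (fmeasN sF).
- by rewrite le_max lexx orbT ge_max ler_norm normr_ge0.
- by rewrite le_max lexx orbT ge_max -normrN ler_norm normr_ge0.
- by case: (ltP (Z w) 0) => ?; case: (ltP (- Z w) 0) => ?; lra.
Qed.

(** A bounded conditional second moment makes the product with an integrable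
    weight integrable, so the weight factors out of the centred variable. *)
Lemma cond_centered F X N2 b Z A : sub_sigma_algebra_of F -> 0 <= b ->
  L1 X -> (forall B, F B -> EA B X = 0) ->
  cond_exp_le P F N2 b -> (forall w, X w ^+ 2 <= N2 w) ->
  fmeas F Z -> L1 Z -> F A ->
  L1 (fun w => Z w * X w) /\ EA A (fun w => Z w * X w) = 0.
Proof.
move=> sF b0 iX X0 cN XN FZ iZ FA; have [sF1 Fm] := sF.
have mX := L1_measurable iX; have mZ := fmeas_measurable sF FZ.
have mA := Fm _ FA.
have smT : sigma_algebra setT (@measurable d T) by exact: sigma_algebra_measurable.
have fmeas_of Y : measurable_fun setT Y -> fmeas measurable Y.
  by move=> mY _ [B mB <-]; exact: mY.
have measurable_of Y : fmeas measurable Y -> measurable_fun setT Y.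
  by move=> mY _ B mB; apply: mY; exists B.
have key Z' : fmeas F Z' -> (forall w, 0 <= Z' w) -> L1 Z' ->
    L1 (fun w => Z' w * X w) /\ EA A (fun w => Z' w * X w) = 0.
  move=> FZ' Z'0 iZ'; have mZ' := fmeas_measurable sF FZ'.
  have [|iZN _] := cond_exp_le_weighted sF b0 cN _ FZ' Z'0 iZ' FA.
    by move=> w; apply: le_trans (sqr_ge0 _) (XN w).
  have dom (Y : T -> R) : measurable_fun setT Y -> (forall w, `|Y w| <= `|X w|) ->
      L1 (fun w => Z' w * Y w).
    move=> mY YX; apply: (L1_le _ (L1D iZ' iZN)); first exact: measurable_funM.
    move=> w; rewrite normrM ger0_norm // -{2}(mulr1 (Z' w)) -mulrDr.
    rewrite ler_wpM2l //; apply: (le_trans (YX w)).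
    have := XN w; rewrite -[X w ^+ 2]real_normK ?num_real //.
    have := normr_ge0 (X w); nra.
  have [Xp [Xn [mXp mXn Xp0 Xn0 Xpn]]] := pos_neg_parts smT (fmeas_of _ mX).
  have {}mXp := measurable_of _ mXp; have {}mXn := measurable_of _ mXn.
  have lp w : `|Xp w| <= `|X w| by case/andP: (Xp0 w) => /ger0_norm ->.
  have ln w : `|Xn w| <= `|X w| by case/andP: (Xn0 w) => /ger0_norm ->.
  have {}Xp0 w : 0 <= Xp w by case/andP: (Xp0 w).
  have {}Xn0 w : 0 <= Xn w by case/andP: (Xn0 w).
  have iXp : L1 Xp by apply: (L1_le mXp (L1_norm iX)).
  have iXn : L1 Xn by apply: (L1_le mXn (L1_norm iX)).
  have eqB B : F B -> (\int[P]_(w in B) (Xp w)%:E = \int[P]_(w in B) (Xn w)%:E)%E.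
    move=> FB; have mB := Fm _ FB; rewrite -!EA_EFin //; congr EFin.
    have := X0 _ FB; rewrite (_ : X = fun w => Xp w - Xn w); last exact/funext.
    by rewrite EAB // => /eqP; rewrite subr_eq0 => /eqP.
  have iZp := dom _ mXp lp; have iZn := dom _ mXn ln.
  split; first exact: dom.
  have -> : EA A (fun w => Z' w * X w) =
      EA A (fun w => Z' w * Xp w) - EA A (fun w => Z' w * Xn w).
    rewrite -EAB //; apply: eq_Rintegral => w _.
    by rewrite Xpn mulrBr.
  apply/eqP; rewrite subr_eq0 eq_le -!lee_fin !EA_EFin //.
  apply/andP; split; apply: (weighted_le sF) => // B FB.
    by rewrite eqB.
  by rewrite eqB.
have [Zp [Zn [FZp FZn Zp1 Zn1 Zpn]]] := pos_neg_parts sF1 FZ.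
have Zp0 w : 0 <= Zp w by case/andP: (Zp1 w).
have Zn0 w : 0 <= Zn w by case/andP: (Zn1 w).
have iZp := L1_ge0_le (fmeas_measurable sF FZp) (L1_norm iZ) Zp1.
have iZn := L1_ge0_le (fmeas_measurable sF FZn) (L1_norm iZ) Zn1.
have [i1 e1] := key _ FZp Zp0 iZp; have [i2 e2] := key _ FZn Zn0 iZn.
have E : (fun w => Z w * X w) = (fun w => Zp w * X w - Zn w * X w).
  by apply/funext => w; rewrite Zpn mulrBl.
rewrite E; split; first exact: L1B.
by rewrite EAB // e1 e2 subrr.
Qed.

Lemma cond_centered_diff F X Y N2 b Z A : sub_sigma_algebra_of F -> 0 <= b ->
  is_cond_exp P F X Y -> cond_exp_le P F N2 b ->
  (forall w, (X w - Y w) ^+ 2 <= N2 w) -> fmeas F Z -> L1 Z -> F A ->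
  L1 (fun w => Z w * (X w - Y w)) /\ EA A (fun w => Z w * (X w - Y w)) = 0.
Proof.
move=> sF b0 [iX iY _ XY] cN XN; apply: (cond_centered sF b0 _ _ cN XN).
  exact: L1B.
move=> B FB; have mB := sF.2 _ FB; rewrite EAB //.
by apply/eqP; rewrite subr_eq0; apply/eqP/EFin_inj; rewrite !EA_EFin // XY.
Qed.

End Expectation.

(** * Almost supermartingales *)

Section RealSequences.
Context {R : realType}.
Implicit Types (v t eta : nat -> R).

Lemma nondecreasing_bounded_cvg v M : (forall k, v k <= v k.+1) ->
  (forall k, v k <= M) -> cvgn v.
Proof.
move=> nd vM; apply: nondecreasing_is_cvgn.
  by apply/nondecreasing_seqP.
by exists M => _ [k _ <-].
Qed.

Lemma cvgn_bounded v : cvgn v -> exists B, forall k, v k <= B.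
Proof.
move=> /cvg_seq_bounded[B [_ hB]]; exists (B + 1) => k.
have := hB (B + 1); rewrite ltrDl ltr01 => /(_ isT k I).
exact: le_trans (ler_norm _).
Qed.

Lemma nonincreasing_bounded_cvg v M : (forall k, v k.+1 <= v k) ->
  (forall k, M <= v k) -> cvgn v.
Proof.
move=> nd vM; apply: nonincreasing_is_cvgn.
  by apply/nonincreasing_seqP.
by exists M => _ [k _ <-].
Qed.

Section AlmostDecreasing.
Variables (eta : nat -> R) (M : R).
Hypothesis eta_ge0 : forall k, 0 <= eta k.
Hypothesis eta_le : forall K, \sum_(k < K) eta k <= M.

Definition growth k := \prod_(j < k) (1 + eta j).
Definition mass k := \sum_(j < k) eta j.

Lemma growthS k : growth k.+1 = growth k * (1 + eta k).
Proof. by rewrite /growth big_ord_recr. Qed.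

Lemma massS k : mass k.+1 = mass k + eta k.
Proof. by rewrite /mass big_ord_recr. Qed.

Lemma growth_ge1 k : 1 <= growth k.
Proof.
elim: k => [|k IH]; first by rewrite /growth big_ord0.
by rewrite growthS; have := eta_ge0 k; nra.
Qed.

Lemma growth_gt0 k : 0 < growth k.
Proof. exact: lt_le_trans ltr01 (growth_ge1 k). Qed.

(** [1 + t <= exp t]. *)
Lemma growth_le k : growth k <= expR M.
Proof.
apply: (@le_trans _ _ (expR (mass k))); last by rewrite ler_expR eta_le.
elim: k => [|k IH]; first by rewrite /growth /mass !big_ord0 expR0.
rewrite growthS massS expRD ler_pM ?(ltW (growth_gt0 _)) ?addr_ge0 //.
exact: expR_ge1Dx.
Qed.

Lemma growth_cvg : cvgn growth.
Proof.
apply: (nondecreasing_bounded_cvg (M := expR M)) => k; last exact: growth_le.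
by rewrite growthS ler_peMr ?(ltW (growth_gt0 _)) // lerDl.
Qed.

Lemma mass_cvg : cvgn mass.
Proof.
apply: (nondecreasing_bounded_cvg (M := M)) => k; last exact: eta_le.
by rewrite massS lerDl.
Qed.

(** Dividing by the accumulated growth and charging the remaining mass turns
    an almost nonincreasing sequence into a nonincreasing one. *)
Definition discount v k := v k / growth k + (M - mass k).

Lemma discountK v k : v k = (discount v k - (M - mass k)) * growth k.
Proof. by rewrite /discount addrK divfK // gt_eqF // growth_gt0. Qed.

Lemma cvg_discount v : cvgn (discount v) -> cvgn v.
Proof.
move=> /cvg_ex[a ha]; have /cvg_ex[b hb] := mass_cvg.
have /cvg_ex[g hg] := growth_cvg.
apply/cvg_ex; exists ((a - (M - b)) * g); rewrite (funext (discountK v)).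
exact: cvgM (cvgB ha (cvgB (cvg_cst M) hb)) hg.
Qed.

Lemma discount_step v t k : 0 <= t k ->
  v k.+1 + t k <= (1 + eta k) * v k + eta k ->
  discount v k.+1 + t k / expR M <= discount v k.
Proof.
move=> t0 h; rewrite /discount massS.
have g0 := growth_gt0 k; have g1 := growth_gt0 k.+1.
have e0 := eta_ge0 k.
have h1 : t k / expR M <= t k / growth k.+1.
  by rewrite ler_wpM2l // lef_pV2 ?posrE ?expR_gt0 // growth_le.
have h2 : (v k.+1 + t k) / growth k.+1 <= v k / growth k + eta k.
  rewrite ler_pdivrMr // mulrDl; apply: (le_trans h).
  rewrite lerD // growthS.
    by rewrite mulrA divfK ?gt_eqF // mulrC.
  by rewrite ler_peMr // -growthS growth_ge1.
by move: h2; rewrite mulrDl; lra.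
Qed.

(** The deterministic form of the Robbins--Siegmund theorem. *)
Lemma almost_decreasing v t : (forall k, 0 <= v k) -> (forall k, 0 <= t k) ->
  (forall k, v k.+1 + t k <= (1 + eta k) * v k + eta k) ->
  [/\ cvgn v, exists B, forall k, v k <= B &
      exists B, forall K, \sum_(k < K) t k <= B].
Proof.
move=> v0 t0 h; have st k := discount_step (t0 k) (h k).
have te k : 0 <= t k / expR M by rewrite divr_ge0 // expR_ge0.
have d0 k : 0 <= discount v k.
  by rewrite addr_ge0 ?divr_ge0 ?(ltW (growth_gt0 _)) // subr_ge0 eta_le.
have cv : cvgn v.
  apply: cvg_discount; apply: (nonincreasing_bounded_cvg (M := 0)) => // k.
  by have := st k; have := te k; lra.
split=> //; first exact: cvgn_bounded.
exists (expR M * discount v 0) => K.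
have : \sum_(k < K) (t k / expR M) + discount v K <= discount v 0.
  elim: K => [|K IH]; first by rewrite big_ord0 add0r.
  by rewrite big_ord_recr /=; have := st K; lra.
rewrite -mulr_suml => hh; have := d0 K => dK.
rewrite -ler_pdivrMl ?expR_gt0 // mulrC; lra.
Qed.

End AlmostDecreasing.

(** The sequence has a finite cluster point, and no rational interval next to it
    is crossed infinitely often. *)
Lemma no_crossing_cvg v : (forall k, 0 <= v k) ->
  (forall a b : rat, a < b ->
     ~ (forall j, (exists2 k, (j <= k)%N & v k < ratr a) /\
                  (exists2 k, (j <= k)%N & ratr b < v k))) ->
  (exists N, forall j, exists2 k, (j <= k)%N & v k < N) ->
  cvgn v.
Proof.
move=> v0 nc [N hN].
have ev (a b : rat) : a < b ->
    (exists j, forall k, (j <= k)%N -> ratr a <= v k) \/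
    (exists j, forall k, (j <= k)%N -> v k <= ratr b).
  move=> ab; have /existsNP[j] := nc a b ab.
  move=> /not_andP[] /forall2NP h; [left|right]; exists j => k jk.
    by have [|/negP] := h k; rewrite ?jk // -leNgt.
  by have [|/negP] := h k; rewrite ?jk // -leNgt.
have [j0 [B hB]] : exists j0 B, forall k, (j0 <= k)%N -> v k <= B.
  have [a] := @rat_in_itvoo R N (N + 1) ltac:(by rewrite ltrDl).
  rewrite in_itv /= => /andP[Na _].
  have aa1 : a < a + 1 by rewrite ltrDl.
  have [[j hj]|[j hj]] := ev _ _ aa1.
    have [k jk vk] := hN j; have := hj k jk; lra.
  by exists j, (ratr (a + 1)).
(* Bolzano--Weierstrass, borrowed from the vectors of size one. *)
pose w k : 'cV[R]_1 := const_mx (v (j0 + k)%N).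
have wB k : enorm (w k) <= B.
  have vB : v (j0 + k)%N <= B by apply: hB; exact: leq_addr.
  rewrite enorm_le_sqn ?(le_trans (v0 _) vB) // sqnE big_ord1 mxE.
  by rewrite ler_sqr ?nnegrE // (le_trans (v0 _) vB).
have [pm hp] := bounded_seq_cluster wB; pose p := pm 0 0.
have {}hp e j : 0 < e -> exists2 k, (j <= k)%N & `|v k - p| < e.
  move=> e0; have [k jk] := hp (e ^+ 2) j (exprn_gt0 _ e0).
  rewrite sqnE big_ord1 !mxE -/p => h; exists (j0 + k)%N.
    by rewrite (leq_trans jk) // leq_addl.
  by rewrite -ltr_sqr ?nnegrE ?(ltW e0) // real_normK ?num_real.
apply/cvg_ex; exists p; apply/cvgrPdist_le => e e0.
have up : exists j, forall k, (j <= k)%N -> v k <= p + e.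
  have [a] := @rat_in_itvoo R p (p + e) ltac:(by rewrite ltrDl).
  rewrite in_itv /= => /andP[pa ae].
  have [b] := rat_in_itvoo ae; rewrite in_itv /= => /andP[ab be].
  rewrite ltr_rat in ab.
  have [[j hj]|[j hj]] := ev _ _ ab.
    have pa0 : 0 < ratr a - p by rewrite subr_gt0.
    have [k jk] := hp _ j pa0; have := hj k jk; rewrite ltr_norml; lra.
  by exists j => k jk; apply: le_trans (hj k jk) (ltW be).
have lo : exists j, forall k, (j <= k)%N -> p - e <= v k.
  have [b] := @rat_in_itvoo R (p - e) p ltac:(by rewrite gtrDl oppr_lt0).
  rewrite in_itv /= => /andP[eb bp].
  have [a] := rat_in_itvoo eb; rewrite in_itv /= => /andP[ea ab].
  rewrite ltr_rat in ab.
  have [[j hj]|[j hj]] := ev _ _ ab.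
    by exists j => k jk; apply: le_trans (ltW ea) (hj k jk).
  have bp0 : 0 < p - ratr b by rewrite subr_gt0.
  have [k jk] := hp _ j bp0; have := hj k jk; rewrite ltr_norml; lra.
have [j1 h1] := up; have [j2 h2] := lo.
exists (maxn j1 j2) => // k /=; rewrite geq_max => /andP[jk1 jk2].
by rewrite ler_norml; have := h1 k jk1; have := h2 k jk2; lra.
Qed.

End RealSequences.

Section Supermartingales.
Context {R : realType} {d : measure_display} {T : measurableType d}.
Variable P : probability T R.
Local Notation L1 := (L1 P).
Local Notation EA := (EA P).
Local Notation Pr A := (fine (P A)).

Lemma PrE A : measurable A -> P A = (Pr A)%:E.
Proof. by move=> mA; rewrite fineK // fin_num_measure. Qed.

Lemma Pr_ge0 A : 0 <= Pr A.
Proof. exact: fine_ge0. Qed.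

Lemma Pr_le1 A : measurable A -> Pr A <= 1.
Proof. by move=> mA; rewrite -lee_fin -PrE // probability_le1. Qed.

Lemma EA_ge_cst A X k : measurable A -> L1 X ->
  (forall w, A w -> k <= X w) -> k * Pr A <= EA A X.
Proof.
move=> mA iX h; rewrite -(EA_cst P mA); apply: EA_le => //; exact: L1_cst.
Qed.

Lemma negligible_small A : measurable A ->
  (forall e, 0 < e -> Pr A <= e) -> P.-negligible A.
Proof.
move=> mA h; apply/negligibleP => //; apply: etrans (PrE mA) _; congr EFin.
apply/eqP; rewrite eq_le Pr_ge0 andbT leNgt; apply/negP => p0.
by have := h (Pr A / 2) ltac:(lra); lra.
Qed.

Lemma ae_bigcupP (I : countType) (Q : I -> T -> Prop) :
  (forall i, {ae P, forall w, Q i w}) -> {ae P, forall w, forall i, Q i w}.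
Proof.
move=> h; have : {ae P, forall w, forall k : nat,
    if unpickle k is Some i then Q i w else True}.
  apply/ae_foralln => k; case: (unpickle k) => [i|]; first exact: h.
  exact: aeW.
by apply: filterS => w hw i; have := hw (pickle i); rewrite pickleK.
Qed.

Lemma measurable_setge (X : T -> R) a : measurable_fun setT X ->
  measurable ([set w | a <= X w] : set T).
Proof.
move=> mX; have := mX measurableT _ (measurable_itv `[a, +oo[).
rewrite setTI; congr measurable; apply/seteqP; split=> w /=; by rewrite in_itv /= andbT.
Qed.

(** Markov's inequality on the events that the sequence stays above [e] from
    some time on. *)
Lemma ae_frequently_small (Y : nat -> T -> R) :
  (forall k, L1 (Y k)) -> (forall k w, 0 <= Y k w) ->
  (forall e j, 0 < e -> exists2 k, (j <= k)%N & EA setT (Y k) <= e) ->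
  {ae P, forall w, forall e j, 0 < e -> exists2 k, (j <= k)%N & Y k w < e}.
Proof.
move=> iY Y0 h.
have key (i : nat * nat) : {ae P, forall w,
    exists2 k, (i.1 <= k)%N & Y k w < i.2.+1%:R^-1}.
  case: i => j n /=; set e := n.+1%:R^-1; have e0 : 0 < e by rewrite invr_gt0.
  pose B := \bigcap_(k in [set k | (j <= k)%N]) [set w | e <= Y k w].
  have mB : measurable B.
    apply: bigcap_measurableType => k _.
    by apply: measurable_setge; exact: L1_measurable (iY k).
  suff nB : P.-negligible B.
    apply: negligibleS nB => w /= hw k /= jk; rewrite leNgt; apply/negP => Yk.
    by apply: hw; exists k.
  apply: negligible_small => // e' e'0.
  have [k jk hk] := h (e * e') j (mulr_gt0 e0 e'0).
  rewrite -(ler_pM2l e0); apply: le_trans hk.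
  apply: (@le_trans _ _ (EA B (Y k))).
    by apply: EA_ge_cst => // w Bw; exact: Bw.
  by apply: EA_subset => //; exact: iY.
have := ae_bigcupP key; apply: filterS => w hw e j e0.
have [k jk hk] := hw (j, Num.truncn e^-1).
exists k => //=; apply: (lt_le_trans hk) => /=.
rewrite -[leRHS]invrK lef_pV2 ?posrE ?invr_gt0 //; apply: ltW.
exact: truncnS_gt.
Qed.

Section Filtration.
Variable F : nat -> set (set T).
Hypothesis sF : forall k, sub_sigma_algebra_of (F k).
Hypothesis F_nd : forall k, F k `<=` F k.+1.

Lemma F_measurable k A : F k A -> measurable A.
Proof. by move: (sF k) => [_]; apply. Qed.

Lemma fmeas_lt k (X : T -> R) a : fmeas (F k) X -> F k [set w | X w < a].
Proof.
move=> mX; have := fmeas_set mX (measurable_itv `]-oo, a[).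
by congr (F k); apply/seteqP; split=> w /=; rewrite in_itv.
Qed.

Lemma fmeas_le k (X : T -> R) a : fmeas (F k) X -> F k [set w | X w <= a].
Proof.
move=> mX; have := fmeas_set mX (measurable_itv `]-oo, a]).
by congr (F k); apply/seteqP; split=> w /=; rewrite in_itv.
Qed.

Section Upcrossing.
Variable Y : nat -> T -> R.
Hypothesis FY : forall k, fmeas (F k) (Y k).
Hypothesis iY : forall k, L1 (Y k).
Hypothesis Y0 : forall k w, 0 <= Y k w.
Hypothesis supermart : forall k A, F k A -> EA A (Y k.+1) <= EA A (Y k).

Section Interval.
Variables a b : R.
Hypothesis ab : a < b.
Hypothesis a0 : 0 <= a.

(** The holding set of the strategy that buys below [a] and sells above [b]. *)
Fixpoint hold k : set T := match k with
  | 0 => [set w | Y 0 w < a]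
  | k'.+1 => (hold k' `&` [set w | Y k'.+1 w <= b]) `|`
             (~` hold k' `&` [set w | Y k'.+1 w < a])
  end.

Lemma hold_F k : F k (hold k).
Proof.
elim: k => [|k IH]; first exact: fmeas_lt.
have sk := (sF k.+1).1; have IH' := F_nd IH.
apply: (sigma_algebra_setU sk); apply: (sigma_algebra_setI sk) => //.
- exact: fmeas_le.
- exact: sigma_algebra_setC.
- exact: fmeas_lt.
Qed.

Definition crossing k := hold k `&` [set w | b < Y k.+1 w].

Lemma measurable_crossing k : measurable (crossing k).
Proof.
apply: measurableI; first exact: F_measurable (hold_F k).
have : measurable (~` [set w | Y k.+1 w <= b]).
  by apply: measurableC; apply: (@F_measurable k.+1); exact: fmeas_le.
by congr measurable; apply/seteqP; split=> w /=; rewrite ltNge => /negP.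
Qed.

(** One round of trading in a supermartingale: holding it gains nothing in mean,
    and each sale above [b] cashes at least [b - a]. *)
Lemma crossing_step k :
  EA (hold k.+1) (fun w => Y k.+1 w - a) + (b - a) * Pr (crossing k) <=
  EA (hold k) (fun w => Y k w - a).
Proof.
have mh := F_measurable (hold_F k); have mc := measurable_crossing k.
have mh1 := F_measurable (hold_F k.+1).
have i1 : L1 (fun w => Y k.+1 w - a) by apply: L1B => //; exact: L1_cst.
pose Q := hold k `&` [set w | Y k.+1 w <= b].
have mQ : measurable Q.
  by apply: measurableI => //; apply: (@F_measurable k.+1); exact: fmeas_le.
have e1 : EA (hold k) (fun w => Y k.+1 w - a) =
    EA Q (fun w => Y k.+1 w - a) + EA (crossing k) (fun w => Y k.+1 w - a).
  rewrite (EA_setID mh mc i1) addrC; congr (EA _ _ + EA _ _).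
    apply/seteqP; split=> w [hw]; rewrite /crossing /=.
      by move=> /not_andP[//|/negP]; rewrite -leNgt => hb; split.
    by move=> hb; split=> // -[_]; rewrite /= ltNge hb.
  by rewrite setIidr // => w [].
have e2 : (b - a) * Pr (crossing k) <= EA (crossing k) (fun w => Y k.+1 w - a).
  by apply: EA_ge_cst => // w [_ /= /ltW h]; rewrite lerD2r.
have e3 : EA (hold k.+1) (fun w => Y k.+1 w - a) <= EA Q (fun w => Y k.+1 w - a).
  rewrite (EA_setID mh1 mQ i1) setIidr; last by move=> w Qw; left.
  rewrite gerDl; have mD : measurable (hold k.+1 `\` Q) by exact: measurableD.
  apply: (@le_trans _ _ (EA (hold k.+1 `\` Q) (fun _ => 0))).
    apply: EA_le => // [|w [[//|[_ /= /ltW h]] _]]; first exact: L1_cst.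
    by rewrite subr_le0.
  by rewrite EA_cst // mul0r.
have e4 : EA (hold k) (fun w => Y k.+1 w - a) <= EA (hold k) (fun w => Y k w - a).
  rewrite !EAB //; try exact: L1_cst.
  by rewrite lerD2r; exact: supermart (hold_F k).
lra.
Qed.

(** Doob's upcrossing inequality; the loss of the trader is at most [a] because
    the process is nonnegative. *)
Lemma crossing_sum n : (b - a) * \sum_(k < n) Pr (crossing k) <= a.
Proof.
have h : EA (hold n) (fun w => Y n w - a) +
    (b - a) * \sum_(k < n) Pr (crossing k) <= 0.
  elim: n => [|n IH].
    rewrite big_ord0 mulr0 addr0; have mh := F_measurable (hold_F 0).
    apply: (@le_trans _ _ (EA (hold 0) (fun _ => 0))).
      apply: EA_le => // [| |w /= /ltW h].
      - by apply: L1B => //; exact: L1_cst.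
      - exact: L1_cst.
      - by rewrite subr_le0.
    by rewrite EA_cst // mul0r.
  by rewrite big_ord_recr /= mulrDr; have := crossing_step n; lra.
have mh := F_measurable (hold_F n).
have : - a * Pr (hold n) <= EA (hold n) (fun w => Y n w - a).
  apply: EA_ge_cst => // [|w _]; first by apply: L1B => //; exact: L1_cst.
  by have := Y0 n w; lra.
have : a * Pr (hold n) <= a by rewrite ler_piMr // Pr_le1.
by move: h; lra.
Qed.

(** Borel--Cantelli. *)
Lemma ae_finitely_many_crossings : {ae P, forall w,
  exists j, forall k, (j <= k)%N -> ~ crossing k w}.
Proof.
have mc := measurable_crossing.
have P0 : P (lim_sup_set crossing) = 0%E.
  apply: lim_sup_set_cvg0 => //.
  apply: (@le_lt_trans _ _ (a / (b - a))%:E); last exact: ltry.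
  apply: lime_le; first by apply: is_cvg_nneseries.
  apply: nearW => n; rewrite (eq_bigr (fun k => (Pr (crossing k))%:E)).
    rewrite sumEFin lee_fin big_mkord ler_pdivlMr ?subr_gt0 // mulrC.
    exact: crossing_sum.
  by move=> k _; exact: PrE.
have ml : measurable (lim_sup_set crossing).
  apply: bigcap_measurableType => n _; exact: bigcup_measurable.
exists (lim_sup_set crossing); split=> // w /= hw n _.
apply: contrapT => hn; apply: hw; exists n => k nk ck; apply: hn; by exists k.
Qed.

(** After a visit below [a] the process is held until it exceeds [b], which is
    then a crossing. *)
Lemma finitely_many_crossings w :
  (exists j, forall k, (j <= k)%N -> ~ crossing k w) ->
  ~ (forall j, (exists2 k, (j <= k)%N & Y k w < a) /\
               (exists2 k, (j <= k)%N & b < Y k w)).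
Proof.
move=> [j hj] h; have [[k jk Yk] _] := h j.+1.
have hk : hold k w.
  case: k jk Yk => // k jk Yk /=.
  have [hw|hw] := pselect (hold k w); [left|right]; split=> //=.
  exact: ltW (lt_trans Yk ab).
have stay i : hold (k + i)%N w.
  elim: i => [|i IH]; first by rewrite addn0.
  rewrite addnS; left; split=> //=; rewrite leNgt; apply/negP => bY.
  by apply: (hj (k + i)%N) => //; rewrite (leq_trans _ (leq_addr _ _)) // ltnW.
have [_ [i ki bY]] := h k.+1.
apply: (hj i.-1); first by case: i ki bY => //= i ki _; exact: leq_trans (ltnW jk) ki.
case: i ki bY => //= i ki bY; split=> //.
by have ki' : (k <= i)%N by []; rewrite -(subnKC ki'); exact: stay.
Qed.

End Interval.

(** Markov's inequality on the events that the process stays above [N.+1] from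
    time [j] on, which increase with [j]. *)
Lemma ae_frequently_bounded : {ae P, forall w,
  exists N, forall j, exists2 k, (j <= k)%N & Y k w < N}.
Proof.
pose E0 := EA setT (Y 0).
have EY k : EA setT (Y k) <= E0.
  elim: k => // k; apply: le_trans; apply: supermart.
  by rewrite -setC0; apply: sigma_algebra_setC; [exact: (sF k).1|case: (sF k) => -[]].
have E00 : 0 <= E0 by exact: EA_ge0.
pose B (N j : nat) := \bigcap_(k in [set k | (j <= k)%N]) [set w | N.+1%:R <= Y k w].
have mB N j : measurable (B N j).
  apply: bigcap_measurableType => k _.
  by apply: measurable_setge; exact: L1_measurable (iY k).
have PB N j : Pr (B N j) <= E0 / N.+1%:R.
  rewrite ler_pdivlMr // mulrC; apply: le_trans (EY j).
  apply: (@le_trans _ _ (EA (B N j) (Y j))).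
    by apply: EA_ge_cst => // w; apply => /=.
  exact: EA_subset.
pose D N := \bigcup_j B N j.
have mD N : measurable (D N) by exact: bigcupT_measurable.
have PD N : Pr (D N) <= E0 / N.+1%:R.
  rewrite -lee_fin -PrE //.
  have ndB : nondecreasing_seq (B N).
    by move=> i j ij; apply/subsetPset => w Bw k /= jk; apply: Bw; exact: leq_trans jk.
  have /cvg_lim <- // := nondecreasing_cvg_mu (mu := P) (mB N) (mD N) ndB.
  apply: lime_le.
    by apply/cvg_ex; eexists; exact: (nondecreasing_cvg_mu (mB N) (mD N) ndB).
  by apply: nearW => j; rewrite /= PrE // lee_fin.
have nD : P.-negligible (\bigcap_N D N).
  have mI : measurable (\bigcap_N D N) by exact: bigcapT_measurable.
  apply: negligible_small => // e e0.
  pose N := Num.truncn (E0 / e).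
  apply: (@le_trans _ _ (Pr (D N))).
    rewrite -lee_fin -!PrE //; apply: le_measure; rewrite ?inE //.
    by move=> w; apply.
  apply: (le_trans (PD N)); rewrite ler_pdivrMr // mulrC -ler_pdivrMr //.
  exact/ltW/truncnS_gt.
apply: negligibleS nD => w /= hw N _; apply: contrapT => hN.
apply: hw; exists N.+1%:R => j; apply: contrapT => hj; apply: hN; exists j => // k jk /=.
by rewrite leNgt; apply/negP => Yk; apply: hj; exists k.
Qed.

(** Doob's convergence theorem: almost surely no rational interval is crossed
    infinitely often and the process does not tend to infinity. *)
Lemma supermartingale_cvg : {ae P, forall w, cvgn (fun k => Y k w)}.
Proof.
have : {ae P, forall w, forall i : rat * rat, i.1 < i.2 ->
    ~ (forall j, (exists2 k, (j <= k)%N & Y k w < ratr i.1) /\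
                 (exists2 k, (j <= k)%N & ratr i.2 < Y k w))}.
  apply: (ae_bigcupP (I := (rat * rat)%type) (Q := fun i w => i.1 < i.2 ->
    ~ (forall j, (exists2 k, (j <= k)%N & Y k w < ratr i.1) /\
                 (exists2 k, (j <= k)%N & ratr i.2 < Y k w)))) => -[a b] /=.
  have [ab|ab] := boolP (a < b); last exact: aeW.
  have [a0|a0] := leP 0 a; last first.
    apply: aeW => w _ h; have [[k _ Yk] _] := h 0.
    have : (ratr a : R) < 0 by rewrite ltrq0.
    by have := Y0 k w; lra.
  have a0' : 0 <= (ratr a : R) by rewrite ler0q.
  have ab' : (ratr a : R) < ratr b by rewrite ltr_rat.
  have := ae_finitely_many_crossings ab' a0'.
  by apply: filterS => w hw _; exact: finitely_many_crossings.
move=> h1; apply: filterS2 h1 ae_frequently_bounded => w hw1 hw2.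
apply: no_crossing_cvg => // a b.
exact: (hw1 (a, b)).
Qed.

End Upcrossing.

(** The almost supermartingale convergence theorem of Robbins and Siegmund:
    discounting turns [X] into a nonnegative supermartingale. *)
Lemma robbins_siegmund (X t : nat -> T -> R) (eta : nat -> R) M :
  (forall k, 0 <= eta k) -> (forall K, \sum_(k < K) eta k <= M) ->
  (forall k, fmeas (F k) (X k)) -> (forall k, L1 (X k)) ->
  (forall k w, 0 <= X k w) -> (forall k w, 0 <= t k w) ->
  (forall k A, F k A ->
     EA A (X k.+1) + EA A (t k) <= (1 + eta k) * EA A (X k) + eta k * Pr A) ->
  [/\ cvgn (fun k => EA setT (X k)),
      exists B, forall k, EA setT (X k) <= B,
      exists B, forall K, \sum_(k < K) EA setT (t k) <= B &
      {ae P, forall w, cvgn (fun k => X k w)}].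
Proof.
move=> eta0 etaM FX iX X0 t0 step.
have FT k : F k setT.
  rewrite -setC0; apply: sigma_algebra_setC; first exact: (sF k).1.
  by case: (sF k) => -[].
have stepT k : EA setT (X k.+1) + EA setT (t k) <=
    (1 + eta k) * EA setT (X k) + eta k.
  apply: le_trans (step k _ (FT k)) _; rewrite lerD2l ler_piMr // Pr_le1 //.
have [h1 h2 h3] := almost_decreasing eta0 etaM
  (fun k => EA_ge0 P setT (X0 k)) (fun k => EA_ge0 P setT (t0 k)) stepT.
split=> //.
pose Y k w := discount eta M (fun k => X k w) k.
have YE k : Y k = fun w => (growth eta k)^-1 * X k w + (M - mass eta k).
  by apply/funext => w; rewrite /Y /discount mulrC.
have iY k : L1 (Y k).
  by rewrite YE; apply: L1D; [exact: L1Z|exact: L1_cst].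
have EY k A : measurable A ->
    EA A (Y k) = (growth eta k)^-1 * EA A (X k) + (M - mass eta k) * Pr A.
  move=> mA; rewrite YE EAD //; [|exact: L1Z|exact: L1_cst].
  by rewrite EAZ // EA_cst.
have : {ae P, forall w, cvgn (fun k => Y k w)}.
  apply: supermartingale_cvg => //.
  - move=> k; rewrite YE; have sk := (sF k).1.
    by apply: (fmeasD sk); [exact: (fmeasZ sk)|exact: (fmeas_cst sk)].
  - move=> k w; rewrite /Y /discount addr_ge0 ?divr_ge0 //.
      exact: ltW (growth_gt0 eta0 k).
    by rewrite subr_ge0 etaM.
  - move=> k A FA; have mA := F_measurable FA; rewrite !EY // massS.
    have st := step k A FA; have tA := EA_ge0 P A (t0 k).
    have g0 := growth_gt0 eta0 k; have g1 := growth_gt0 eta0 k.+1.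
    have h : (growth eta k.+1)^-1 * EA A (X k.+1) <=
        (growth eta k)^-1 * EA A (X k) + eta k * Pr A.
      rewrite mulrC ler_pdivrMr // mulrDl growthS.
      have -> : (growth eta k)^-1 * EA A (X k) * (growth eta k * (1 + eta k)) =
        (1 + eta k) * EA A (X k) by field; rewrite gt_eqF.
      have : eta k * Pr A <= eta k * Pr A * (growth eta k * (1 + eta k)).
        by rewrite ler_peMr ?mulr_ge0 ?Pr_ge0 // -growthS growth_ge1.
      lra.
    by have := Pr_ge0 A; nra.
by apply: filterS => w; apply: cvg_discount.
Qed.

End Filtration.
End Supermartingales.

(** * Step sizes *)

Section Steps.
Context {R : realType}.
Implicit Types (s tau r : R).

Lemma step_base_ge1 tau k : 1 <= tau -> 1 <= 1 + k%:R / tau.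
Proof. by move=> t1; rewrite lerDl divr_ge0 // (le_trans ler01). Qed.

Lemma power_step_gt0 (s0 : R) tau r k : 1 <= tau -> 0 < s0 -> 0 < power_step s0 tau r k.
Proof.
move=> t1 s1; rewrite mulr_gt0 // powR_gt0 //.
exact: lt_le_trans ltr01 (step_base_ge1 k t1).
Qed.

Lemma power_step_le (s0 : R) tau r k : 1 <= tau -> 0 < s0 -> 0 <= r ->
  power_step s0 tau r k <= s0.
Proof.
move=> t1 s1 r0; have b1 := step_base_ge1 k t1.
have b0 := lt_le_trans ltr01 b1.
rewrite ler_piMr ?(ltW s1) // powRN invf_le1 ?powR_gt0 //.
have : (1 : R) `^ r <= (1 + k%:R / tau) `^ r.
  by apply: ge0_ler_powR; rewrite ?nnegrE ?(ltW b0).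
by rewrite powR1.
Qed.

Lemma power_stepM (s0 s1 : R) tau r (r' : R) k : 1 <= tau ->
  power_step s0 tau r k * power_step s1 tau r' k =
  power_step (s0 * s1) tau (r + r') k.
Proof.
move=> t1; have b0 := lt_le_trans ltr01 (step_base_ge1 k t1).
by rewrite /power_step opprD powRD ?(gt_eqF b0) ?implybT // mulrACA.
Qed.

Lemma power_stepV (s0 : R) tau r k : 1 <= tau ->
  (power_step s0 tau r k)^-1 = power_step s0^-1 tau (- r) k.
Proof.
move=> t1; have b0 := lt_le_trans ltr01 (step_base_ge1 k t1).
by rewrite /power_step invfM -powRN.
Qed.

(** The bounds [1 + r <= exp r] and [ln r >= 1 - 1 / r] stand in for the mean
    value theorem of the power function. *)
Lemma powR_telescope (t t' s : R) : 0 < t -> t <= t' -> 0 < s ->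
  s * (t' - t) * t' `^ (- (s + 1)) <= t `^ (- s) - t' `^ (- s).
Proof.
move=> t0 tt' s0; have t'0 := lt_le_trans t0 tt'.
have e1 : t' `^ (- (s + 1)) = t' `^ (- s) / t'.
  by rewrite opprD powRD ?(gt_eqF t'0) ?implybT // powR_inv1 // ltW.
have e2 : t `^ (- s) = t' `^ (- s) * expR (s * ln (t' / t)).
  rewrite /powR (gt_eqF t0) (gt_eqF t'0) -expRD; congr expR.
  by rewrite ln_div ?posrE //; ring.
have h1 : 1 + s * ln (t' / t) <= expR (s * ln (t' / t)) by exact: expR_ge1Dx.
have h2 : 1 - t / t' <= ln (t' / t).
  have : ln (1 + (t / t' - 1)) <= t / t' - 1.
    by apply: le_ln1Dx; rewrite ltrBrDl subrr divr_gt0.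
  rewrite addrC subrK -[t' / t]invf_div lnV ?posrE ?divr_gt0 //; lra.
have p0 : 0 < t' `^ (- s) by rewrite powR_gt0.
rewrite e1 e2.
have -> : s * (t' - t) * (t' `^ (- s) / t') = t' `^ (- s) * (s * (1 - t / t')).
  by field; rewrite gt_eqF.
have -> : t' `^ (- s) * expR (s * ln (t' / t)) - t' `^ (- s) =
    t' `^ (- s) * (expR (s * ln (t' / t)) - 1) by ring.
rewrite ler_wpM2l ?(ltW p0) //.
have : s * (1 - t / t') <= s * ln (t' / t) by rewrite ler_wpM2l ?(ltW s0).
by move: h1; lra.
Qed.

(** Comparison with the telescoping sum of [powR_telescope] for [s = r - 1]. *)
Lemma power_step_summable (s0 : R) tau r : 1 <= tau -> 0 <= s0 -> 1 < r ->
  exists M, forall K, \sum_(k < K) power_step s0 tau r k <= M.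
Proof.
move=> t1 s00 r1; pose s := r - 1; have s1 : 0 < s by rewrite subr_gt0.
have tau0 : 0 < tau := lt_le_trans ltr01 t1.
pose b k := 1 + k%:R / tau; have b0 k : 0 < b k := lt_le_trans ltr01 (step_base_ge1 k t1).
pose C := tau / s; have C0 : 0 <= C by rewrite divr_ge0 // ltW.
have key k : b k.+1 `^ (- r) <= C * (b k `^ (- s) - b k.+1 `^ (- s)).
  have bb : b k.+1 - b k = tau^-1 by rewrite /b -natr1; ring.
  have le : b k <= b k.+1 by rewrite -subr_ge0 bb invr_ge0 ltW.
  have := powR_telescope (b0 k) le s1; rewrite bb subrK => h.
  have := ler_wpM2l C0 h; rewrite mulrA.
  have -> : C * (s / tau) = 1 by rewrite /C; field; rewrite (gt_eqF s1) gt_eqF.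
  by rewrite mul1r.
have sum K : \sum_(k < K.+1) b k `^ (- r) + C * b K `^ (- s) <= 1 + C.
  elim: K => [|K IH].
    have bz : b 0%N = 1 by rewrite /b mul0r addr0.
    by rewrite big_ord_recr big_ord0 /= bz !powR1; lra.
  by rewrite big_ord_recr /=; have := key K; lra.
exists (s0 * (1 + C)) => K; rewrite -mulr_sumr ler_wpM2l //.
apply: le_trans (sum K); rewrite big_ord_recr /= -addrA lerDl.
apply: addr_ge0; first exact: powR_ge0.
by apply: mulr_ge0 => //; exact: powR_ge0.
Qed.

(** Comparison with the harmonic series, as [1 + k / tau <= k.+1]. *)
Lemma power_step_divergent (s0 : R) tau r : 1 <= tau -> 0 < s0 -> r <= 1 ->
  forall M, exists K, M <= \sum_(k < K) power_step s0 tau r k.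
Proof.
move=> t1 s00 r1 M; apply: contrapT => /forallNP hM.
apply: (@dvg_harmonic R).
have tau0 : 0 < tau := lt_le_trans ltr01 t1.
apply: (nondecreasing_bounded_cvg (M := M / s0)) => K.
  by rewrite /series /= big_nat_recr //= lerDl invr_ge0.
rewrite /series /= big_mkord ler_pdivlMr // mulrC.
apply: le_trans (_ : \sum_(k < K) power_step s0 tau r k <= M); last first.
  by have /negP := hM K; rewrite -ltNge => /ltW.
rewrite mulr_sumr; apply: ler_sum => k _; rewrite ler_wpM2l ?(ltW s00) //=.
have b1 := step_base_ge1 k t1; have b0 := lt_le_trans ltr01 b1.
apply: (@le_trans _ _ ((1 + k%:R / tau) `^ (- 1))); last first.
  by rewrite ler_powR // lerN2.
rewrite powR_inv1 ?(ltW b0) // lef_pV2 ?posrE // -natr1 addrC lerD2r.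
by rewrite ler_pdivrMr // ler_peMr.
Qed.

(** If all late terms exceeded [e], the weighted sum would grow like
    [e * \sum al], faster than [e / 2 * \sum al]. *)
Lemma weighted_sum_frequently_small (al b : nat -> R) :
  (forall k, 0 <= al k) -> (forall M, exists K, M <= \sum_(k < K) al k) ->
  (forall k, 0 <= b k) ->
  (forall delta, 0 < delta -> exists C, forall K,
     \sum_(k < K) al k * b k <= C + delta * \sum_(k < K) al k) ->
  forall e j, 0 < e -> exists2 k, (j <= k)%N & b k <= e.
Proof.
move=> al0 div b0 hb e j e0; apply: contrapT => hn.
have {}hn k : (j <= k)%N -> e <= b k.
  by move=> jk; rewrite leNgt; apply/negP => /ltW bk; apply: hn; exists k.
have low i : e * \sum_(k < j + i) al k <=
    \sum_(k < j + i) al k * b k + e * \sum_(k < j) al k.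
  elim: i => [|i IH].
    by rewrite addn0 lerDr sumr_ge0 // => k _; rewrite mulr_ge0.
  rewrite addnS !big_ord_recr /= mulrDr.
  have : e * al (j + i)%N <= al (j + i)%N * b (j + i)%N.
    by rewrite mulrC ler_wpM2l // hn // leq_addr.
  lra.
have e2 : 0 < e / 2 by lra.
have [C hC] := hb _ e2.
set S := \sum_(k < j) al k in low.
have [K hK] := div ((C + e * S + 1) / (e / 2)).
have : \sum_(k < K) al k <= \sum_(k < j + K) al k.
  rewrite addnC; elim: j {low hn S hK} => [|i IH]; first by rewrite addn0.
  by rewrite addnS big_ord_recr /=; apply: (le_trans IH); rewrite lerDl.
move=> /(le_trans hK); rewrite ler_pdivrMr // => h1.
have := low K; have := hC (j + K)%N; lra.
Qed.

End Steps.

(** * One iteration *)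

Section OneStep.
Context {R : realType} {n m : nat}.
Variables (f : 'cV[R]_n -> R) (c : 'cV[R]_n -> 'cV[R]_m) (K : set 'cV[R]_m)
  (D : 'M[R]_m) (kappa Lf Mc LJ : R).
Hypothesis spd : sym_posdef D.
Hypothesis kappa_gt0 : 0 < kappa.
Hypothesis df : forall x, differentiable f x.
Hypothesis dc : forall x, differentiable c x.
Hypothesis f_cvx : convex_function setT f.
Hypothesis c_cvx : cone_convex K c.
Hypothesis (Lf0 : 0 <= Lf) (Mc0 : 0 <= Mc) (LJ0 : 0 <= LJ).
Hypothesis f_lip : forall x z,
  enorm (gradient f x - gradient f z) <= Lf * enorm (x - z).
Hypothesis J_bnd : forall x, opnorm (jacobian_cv c x) <= Mc.
Hypothesis J_lip : forall x z,
  opnorm (jacobian_cv c x - jacobian_cv c z) <= LJ * enorm (x - z).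

Local Notation q := (wnorm2 (invmx D)).
Local Notation J := (jacobian_cv c).
Local Notation grad := (gradient f).

Lemma grad_lip2 x z : sqn (grad x - grad z) <= Lf ^+ 2 * sqn (x - z).
Proof.
by rewrite -!sqn_enorm -exprMn ler_sqr ?nnegrE ?mulr_ge0 ?enorm_ge0.
Qed.

Lemma opnorm2_le x : opnorm (J x) ^+ 2 <= Mc ^+ 2.
Proof. by rewrite ler_sqr ?nnegrE ?opnorm_ge0. Qed.

Lemma sqn_JT x v : sqn ((J x)^T *m v) <= Mc ^+ 2 * sqn v.
Proof.
apply: (le_trans (sqn_trmulmx _ _)); rewrite ler_wpM2r ?sqn_ge0 //.
exact: opnorm2_le.
Qed.

Lemma c_lip x z : sqn (c x - c z) <= Mc ^+ 2 * sqn (x - z).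
Proof. exact: lipschitz_of_jacobian. Qed.

Lemma sqn_le_q v : sqn v <= opnorm D * q v.
Proof. by have := spd_coercive v (spd_inv spd); rewrite invmxK. Qed.

Lemma q_ge0 v : 0 <= q v.
Proof. exact: spd_ge0 (spd_inv spd). Qed.

Section Reference.
Variables (xs : 'cV[R]_n) (us : 'cV[R]_m).
Hypothesis kkt : KKT f c K (xs, us).
Hypothesis cK : closed_convex_cone K.

(** The saddle-point inequality: convexity of the Lagrangian in [x] at the
    multiplier [lam], and minimality of [xs] for the multiplier [us]. *)
Lemma saddle_gap x lam : dual_cone K lam ->
  dotcv (lam - us) (c x) <= dotcv (x - xs) (grad x + (J x)^T *m lam).
Proof.
move=> Klam; case: kkt => /= st Kc Kus comp.
have h1 := convex_gradient_le xs (df x) f_cvx.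
have h2 := convex_gradient_le x (df xs) f_cvx.
have h3 := convex_gradient_le xs (differentiable_dotcv dc lam x) (c_cvx Klam).
have h4 := convex_gradient_le x (differentiable_dotcv dc us xs) (c_cvx Kus).
have h5 : dotcv lam (c xs) <= 0.
  by have := Klam _ Kc; rewrite dotcvNr oppr_ge0.
rewrite !gradient_dotcv // in h3 h4.
have st' : dotcv (grad xs) (x - xs) + dotcv ((J xs)^T *m us) (x - xs) = 0.
  by rewrite -dotcvDl st dotcv0l.
rewrite (dotcvC (x - xs)) !dotcvDl (dotcvNl us).
have e1 v : dotcv v (xs - x) = - dotcv v (x - xs) by rewrite -dotcvNr opprB.
rewrite !e1 in h1 h3; lra.
Qed.

(** The variational inequality of the projection, tested at [us]. *)
Lemma dual_progress u y : let lam := proj D K (u + D *m y) in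
  dotcv (u - us) (invmx D *m (lam - u)) <= dotcv (lam - us) y - q (lam - u).
Proof.
rewrite /=; set lam := proj D K _; have [_ _ Kus _] := kkt.
have [_ vi] := projP K spd (u + D *m y); rewrite -/lam in vi.
have := vi us Kus; rewrite opprD addrA mulmxBr mulmxA mulVmx ?spd_unit // mul1mx.
rewrite (dotcvDr (us - lam)) dotcvNr wnorm2E.
have e1 v : dotcv (us - lam) v = - dotcv (lam - us) v by rewrite -dotcvNl opprB.
have e2 v : dotcv (u - us) v = dotcv (lam - us) v - dotcv (lam - u) v.
  rewrite -dotcvNl -dotcvDl; congr dotcv.
  by apply/colP => i; rewrite !mxE; ring.
by rewrite !e1 e2; lra.
Qed.

Definition dist x u (e : 'cV[R]_m) := sqn (x - xs) + sqn (u - us) + sqn e.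

Lemma dist_ge0 x u e : 0 <= dist x u e.
Proof. by rewrite !addr_ge0 ?sqn_ge0. Qed.

(** The projection is Lipschitz and fixes [us] at the argument [us + D c xs]. *)
Lemma multiplier_growth : exists2 C, 0 <= C & forall x u y,
  sqn (proj D K (u + D *m y) - us) <= C * dist x u (y - c x).
Proof.
set a := opnorm D * opnorm (invmx D); set b := opnorm D ^+ 2.
have a0 : 0 <= a by rewrite mulr_ge0 ?opnorm_ge0.
have b0 : 0 <= b by rewrite sqr_ge0.
have m0 : 0 <= Mc ^+ 2 by rewrite sqr_ge0.
exists (a * (2 + 4 * b + 4 * b * Mc ^+ 2)).
  by have := mulr_ge0 b0 m0; move=> bm; apply: mulr_ge0 => //; lra.
move=> x u y.
have {1}<- : proj D K (us + D *m c xs) = us.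
  apply/(proj_fixP spd us (c xs) cK).
  by case: kkt => _ ? ? ?; split.
apply: (le_trans (proj_lipschitz K spd _ _)); rewrite -/a -[X in _ <= X]mulrA.
rewrite ler_wpM2l //.
have -> : u + D *m y - (us + D *m c xs) = (u - us) + D *m ((y - c x) + (c x - c xs)).
  by rewrite addrA subrK mulmxBr; apply/colP => i; rewrite !mxE; ring.
apply: (le_trans (sqnD_le _ _)).
have h1 := sqn_mulmx D ((y - c x) + (c x - c xs)); rewrite -/b in h1.
have h2 := sqnD_le (y - c x) (c x - c xs).
have h3 := c_lip x xs.
have h4 : b * sqn (y - c x + (c x - c xs)) <=
    b * (2 * sqn (y - c x) + 2 * (Mc ^+ 2 * sqn (x - xs))).
  by rewrite ler_wpM2l //; lra.
have sx := sqn_ge0 (x - xs); have su := sqn_ge0 (u - us).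
have se := sqn_ge0 (y - c x).
have p1 := mulr_ge0 b0 su; have p2 := mulr_ge0 b0 sx; have p3 := mulr_ge0 b0 se.
have bm := mulr_ge0 b0 m0.
have p4 := mulr_ge0 bm su; have p5 := mulr_ge0 bm se.
rewrite /dist; lra.
Qed.

(** Subtract the stationarity equation at [(xs, us)].  Only the product of
    [J x - J xs] with the fixed vector [us] occurs, so the growth is linear
    although the Lagrangian is not jointly smooth with a global constant. *)
Lemma gradient_growth C : 0 <= C -> (forall x u y,
    sqn (proj D K (u + D *m y) - us) <= C * dist x u (y - c x)) ->
  exists2 C', C <= C' & forall x u y,
  sqn (grad x + (J x)^T *m proj D K (u + D *m y)) <= C' * dist x u (y - c x).
Proof.
move=> C0 hC; set a := Lf ^+ 2; set b := Mc ^+ 2; set l := LJ ^+ 2 * sqn us.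
have a0 : 0 <= a by exact: sqr_ge0.
have b0 : 0 <= b by exact: sqr_ge0.
have l0 : 0 <= l by rewrite mulr_ge0 ?sqr_ge0 ?sqn_ge0.
exists (C + (2 * a + 4 * b * C + 4 * l)).
  by have := mulr_ge0 b0 C0; lra.
move=> x u y; set lam := proj D K _; set S := dist _ _ _.
have S0 : 0 <= S by exact: dist_ge0.
have split_grad (A B : 'M[R]_(m, n)) a0' b0' : b0' + B^T *m us = 0 ->
    a0' + A^T *m lam = (a0' - b0') + (A^T *m (lam - us) + (A - B)^T *m us).
  move=> /eqP; rewrite addr_eq0 => /eqP ->.
  by rewrite mulmxBr trmxB mulmxBl; apply/colP => i; rewrite !mxE; ring.
rewrite (split_grad _ (J xs) _ (grad xs)); last by case: kkt.
apply: (le_trans (sqnD_le _ _)).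
have h1 := grad_lip2 x xs; rewrite -/a in h1.
have h2 := sqnD_le ((J x)^T *m (lam - us)) ((J x - J xs)^T *m us).
have h3 := sqn_JT x (lam - us); rewrite -/b in h3.
have h4 : sqn ((J x - J xs)^T *m us) <= l * sqn (x - xs).
  apply: (le_trans (sqn_trmulmx _ _)).
  have -> : l * sqn (x - xs) = LJ ^+ 2 * sqn (x - xs) * sqn us by rewrite /l; ring.
  rewrite ler_wpM2r ?sqn_ge0 //.
  rewrite -sqn_enorm -exprMn ler_sqr ?nnegrE ?opnorm_ge0 ?mulr_ge0 ?enorm_ge0 //.
have h5 := hC x u y; rewrite -/lam -/S in h5.
have h6 := ler_wpM2l b0 h5.
have sx : sqn (x - xs) <= S.
  by rewrite /S /dist; have := sqn_ge0 (u - us); have := sqn_ge0 (y - c x); lra.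
have h7 := ler_wpM2l a0 sx; have h8 := ler_wpM2l l0 sx.
have h9 := mulr_ge0 C0 S0.
lra.
Qed.

(** The scaling [kappa^-1] of the dual part cancels the factor [kappa] of the
    dual step size, which makes the coupling terms of the two updates match. *)
Definition lyap (rho : R) x u (e : 'cV[R]_m) :=
  sqn (x - xs) + kappa^-1 * q (u - us) + rho * sqn e.

Lemma lyap_ge0 rho x u e : 0 <= rho -> 0 <= lyap rho x u e.
Proof.
move=> r0; rewrite /lyap !addr_ge0 ?mulr_ge0 ?sqn_ge0 ?q_ge0 //.
by rewrite invr_ge0 ltW.
Qed.

Lemma dist_le_lyap rho x u e : 1 <= rho ->
  dist x u e <= (1 + kappa * opnorm D) * lyap rho x u e.
Proof.
move=> r1; have o0 := opnorm_ge0 D; have k0 := ltW kappa_gt0.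
have ko := mulr_ge0 k0 o0.
have sx := sqn_ge0 (x - xs); have se := sqn_ge0 e; have qu := q_ge0 (u - us).
have hu : sqn (u - us) <= kappa * opnorm D * (kappa^-1 * q (u - us)).
  have -> : kappa * opnorm D * (kappa^-1 * q (u - us)) = opnorm D * q (u - us).
    by field; rewrite gt_eqF.
  exact: sqn_le_q.
have qk : 0 <= kappa^-1 * q (u - us) by rewrite mulr_ge0 // invr_ge0.
rewrite /dist /lyap mulrDl mul1r.
have h : rho * sqn e >= sqn e by rewrite ler_peMl.
have h2 : 0 <= kappa * opnorm D * sqn (x - xs) by rewrite mulr_ge0.
have h3 : 0 <= kappa * opnorm D * (rho * sqn e).
  by rewrite mulr_ge0 // (le_trans se).
rewrite !mulrDr; lra.
Qed.

(** The coupling term [<lam - us, c x>] cancels between the primal and the dual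
    updates, which leaves only its tracking error [<lam - us, e>]; the slack of
    [rho * sqn e] over one averaging step pays for it. *)
Lemma lyap_step rho al ga x u y gh Jh ch :
  1 <= rho -> 0 < al -> kappa * al <= 1 -> 0 < ga <= 1 ->
  let lam := proj D K (u + D *m y) in
  let e := y - c x in
  let g := grad x + (J x)^T *m lam in
  let xi := (gh - grad x) + (Jh - J x)^T *m lam in
  let x' := x - al *: (gh + Jh^T *m lam) in
  let u' := u + (kappa * al) *: (lam - u) in
  let eps := ch - c x' in
  let e' := ((1 - ga) *: y + ga *: ch) - c x' in
  lyap rho x' u' e' + (al * q (lam - u) + ga / 2 * sqn e) <=
  lyap rho x u e + 2 * (al ^+ 2 / ga) * sqn (lam - us)
    + (2 + 2 * rho * Mc ^+ 2) * (al ^+ 2 / ga) * (sqn g + sqn xi)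
    + rho * ga ^+ 2 * sqn eps
    - 2 * al * dotcv (x - xs) xi
    + 2 * rho * ga * (1 - ga) * dotcv (e + (c x - c x')) eps.
Proof.
move=> r1 al0 kal /andP[ga0 ga1] /=.
set lam := proj D K _; set e := y - c x; set g := grad x + _.
set xi := gh - grad x + _; set x' := x - al *: _; set u' := u + _ *: _.
set eps := ch - c x'; set e' := _ - c x'.
set w := g + xi.
have wE : gh + Jh^T *m lam = w.
  rewrite /w /g /xi trmxB mulmxBl.
  by apply/colP => i; rewrite !mxE; ring.
have Klam : dual_cone K lam by have [] := projP K spd (u + D *m y).
have hx : sqn (x' - xs) = sqn (x - xs) - 2 * al * dotcv (x - xs) w + al ^+ 2 * sqn w.
  have -> : x' - xs = (x - xs) - al *: w by rewrite /x' wE addrAC.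
  by rewrite (sqnB (x - xs) (al *: w)) sqnZ dotcvZr; ring.
have hu : kappa^-1 * q (u' - us) = kappa^-1 * q (u - us)
    + 2 * al * dotcv (u - us) (invmx D *m (lam - u))
    + kappa * al ^+ 2 * q (lam - u).
  have -> : u' - us = (u - us) + (kappa * al) *: (lam - u) by rewrite /u' addrAC.
  rewrite (wnorm2D (u - us)); last by case: (spd_inv spd).
  by rewrite wnorm2Z -scalemxAr dotcvZr; field; rewrite gt_eqF.
set de := c x - c x'.
have he : sqn e' = (1 - ga) ^+ 2 * sqn (e + de)
    + 2 * (ga * (1 - ga) * dotcv (e + de) eps) + ga ^+ 2 * sqn eps.
  have -> : e' = (1 - ga) *: (e + de) + ga *: eps.
    by rewrite /e' /e /de /eps; apply/colP => i; rewrite !mxE; ring.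
  by rewrite (sqnD ((1 - ga) *: _)) !sqnZ dotcvZl dotcvZr; ring.
have gap := saddle_gap x Klam; rewrite -/g in gap.
have dual := dual_progress u y; rewrite /= -/lam in dual.
have hde : sqn de <= Mc ^+ 2 * (al ^+ 2 * sqn w).
  apply: (le_trans (c_lip _ _)); rewrite ler_wpM2l ?sqr_ge0 //.
  by rewrite /x' wE opprD addNKr opprK sqnZ.
have hw : sqn w <= 2 * (sqn g + sqn xi) by have := sqnD_le g xi; rewrite -/w; lra.
have gai : 0 < ga^-1 by rewrite invr_gt0.
(* Young's inequality with weight [ga] absorbs the increment of [c]. *)
have hed : (1 - ga) ^+ 2 * sqn (e + de) <= (1 - ga) * sqn e + ga^-1 * sqn de.
  have y1 := dotcv_le e de ga0.
  have h1 : sqn (e + de) <= (1 + ga) * sqn e + (1 + ga^-1) * sqn de.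
    by rewrite (sqnD e de); lra.
  apply: (@le_trans _ _ ((1 - ga) ^+ 2 * ((1 + ga) * sqn e + (1 + ga^-1) * sqn de))).
    by rewrite ler_wpM2l ?sqr_ge0.
  have -> : (1 - ga) ^+ 2 * ((1 + ga) * sqn e + (1 + ga^-1) * sqn de) =
     (1 - ga) * (1 - ga ^+ 2) * sqn e + (1 - ga) * (1 - ga ^+ 2) * (ga^-1 * sqn de).
    by field; rewrite gt_eqF.
  have g2 : 0 <= ga ^+ 2 by exact: sqr_ge0.
  have g3 : (1 - ga) * (1 - ga ^+ 2) <= 1 - ga by rewrite ler_piMr; lra.
  have g4 : (1 - ga) * (1 - ga ^+ 2) <= 1 by lra.
  apply: lerD; rewrite ?ler_wpM2r ?sqn_ge0 //.
  by rewrite ler_piMl ?mulr_ge0 ?sqn_ge0 ?(ltW gai).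
have tr : 2 * al * dotcv (lam - us) e <= ga / 2 * sqn e
    + 2 * (al ^+ 2 / ga) * sqn (lam - us).
  have t0 : 0 < 2 * al / ga by rewrite divr_gt0 // mulr_gt0.
  have := dotcv_le (lam - us) e t0; rewrite invf_div => y1.
  have := ler_wpM2l (ltW al0) y1.
  have -> : al * (2 * al / ga * sqn (lam - us) + ga / (2 * al) * sqn e) =
     ga / 2 * sqn e + 2 * (al ^+ 2 / ga) * sqn (lam - us).
    by field; rewrite !gt_eqF.
  lra.
have kq : kappa * al ^+ 2 * q (lam - u) <= al * q (lam - u).
  by rewrite ler_wpM2r ?q_ge0 // expr2 mulrA ler_piMl ?(ltW al0).
have a2 : al ^+ 2 <= al ^+ 2 / ga.
  by rewrite ler_peMr ?sqr_ge0 // -invr1 lef_pV2 ?posrE.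
have a2w := ler_wpM2r (sqn_ge0 w) a2.
have ag0 : 0 <= al ^+ 2 / ga by rewrite divr_ge0 ?sqr_ge0 ?ltW.
have agw := ler_wpM2l ag0 hw.
have rde : rho * (ga^-1 * sqn de) <= rho * Mc ^+ 2 * (al ^+ 2 / ga * sqn w).
  have -> : rho * Mc ^+ 2 * (al ^+ 2 / ga * sqn w) =
    rho * (ga^-1 * (Mc ^+ 2 * (al ^+ 2 * sqn w))) by ring.
  by rewrite !ler_wpM2l ?(ltW gai) ?(le_trans ler01).
have rm : 0 <= rho * Mc ^+ 2 by rewrite mulr_ge0 ?sqr_ge0 ?(le_trans ler01).
have rde2 := ler_wpM2l rm agw.
have rhe := ler_wpM2l (le_trans ler01 r1) hed.
have yE : dotcv (lam - us) y = dotcv (lam - us) (c x) + dotcv (lam - us) e.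
  by rewrite -dotcvDr; congr dotcv; rewrite /e addrC subrK.
have xw : dotcv (x - xs) w = dotcv (x - xs) g + dotcv (x - xs) xi.
  exact: dotcvDr.
have gapa := ler_wpM2l (ltW al0) gap.
have duala := ler_wpM2l (ltW al0) dual.
have rge : ga * sqn e <= rho * (ga * sqn e).
  by rewrite ler_peMl // mulr_ge0 ?sqn_ge0 ?ltW.
rewrite /lyap hx hu he xw.
rewrite yE in duala.
lra.
Qed.

Lemma sqn_c_le x u e : sqn (c x) <= 2 * sqn (c xs) + 2 * Mc ^+ 2 * dist x u e.
Proof.
have := sqnD_le (c xs) (c x - c xs); rewrite addrC subrK => h.
have h2 := c_lip x xs.
have : Mc ^+ 2 * sqn (x - xs) <= Mc ^+ 2 * dist x u e.
  rewrite ler_wpM2l ?sqr_ge0 // /dist.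
  by have := sqn_ge0 (u - us); have := sqn_ge0 e; lra.
lra.
Qed.

Lemma sqn_u_le x u e : sqn u <= 2 * sqn us + 2 * dist x u e.
Proof.
have := sqnD_le us (u - us); rewrite addrC subrK => h; rewrite /dist.
by have := sqn_ge0 (x - xs); have := sqn_ge0 e; lra.
Qed.

Lemma f_increment x v : `|f (x + v) - f x - dotcv (grad x) v| <= Lf * sqn v.
Proof.
have [t /andP[t0 t1] ->] := mean_value x v df.
rewrite -dotcvNl -dotcvDl; apply: (le_trans (dotcv_CS _ _)).
rewrite -sqn_enorm expr2 mulrA ler_wpM2r ?enorm_ge0 //.
apply: (le_trans (f_lip _ _)); rewrite ler_wpM2l //.
by rewrite addrC addKr enorm_scale_le ?t0.
Qed.

Lemma c_increment u x v :
  `|dotcv u (c (x + v) - c x) - dotcv ((J x)^T *m u) v| <= LJ * enorm u * sqn v.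
Proof.
have [t /andP[t0 t1] ->] := mean_value_dotcv dc u x v.
rewrite dotcv_mulmxl trmxK -dotcvNr -dotcvDr -mulmxBl.
apply: (le_trans (dotcv_CS _ _)); rewrite (mulrC LJ) -mulrA ler_wpM2l ?enorm_ge0 //.
apply: (le_trans (opnormP _ _)).
rewrite -sqn_enorm expr2 mulrA ler_wpM2r ?enorm_ge0 //.
apply: (le_trans (J_lip _ _)); rewrite ler_wpM2l //.
by rewrite addrC addKr enorm_scale_le ?t0.
Qed.

Definition lagrangian x u := f x + dotcv u (c x).

(** The Lagrangian may be unbounded below; this quadratic bound is what allows a
    multiple of the energy to be added to make it nonnegative. *)
Lemma lagrangian_bound : exists2 C, 0 <= C & forall x u e,
  `|lagrangian x u| <= C * (1 + dist x u e).
Proof.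
have lf0 : 0 <= Lf by exact: Lf0.
pose a := `|f xs|; pose b := sqn (grad xs); pose k := sqn (c xs).
have a0 : 0 <= a by exact: normr_ge0.
have b0 : 0 <= b by exact: sqn_ge0.
have k0 : 0 <= k by exact: sqn_ge0.
have s0 : 0 <= sqn us by exact: sqn_ge0.
have m0 : 0 <= Mc ^+ 2 by exact: sqr_ge0.
exists (a + b + 1 + Lf + sqn us + 1 + k + Mc ^+ 2); first by rewrite !addr_ge0.
move=> x u e; set S := dist x u e; have S0 : 0 <= S by exact: dist_ge0.
have h1 := f_increment xs (x - xs).
rewrite [X in f X](_ : _ = x) in h1; last by rewrite addrC subrK.
have h2 := dotcv_le1 (grad xs) (x - xs).
have h3 := dotcv_le1 (- grad xs) (x - xs); rewrite dotcvNl sqnN in h3.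
have h4 := dotcv_le1 u (c x).
have h5 := dotcv_le1 (- u) (c x); rewrite dotcvNl sqnN in h5.
have h6 := sqn_u_le x u e; have h7 := sqn_c_le x u e; rewrite -/S in h6 h7.
have sx : sqn (x - xs) <= S.
  by rewrite /S /dist; have := sqn_ge0 (u - us); have := sqn_ge0 e; lra.
have h8 := ler_wpM2l Lf0 sx.
have h9 := ler_norm (f xs); have h10 := ler_norm (- f xs).
rewrite normrN in h10; rewrite -/a in h9 h10.
have [p1 p2 p3 p4] : [/\ 0 <= a * S, 0 <= b * S, 0 <= sqn us * S & 0 <= k * S].
  by rewrite !mulr_ge0.
have p5 : 0 <= Lf * S by rewrite mulr_ge0.
have p6 : 0 <= Mc ^+ 2 * S by rewrite mulr_ge0.
move: h1; rewrite ler_norml => /andP[h1 h1'].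
rewrite -/b in h2 h3; rewrite -/k in h7.
rewrite /lagrangian ler_norml; apply/andP; split; lra.
Qed.

(** Descent of the Lagrangian along the primal step; the dual step may increase
    it, by at most [al] times an arbitrarily small multiple of [sqn (c x)] plus
    a multiple of [sqn (lam - u)]. *)
Lemma lagrangian_step al t x u lam gh Jh :
  0 < al -> kappa * al <= 1 -> 0 < t ->
  let G := grad x + (J x)^T *m u in
  let g := grad x + (J x)^T *m lam in
  let xi := (gh - grad x) + (Jh - J x)^T *m lam in
  let x' := x - al *: (gh + Jh^T *m lam) in
  let u' := u + (kappa * al) *: (lam - u) in
  lagrangian x' u' + al / 2 * sqn G <=
  lagrangian x u - al * dotcv G xi + al * (kappa / 2 * t^-1 * sqn (c x))
   + (Mc ^+ 2 / 2 + kappa / 2 * t + kappa / 2) * (al * sqn (lam - u))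
   + (Lf + LJ * enorm u + Mc ^+ 2 / 2) * (2 * al ^+ 2 * (sqn g + sqn xi)).
Proof.
move=> al0 kal t0 /=.
set G := grad x + _; set g := grad x + _.
set xi := gh - grad x + _; set x' := x - al *: _; set u' := u + _ *: _.
set w := g + xi; set v := - (al *: w).
have wE : gh + Jh^T *m lam = w.
  rewrite /w /g /xi trmxB mulmxBl.
  by apply/colP => i; rewrite !mxE; ring.
have xE : x' = x + v by rewrite /x' wE.
have sv : sqn v = al ^+ 2 * sqn w by rewrite sqnN sqnZ.
have sw : sqn w <= 2 * (sqn g + sqn xi) by have := sqnD_le g xi; rewrite -/w; lra.
have gE : g = G + (J x)^T *m (lam - u).
  by rewrite /g /G mulmxBr -addrA (addrC (_ *m u)) subrK.
have hf := f_increment x v; have hc := c_increment u x v.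
have hG : dotcv (grad x) v + dotcv ((J x)^T *m u) v =
    - al * (sqn G + dotcv G ((J x)^T *m (lam - u)) + dotcv G xi).
  by rewrite -dotcvDl -/G /v dotcvNr dotcvZr /w gE (dotcvDr G (G + _) xi) (dotcvDr G G) /sqn; ring.
have y1 := dotcv_le1 (- G) ((J x)^T *m (lam - u)); rewrite dotcvNl sqnN in y1.
have j1 := sqn_JT x (lam - u).
have y2 := dotcv_le (lam - u) (c x) t0.
have y3 := dotcv_le1 (lam - u) (c x' - c x).
have c1 : sqn (c x' - c x) <= Mc ^+ 2 * sqn v.
  by apply: (le_trans (c_lip _ _)); rewrite xE addrC addKr.
have LE : lagrangian x' u' = lagrangian x u + (f x' - f x)
    + dotcv u (c x' - c x) + kappa * al * dotcv (lam - u) (c x)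
    + kappa * al * dotcv (lam - u) (c x' - c x).
  by rewrite /lagrangian /u' (dotcvDl (c x') u) dotcvZl !dotcvDr !dotcvNr; ring.
have ka0 : 0 <= kappa * al by rewrite mulr_ge0 ?ltW.
have k2 := ler_wpM2l ka0 y2; have k3 := ler_wpM2l ka0 y3.
have a1 := ler_wpM2l (ltW al0) y1; have a2 := ler_wpM2l (ltW al0) j1.
have k4 : kappa * al * sqn (c x' - c x) <= Mc ^+ 2 * sqn v.
  by apply: le_trans c1; rewrite ler_piMl ?sqn_ge0.
have B0 : 0 <= Lf + LJ * enorm u + Mc ^+ 2 / 2.
  by rewrite !addr_ge0 ?mulr_ge0 ?enorm_ge0 ?sqr_ge0 // invr_ge0.
have hB : (Lf + LJ * enorm u + Mc ^+ 2 / 2) * sqn v <=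
    (Lf + LJ * enorm u + Mc ^+ 2 / 2) * (2 * al ^+ 2 * (sqn g + sqn xi)).
  apply: ler_wpM2l => //; rewrite sv.
  by have := ler_wpM2l (sqr_ge0 al) sw; lra.
rewrite LE; rewrite xE in k3 k4 *.
move: hf hc; rewrite !ler_norml => /andP[_ hf] /andP[_ hc].
move: hB; rewrite mulrDl mulrDl => hB.
lra.
Qed.

End Reference.
End OneStep.

(** * The stochastic iteration *)

(** The next six lemmas only collect terms; they are linear once the nonlinear
    products that occur are regarded as atoms. *)
Lemma energy_arith (R : realType) (v a2 a3 a4 a5 h g C b1 b2 rho s E : R) :
  2 * h * a2 <= 2 * h * (b1 * E) ->
  C * h * (a3 + a4) <= C * h * (b1 * E + b2 * E) ->
  rho * g * a5 <= rho * g * (s * E) ->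
  0 <= (2 * b1 + C * (b1 + b2)) * (g * E) -> 0 <= rho * s * (h * E) ->
  v + 2 * h * a2 + C * h * (a3 + a4) + rho * g * a5 <=
  v + (2 * b1 + C * (b1 + b2) + rho * s) * (h + g) * E.
Proof. lra. Qed.

Lemma relative_arith (R : realType) (x E r m s C p : R) :
  x <= E + r * m * s -> r * m * s <= r * m * (C * (p + E)) ->
  x <= (1 + r * C * m) * E + r * C * m * p.
Proof. lra. Qed.

Lemma shifted_arith (R : realType) (s1 l1 l0 a dl G C1 dd qq C2 Nn Cgx cc p E1 E0
    Dl D1 r mm E o al2 : R) :
  s1 <= l1 + cc * (p + E1) ->
  l1 + a / 2 * G <= l0 + a * dl + C1 * a * dd + C2 * (2 * al2) * (Cgx * Nn) ->
  cc * (p + (E1 + Dl)) <= cc * (p + (E0 + r * mm * E)) ->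
  cc * (r * mm) * E <= cc * (r * mm) * Nn ->
  C1 * a * dd <= C1 * a * (o * qq) -> C1 * o * (a * qq) <= C1 * o * D1 ->
  C2 * (Cgx * Nn) * al2 <= C2 * (Cgx * Nn) * mm ->
  0 <= cc * Dl -> 0 <= C1 * o * mm -> 0 <= 2 * C2 * Cgx * Nn * D1 ->
  0 <= cc * r * Nn * D1 ->
  s1 + a / 2 * G <= l0 + cc * (p + E0) + a * dl
    + (C1 * o + 2 * C2 * Cgx * Nn + cc * r * Nn) * (D1 + mm).
Proof. lra. Qed.

Lemma lagr_arith (R : realType) (l1 l0 G o p pd c1 dd b C s : R) :
  l1 + G <= l0 - o + p + c1 * dd + b * s -> p <= pd -> b * s <= C * s ->
  l1 + G <= l0 - o + pd + c1 * dd + C * s.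
Proof. lra. Qed.

Lemma stationarity_arith (R : realType) (a v v' G Q D m C delta : R) :
  v' + a / 2 * G <= v + a * (delta / 2) + C * (D + m) -> a * Q <= D -> 0 <= m ->
  a * (G + Q) <= 2 * (v - v') + delta * a + (2 * C + 1) * (D + m).
Proof. lra. Qed.

Lemma bound_arith (R : realType) (v0 v s r b : R) : 0 <= v -> r <= b ->
  2 * (v0 - v) + s + r <= 2 * v0 + b + s.
Proof. lra. Qed.

Lemma telescope_le (R : realType) (a b v r : nat -> R) delta :
  (forall k, a k * b k <= 2 * (v k - v k.+1) + delta * a k + r k) ->
  forall M, \sum_(k < M) a k * b k <=
    2 * (v 0 - v M) + delta * \sum_(k < M) a k + \sum_(k < M) r k.
Proof.
move=> h; elim=> [|M IH]; first by rewrite !big_ord0 subrr; lra.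
by rewrite !big_ord_recr /=; have := h M; lra.
Qed.

Lemma frequently_small_cvg0 (R : realType) (v : nat -> R) :
  (forall k, 0 <= v k) -> cvgn v ->
  (forall eps j, 0 < eps -> exists2 k, (j <= k)%N & v k <= eps) ->
  v @ \oo --> (0 : R).
Proof.
move=> v0 /cvg_ex[l vl] h; suff -> : 0 = l by [].
apply/eqP; rewrite eq_le; apply/andP; split.
  by apply: (cvgr_to_ge vl); apply: nearW.
rewrite leNgt; apply/negP => l0; have l2 : 0 < l / 2 by lra.
have /cvgrPdist_lt /(_ _ l2) [j _ hj] := vl.
have [k jk vk] := h _ j l2; have := hj k jk; rewrite ltr_norml.
move: vk; lra.
Qed.

Section Process.
Context {R : realType} {n m : nat}.
Variables (f : 'cV[R]_n -> R) (c : 'cV[R]_n -> 'cV[R]_m) (K : set 'cV[R]_m)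
  (D : 'M[R]_m) (kappa : R).
Hypothesis cK : closed_convex_cone K.
Hypothesis spd : sym_posdef D.
Hypothesis kappa_gt0 : 0 < kappa.
Hypothesis reg : convex_local_regularity f c K.
Variables Lf Mc LJ : R.
Hypothesis Lf0 : 0 <= Lf.
Hypothesis Mc0 : 0 <= Mc.
Hypothesis LJ0 : 0 <= LJ.
Hypothesis f_lip : forall x z,
  enorm (gradient f x - gradient f z) <= Lf * enorm (x - z).
Hypothesis J_bnd : forall x, opnorm (jacobian_cv c x) <= Mc.
Hypothesis J_lip : forall x z,
  opnorm (jacobian_cv c x - jacobian_cv c z) <= LJ * enorm (x - z).
Variables (al ga : nat -> R).
Hypothesis al_gt0 : forall k, 0 < al k.
Hypothesis kal : forall k, kappa * al k <= 1.
Hypothesis ga_itv : forall k, 0 < ga k <= 1.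
Context {d : measure_display} {T : measurableType d}.
Variable P : probability T R.
Variables (Bg BJ Bc : nat) (sigmag sigmaJ sigmac : R) (F : nat -> set (set T))
  (ghat : nat -> T -> 'cV[R]_n) (Jhat : nat -> T -> 'M[R]_(m, n))
  (chat : nat -> T -> 'cV[R]_m)
  (x : nat -> T -> 'cV[R]_n) (u y : nat -> T -> 'cV[R]_m).
Hypothesis obs : conditional_observation P f c K Bg BJ Bc sigmag sigmaJ sigmac
           F ghat Jhat chat x u y.
Hypothesis iter_xuy : generated_by_iteration K D kappa al ga ghat Jhat chat x u y.

Local Notation L1 := (L1 P).
Local Notation EA := (EA P).
Local Notation Pr A := (fine (P A)).
Local Notation q := (wnorm2 (invmx D)).
Local Notation grad := (gradient f).
Local Notation J := (jacobian_cv c).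
Local Notation lam := (tracked_multiplier K D u y).
Local Notation e := (tracking_error c x y).

Let df : forall z, differentiable f z. Proof. by case: reg => _ [] . Qed.
Let dc : forall z, differentiable c z. Proof. by case: reg => _ _ [] . Qed.
Let cgrad : continuous grad. Proof. by case: reg => _ [] . Qed.
Let cJ : continuous J. Proof. by case: reg => _ _ [] . Qed.
Let f_cvx : convex_function setT f. Proof. by case: reg => -[]. Qed.
Let c_cvx : cone_convex K c. Proof. by case: reg => -[]. Qed.

Let cc : continuous c.
Proof. by move=> z; exact: differentiable_continuous. Qed.

Let cf : continuous f.
Proof. by move=> z; exact: differentiable_continuous. Qed.

Let sF k : sub_sigma_algebra_of (F k) := obs_sigma_algebra obs k.
Let sFk k : sigma_algebra setT (F k) := (sF k).1.
Let Fp k := Fplus F ghat Jhat x u k.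

Let sFp k : sub_sigma_algebra_of (Fp k).
Proof.
split; first exact: smallest_sigma_algebra.
by move=> A /(obs_filtration obs); apply: (sF k.+1).2.
Qed.

Let F_Fp k : F k `<=` Fp k.
Proof. by move=> A FA; apply: sub_sigma_algebra; do 4 left. Qed.

Let F_nd k : F k `<=` F k.+1.
Proof. by move=> A /F_Fp; exact: (obs_filtration obs). Qed.

Let FT k : F k setT.
Proof.
by rewrite -setC0; apply: (sigma_algebra_setC (sFk k)); case: (sFk k).
Qed.

Let mF k A : F k A -> measurable A.
Proof. exact: (sF k).2. Qed.

Let sM : sigma_algebra setT (@measurable d T).
Proof. exact: sigma_algebra_measurable. Qed.

Let FM k p r (X : T -> 'M[R]_(p, r)) :
  mx_measurable (F k) X -> mx_measurable measurable X.
Proof. by move=> h A /h; exact: mF. Qed.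

(** The gradient of the Lagrangian in [x], at the multiplier [lam] that drives
    the primal step and at the dual state [u]. *)
Definition pgrad k w := grad (x k w) + (J (x k w))^T *m lam k w.
Definition lgrad k w := grad (x k w) + (J (x k w))^T *m u k w.
Definition noise k w :=
  (ghat k w - grad (x k w)) + (Jhat k w - J (x k w))^T *m lam k w.
Definition cnoise k w := chat k.+1 w - c (x k.+1 w).
Definition dstep k w := lam k w - u k w.

Let Fx k : mx_measurable (F k) (x k). Proof. by case: (obs_adapted obs k). Qed.
Let Fu k : mx_measurable (F k) (u k). Proof. by case: (obs_adapted obs k). Qed.
Let Fy k : mx_measurable (F k) (y k). Proof. by case: (obs_adapted obs k). Qed.

Let Fcx k : mx_measurable (F k) (fun w => c (x k w)).
Proof. exact: (mx_measurable_continuous (sFk k)). Qed.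

Let Fe k : mx_measurable (F k) (e k).
Proof. exact: (mx_measurableB (sFk k)). Qed.

Let Flam k : mx_measurable (F k) (lam k).
Proof.
apply: (mx_measurable_continuous (sFk k) (g := proj D K)).
  by move=> v; apply: (@cvg_proj _ _ D K spd _ (nbhs v) _ id v).
apply: (mx_measurableD (sFk k)) => //; apply: (mx_measurableM (sFk k)) => //.
exact: mx_measurable_cst.
Qed.

Let Fgrad k : mx_measurable (F k) (fun w => grad (x k w)).
Proof. exact: (mx_measurable_continuous (sFk k)). Qed.

Let FJ k : mx_measurable (F k) (fun w => J (x k w)).
Proof. exact: (mx_measurable_continuous (sFk k)). Qed.

Let Fpgrad k : mx_measurable (F k) (pgrad k).
Proof.
apply: (mx_measurableD (sFk k)) => //; apply: (mx_measurableM (sFk k)) => //.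
by apply: mx_measurableT; exact: FJ.
Qed.

Let Flgrad k : mx_measurable (F k) (lgrad k).
Proof.
apply: (mx_measurableD (sFk k)) => //; apply: (mx_measurableM (sFk k)) => //.
by apply: mx_measurableT; exact: FJ.
Qed.

Let Fdstep k : mx_measurable (F k) (dstep k).
Proof. exact: (mx_measurableB (sFk k)). Qed.

Section L2.
Variable G : set (set T).
Hypothesis sG : sub_sigma_algebra_of G.

Lemma L1_coord p (Z : T -> 'cV[R]_p) i :
  mx_measurable G Z -> L1 (fun w => sqn (Z w)) -> L1 (fun w => Z w i 0).
Proof.
move=> /mx_measurableP GZ iZ.
apply: (L1_le _ (L1D (L1_cst P 1) iZ)).
  exact: fmeas_measurable sG (GZ i 0).
move=> w; have h := sqr_coord_le (Z w) i; have n0 := normr_ge0 (Z w i 0).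
by rewrite -[X in X <= _]real_normK ?num_real // in h; nra.
Qed.

Lemma L1_coordM p r (Z : T -> 'cV[R]_p) (Z' : T -> 'cV[R]_r) i j :
  mx_measurable G Z -> L1 (fun w => sqn (Z w)) ->
  mx_measurable G Z' -> L1 (fun w => sqn (Z' w)) ->
  L1 (fun w => Z w i 0 * Z' w j 0).
Proof.
move=> /mx_measurableP GZ iZ /mx_measurableP GZ' iZ'.
apply: (L1_le _ (L1D iZ iZ')).
  by apply: (fmeas_measurable sG); apply: (fmeasM sG.1).
move=> w; have h := sqr_coord_le (Z w) i; have h' := sqr_coord_le (Z' w) j.
rewrite normrM; rewrite -[X in X <= _]real_normK ?num_real // in h.
rewrite -[X in X <= _]real_normK ?num_real // in h'.
have := sqr_ge0 (`|Z w i 0| - `|Z' w j 0|).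
have := sqr_ge0 (`|Z w i 0|); have := sqr_ge0 (`|Z' w j 0|).
rewrite sqrrB; lra.
Qed.

Lemma L1_sqn_le r (Y : T -> R) (X : T -> 'cV[R]_r) :
  mx_measurable measurable X -> L1 Y -> (forall w, sqn (X w) <= Y w) ->
  L1 (fun w => sqn (X w)).
Proof.
move=> mX iY h; apply: (L1_ge0_le _ iY); last by move=> w; rewrite sqn_ge0 h.
by apply: (@fmeas_measurable _ _ _ measurable); [split|exact: (fmeas_sqn sM)].
Qed.

(** A centred random vector with bounded conditional second moment is orthogonal
    to the square-integrable vectors known beforehand. *)
Lemma centered_dotcv p (X X' : T -> 'cV[R]_p) (b : R) (Z : T -> 'cV[R]_p) A :
  0 <= b -> is_cond_exp_mx P G X X' ->
  cond_exp_le P G (fun w => sqn (X w - X' w)) b ->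
  mx_measurable G Z -> L1 (fun w => sqn (Z w)) -> G A ->
  L1 (fun w => dotcv (Z w) (X w - X' w)) /\
  EA A (fun w => dotcv (Z w) (X w - X' w)) = 0.
Proof.
move=> b0 XX' var GZ iZ GA; have mA := sG.2 _ GA.
have key i : L1 (fun w => Z w i 0 * (X w - X' w) i 0) /\
    EA A (fun w => Z w i 0 * (X w - X' w) i 0) = 0.
  under eq_fun do rewrite !mxE; apply: (cond_centered_diff sG b0 (XX' i 0) var) => //.
  - by move=> w; have := sqr_coord_le (X w - X' w) i; rewrite !mxE.
  - by move/mx_measurableP : GZ; apply.
  - exact: L1_coord.
have E : (fun w => dotcv (Z w) (X w - X' w)) =
    (fun w => \sum_i Z w i 0 * (X w - X' w) i 0).
  by apply/funext => w; rewrite dotcvE.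
rewrite E; split; first by apply: L1_sum => i; case: (key i).
rewrite EA_sum //; last by move=> i; case: (key i).
by rewrite big1 // => i _; case: (key i).
Qed.

End L2.

Let sg2 := sigmag ^+ 2 / Bg%:R.
Let sJ2 := sigmaJ ^+ 2 / BJ%:R.
Let sc2 := sigmac ^+ 2 / Bc%:R.
Let sg2_ge0 : 0 <= sg2. Proof. by rewrite divr_ge0 // sqr_ge0. Qed.
Let sJ2_ge0 : 0 <= sJ2. Proof. by rewrite divr_ge0 // sqr_ge0. Qed.
Let sc2_ge0 : 0 <= sc2. Proof. by rewrite divr_ge0 // sqr_ge0. Qed.

Let g_var k : cond_exp_le P (F k) (fun w => sqn (ghat k w - grad (x k w))) sg2.
Proof.
rewrite (_ : (fun w => _) = fun w => enorm (ghat k w - grad (x k w)) ^+ 2).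
  exact: obs_g_var obs k.
by apply/funext => w; rewrite sqn_enorm.
Qed.

Let c_var k : cond_exp_le P (Fp k) (fun w => sqn (cnoise k w)) sc2.
Proof.
rewrite (_ : (fun w => _) = fun w => enorm (cnoise k w) ^+ 2).
  exact: obs_c_var obs k.
by apply/funext => w; rewrite sqn_enorm.
Qed.

Let J_var k := obs_J_var obs k.

Lemma measurable_noise k : mx_measurable measurable (noise k).
Proof.
have mg : mx_measurable measurable (ghat k).
  apply/mx_measurableP => i j.
  have [iX _ _ _] := obs_g_mean obs k i j.
  by move=> A [B mB <-]; have := L1_measurable iX; apply.
have mJ : mx_measurable measurable (Jhat k).
  apply/mx_measurableP => i j.
  have [iX _ _ _] := obs_J_mean obs k i j.
  by move=> A [B mB <-]; have := L1_measurable iX; apply.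
apply: (mx_measurableD sM); first by apply: (mx_measurableB sM) => //; exact: FM.
apply: (mx_measurableM sM); last exact: FM.
by apply: mx_measurableT; apply: (mx_measurableB sM) => //; exact: FM.
Qed.

(** The derivative noise is orthogonal to the square-integrable vectors known
    before iteration [k]; its Jacobian part is weighted by the multiplier. *)
Lemma noise_centered k (Z : T -> 'cV[R]_n) A :
  mx_measurable (F k) Z -> L1 (fun w => sqn (Z w)) ->
  L1 (fun w => sqn (lam k w)) -> F k A ->
  L1 (fun w => dotcv (Z w) (noise k w)) /\ EA A (fun w => dotcv (Z w) (noise k w)) = 0.
Proof.
move=> FZ iZ il FA; have mA := mF FA.
have [i1 e1] := centered_dotcv (sF k) sg2_ge0 (obs_g_mean obs k) (g_var k) FZ iZ FA.
have key (ij : 'I_m * 'I_n) :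
    L1 (fun w => (Z w ij.2 0 * lam k w ij.1 0) * (Jhat k w - J (x k w)) ij.1 ij.2) /\
    EA A (fun w => (Z w ij.2 0 * lam k w ij.1 0) *
                   (Jhat k w - J (x k w)) ij.1 ij.2) = 0.
  case: ij => i j /=.
  have E w : (Jhat k w - J (x k w)) i j = Jhat k w i j - J (x k w) i j by rewrite !mxE.
  under eq_fun do rewrite E.
  apply: (cond_centered_diff (sF k) sJ2_ge0 (obs_J_mean obs k i j) (J_var k)) => //.
  - move=> w; rewrite -E -[X in X <= _]real_normK ?num_real //.
    by rewrite ler_sqr ?nnegrE ?opnorm_ge0 // coord_le_opnorm.
  - apply: (fmeasM (sFk k)); first by move/mx_measurableP : FZ; apply.
    by move/mx_measurableP : (@Flam k); apply.
  - exact: (L1_coordM (sF k)).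
have E : (fun w => dotcv (Z w) (noise k w)) =
  (fun w => dotcv (Z w) (ghat k w - grad (x k w)) + \sum_(ij : 'I_m * 'I_n)
     (Z w ij.2 0 * lam k w ij.1 0) * (Jhat k w - J (x k w)) ij.1 ij.2).
  apply/funext => w; rewrite /noise dotcvDr; congr (_ + _).
  rewrite -dotcv_mulmxl dotcvE.
  rewrite (eq_bigr (fun i => \sum_j (Z w j 0 * lam k w i 0) *
      (Jhat k w - J (x k w)) i j)); last first.
    by move=> i _; rewrite mxE mulr_suml; apply: eq_bigr => j _; ring.
  by rewrite pair_bigA.
have i2 := L1_sum (index_enum _) (fun ij => (key ij).1).
rewrite E; split; first exact: L1D.
rewrite EAD // e1 add0r EA_sum //; last by move=> ij; case: (key ij).
by rewrite big1 // => ij _; case: (key ij).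
Qed.

Lemma noise_sqn k A : L1 (fun w => sqn (lam k w)) -> F k A ->
  L1 (fun w => sqn (noise k w)) /\
  EA A (fun w => sqn (noise k w)) <=
    2 * sg2 * Pr A + 2 * sJ2 * EA A (fun w => sqn (lam k w)).
Proof.
move=> il FA; have mA := mF FA.
have g0 w : 0 <= sqn (ghat k w - grad (x k w)) by exact: sqn_ge0.
have J0 w : 0 <= opnorm (Jhat k w - J (x k w)) ^+ 2 by exact: sqr_ge0.
have Fl : fmeas (F k) (fun w => sqn (lam k w)) by exact: (fmeas_sqn (sFk k)).
have l0 w : 0 <= sqn (lam k w) by exact: sqn_ge0.
have [ig eg] := cond_exp_le_weighted (sF k) sg2_ge0 (g_var k) g0
  (@fmeas_cst _ _ _ _ (sFk k) 1) (fun _ => ler01) (L1_cst P 1) FA.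
have [iJ eJ] := cond_exp_le_weighted (sF k) sJ2_ge0 (J_var k) J0 Fl l0 il FA.
have ub w : sqn (noise k w) <= 2 * (1 * sqn (ghat k w - grad (x k w))) +
   2 * (sqn (lam k w) * opnorm (Jhat k w - J (x k w)) ^+ 2).
  rewrite mul1r; apply: (le_trans (sqnD_le _ _)); rewrite lerD2l ler_pM2l //.
  by rewrite mulrC; exact: sqn_trmulmx.
have iU := L1D (L1Z 2 ig) (L1Z 2 iJ).
have iN : L1 (fun w => sqn (noise k w)).
  exact: (L1_sqn_le (@measurable_noise k) iU ub).
split=> //; apply: (le_trans (EA_le mA iN iU (fun w _ => ub w))).
rewrite EAD //; try exact: L1Z.
rewrite (EAZ mA 2 ig) (EAZ mA 2 iJ); rewrite EA_cst // mul1r in eg.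
by lra.
Qed.

Section Reference.
Variables (xs : 'cV[R]_n) (us : 'cV[R]_m).
Hypothesis kkt : KKT f c K (xs, us).
Variable Cg : R.
Hypothesis Cg0 : 0 <= Cg.
Hypothesis multiplierC : forall z v b,
  sqn (proj D K (v + D *m b) - us) <= Cg * dist xs us z v (b - c z).
Hypothesis gradientC : forall z v b,
  sqn (grad z + (J z)^T *m proj D K (v + D *m b)) <= Cg * dist xs us z v (b - c z).

(** The summand [1] lets one quantity dominate the constant terms as well. *)
Definition state k w := 1 + dist xs us (x k w) (u k w) (e k w).
Definition energy rho k w := lyap D kappa xs us rho (x k w) (u k w) (e k w).
Definition dissipation k w := al k * q (dstep k w) + ga k / 2 * sqn (e k w).
Definition step_mass k := al k ^+ 2 / ga k + ga k ^+ 2.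

Let ga0 k : 0 < ga k. Proof. by case/andP: (ga_itv k). Qed.
Let ga1 k : ga k <= 1. Proof. by case/andP: (ga_itv k). Qed.

Lemma state_ge1 k w : 1 <= state k w.
Proof. by rewrite lerDl dist_ge0. Qed.

Let state_ge0 k w : 0 <= state k w.
Proof. exact: le_trans ler01 (state_ge1 k w). Qed.

Lemma sqn_multiplier_le k w : sqn (lam k w - us) <= Cg * state k w.
Proof.
apply: le_trans (multiplierC (x k w) (u k w) (y k w)) _.
by rewrite ler_wpM2l // lerDr.
Qed.

Lemma sqn_pgrad_le k w : sqn (pgrad k w) <= Cg * state k w.
Proof.
apply: le_trans (gradientC (x k w) (u k w) (y k w)) _.
by rewrite ler_wpM2l // lerDr.
Qed.

Lemma sqn_lam_le k w : sqn (lam k w) <= (2 * sqn us + 2 * Cg) * state k w.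
Proof.
have := sqnD_le us (lam k w - us); rewrite addrC subrK => h.
have h1 := sqn_multiplier_le k w; have := state_ge1 k w; have := sqn_ge0 us; nra.
Qed.

Lemma parts_le_state k w : [/\ sqn (x k w - xs) <= state k w,
  sqn (u k w - us) <= state k w & sqn (e k w) <= state k w].
Proof.
have h1 := sqn_ge0 (x k w - xs); have h2 := sqn_ge0 (u k w - us).
by have h3 := sqn_ge0 (e k w); rewrite /state /dist; split; lra.
Qed.

Lemma sqn_dstep_le k w : sqn (dstep k w) <= (2 * Cg + 2) * state k w.
Proof.
have := sqn_tri (lam k w) us (u k w); rewrite (sqnBC us).
have := sqn_multiplier_le k w; have [_ h _] := parts_le_state k w.
rewrite /dstep; lra.
Qed.

Lemma state_measurable k : fmeas (F k) (state k).
Proof.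
apply: (fmeasD (sFk k)); first exact: (fmeas_cst (sFk k)).
apply: (fmeasD (sFk k)); last exact: (fmeas_sqn (sFk k)).
by apply: (fmeasD (sFk k)); apply: (fmeas_sqn (sFk k)); exact: (mx_measurableBc (sFk k)).
Qed.

Lemma energy_measurable rho k : fmeas (F k) (energy rho k).
Proof.
apply: (fmeasD (sFk k)); last first.
  by apply: (fmeasZ (sFk k)); exact: (fmeas_sqn (sFk k)).
apply: (fmeasD (sFk k)).
  by apply: (fmeas_sqn (sFk k)); exact: (mx_measurableBc (sFk k)).
apply: (fmeasZ (sFk k)); apply: (fmeas_wnorm2 (sFk k)).
exact: (mx_measurableBc (sFk k)).
Qed.

Lemma energy_ge0 rho k w : 1 <= rho -> 0 <= energy rho k w.
Proof. by move=> r1; apply: lyap_ge0 => //; exact: le_trans ler01 r1. Qed.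

Lemma dissipation_ge0 k w : 0 <= dissipation k w.
Proof.
rewrite addr_ge0 // mulr_ge0 ?q_ge0 ?sqn_ge0 ?(ltW (al_gt0 k)) //.
by rewrite divr_ge0 // ltW.
Qed.

Let Cd := 1 + kappa * opnorm D.

Let Cd1 : 1 <= Cd.
Proof. by rewrite lerDl mulr_ge0 ?opnorm_ge0 // ltW. Qed.

Lemma state_le_energy rho k w : 1 <= rho ->
  state k w <= Cd * (1 + energy rho k w).
Proof.
move=> r1; rewrite mulrDr mulr1 /state; apply: lerD => //.
exact: dist_le_lyap.
Qed.

Let Cx := 2 * sg2 + 2 * sJ2 * (2 * sqn us + 2 * Cg).

Let Cx0 : 0 <= Cx.
Proof.
have h := mulr_ge0 sJ2_ge0 (sqn_ge0 us); have h2 := mulr_ge0 sJ2_ge0 Cg0.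
by have h3 := sg2_ge0; rewrite /Cx; lra.
Qed.

Section Integrable.
Variable k : nat.
Hypothesis iS : L1 (state k).

Lemma L1_state_le p (X : T -> 'cV[R]_p) C : mx_measurable (F k) X ->
  (forall w, sqn (X w) <= C * state k w) -> L1 (fun w => sqn (X w)).
Proof.
move=> FX h; apply: (L1_sqn_le _ (L1Z C iS)) => //; exact: FM FX.
Qed.

Lemma L1_lam : L1 (fun w => sqn (lam k w)).
Proof. exact: (L1_state_le (@Flam k) (sqn_lam_le k)). Qed.

Lemma Pr_le_state A : F k A -> Pr A <= EA A (state k).
Proof.
move=> FA; have mA := mF FA; rewrite -[Pr A]mul1r -(EA_cst P mA).
by apply: EA_le => // [|w _]; [exact: L1_cst|exact: state_ge1].
Qed.

Lemma noise_le_state A : F k A -> L1 (fun w => sqn (noise k w)) /\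
  EA A (fun w => sqn (noise k w)) <= Cx * EA A (state k).
Proof.
move=> FA; have mA := mF FA; have [iN h] := noise_sqn L1_lam FA; split=> //.
apply: (le_trans h).
have hP := Pr_le_state FA.
have hl : EA A (fun w => sqn (lam k w)) <= (2 * sqn us + 2 * Cg) * EA A (state k).
  rewrite -EAZ //; apply: EA_le => //; [exact: L1_lam|exact: L1Z|].
  by move=> w _; exact: sqn_lam_le.
have h1 := ler_wpM2l sg2_ge0 hP; have h2 := ler_wpM2l sJ2_ge0 hl.
rewrite /Cx; lra.
Qed.

Let x_step w : x k.+1 w = x k w - al k *: (ghat k w + (Jhat k w)^T *m lam k w).
Proof. by have [] := iter_xuy k w. Qed.

Let u_step w : u k.+1 w = u k w + (kappa * al k) *: (lam k w - u k w).
Proof. by have [] := iter_xuy k w. Qed.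

Let y_step w : y k.+1 w = (1 - ga k) *: y k w + ga k *: chat k.+1 w.
Proof. by have [] := iter_xuy k w. Qed.

Lemma x_increment w : x k.+1 w - x k w = - (al k *: (pgrad k w + noise k w)).
Proof.
rewrite x_step addrAC subrr sub0r /pgrad /noise trmxB mulmxBl.
by congr (- (_ *: _)); apply/colP => i; rewrite !mxE; ring.
Qed.

Let Fx1 : mx_measurable (Fp k) (x k.+1).
Proof.
move=> A hA; apply: sub_sigma_algebra; left; right; exact: hA.
Qed.

(** The tracking error before the new observation is averaged in; it is known
    together with the derivative observations. *)
Definition drift k w := e k w + (c (x k w) - c (x k.+1 w)).

Lemma drift_measurable : mx_measurable (Fp k) (drift k).
Proof.
have sp := (sFp k).1.
have FFp p r (X : T -> 'M[R]_(p, r)) : mx_measurable (F k) X -> mx_measurable (Fp k) X.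
  by move=> h A /h; exact: F_Fp.
apply: (mx_measurableD sp); first exact: FFp.
apply: (mx_measurableB sp); first exact: FFp.
exact: (mx_measurable_continuous sp).
Qed.

Lemma L1_drift : L1 (fun w => sqn (drift k w)).
Proof.
have [iN _] := noise_le_state (FT k).
have iB : L1 (fun w => 2 * state k w + 2 * (Mc ^+ 2 * (al k ^+ 2 *
    (2 * (Cg * state k w) + 2 * sqn (noise k w))))).
  apply: L1D; first exact: L1Z.
  apply: L1Z; apply: L1Z; apply: L1Z; apply: L1D; apply: L1Z => //.
  exact: L1Z.
apply: (L1_sqn_le _ iB).
  by move=> A hA; apply: (sFp k).2; exact: drift_measurable hA.
move=> w; apply: (le_trans (sqnD_le _ _)); have [_ _ he] := parts_le_state k w.
apply: lerD; first by rewrite ler_pM2l.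
rewrite ler_pM2l //; apply: (le_trans (c_lip dc Mc0 J_bnd _ _)).
rewrite ler_wpM2l ?sqr_ge0 // sqnBC x_increment sqnN sqnZ ler_wpM2l ?sqr_ge0 //.
apply: (le_trans (sqnD_le _ _)); rewrite lerD2r ler_pM2l //.
exact: sqn_pgrad_le.
Qed.

(** Unlike the derivative noise, the constraint noise is conditioned on the
    later sigma-algebra [Fp k], because the drift depends on [x k.+1]. *)
Lemma cnoise_centered A : F k A ->
  [/\ L1 (fun w => sqn (cnoise k w)),
      EA A (fun w => sqn (cnoise k w)) <= sc2 * Pr A,
      L1 (fun w => dotcv (drift k w) (cnoise k w)) &
      EA A (fun w => dotcv (drift k w) (cnoise k w)) = 0].
Proof.
move=> /[dup] /mF mA /F_Fp FA.
have c0 w : 0 <= sqn (cnoise k w) by exact: sqn_ge0.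
have [ic ec] := cond_exp_le_weighted (sFp k) sc2_ge0 (c_var k) c0
  (@fmeas_cst _ _ _ _ (sFp k).1 1) (fun _ => ler01) (L1_cst P 1) FA.
have E1 : (fun w => 1 * sqn (cnoise k w)) = (fun w => sqn (cnoise k w)).
  by apply/funext => w; rewrite mul1r.
rewrite E1 in ic ec; rewrite EA_cst // mul1r in ec.
have var : cond_exp_le P (Fp k) (fun w => sqn (cnoise k w - 0)) sc2.
  rewrite (_ : (fun w => _) = (fun w => sqn (cnoise k w))); first exact: c_var.
  by apply/funext => w; rewrite subr0.
have mean : is_cond_exp_mx P (Fp k) (cnoise k) (fun=> 0) := obs_c_mean obs k.
have [i2 e2] := centered_dotcv (sFp k) sc2_ge0 mean var drift_measurable L1_drift FA.
have E2 : (fun w => dotcv (drift k w) (cnoise k w - 0)) =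
    (fun w => dotcv (drift k w) (cnoise k w)).
  by apply/funext => w; rewrite subr0.
by rewrite E2 in i2 e2; split.
Qed.

Definition energy_rate rho := 2 * Cg + (2 + 2 * rho * Mc ^+ 2) * (Cg + Cx) + rho * sc2.

Lemma energy_rate_ge0 rho : 1 <= rho -> 0 <= energy_rate rho.
Proof.
move=> r1; have r0 : 0 <= rho := le_trans ler01 r1.
apply: addr_ge0; last exact: mulr_ge0.
apply: addr_ge0; first exact: mulr_ge0.
by apply: mulr_ge0; apply: addr_ge0 => //; rewrite !mulr_ge0 // sqr_ge0.
Qed.

Lemma step_mass_ge0 : 0 <= step_mass k.
Proof. by rewrite addr_ge0 ?sqr_ge0 // divr_ge0 ?sqr_ge0 // ltW. Qed.

Lemma energy_pathwise rho w : 1 <= rho ->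
  energy rho k.+1 w + dissipation k w <=
  energy rho k w + 2 * (al k ^+ 2 / ga k) * sqn (lam k w - us)
    + (2 + 2 * rho * Mc ^+ 2) * (al k ^+ 2 / ga k) *
        (sqn (pgrad k w) + sqn (noise k w))
    + rho * ga k ^+ 2 * sqn (cnoise k w)
    - 2 * al k * dotcv (x k w - xs) (noise k w)
    + 2 * rho * ga k * (1 - ga k) * dotcv (drift k w) (cnoise k w).
Proof.
move=> r1.
have := lyap_step spd kappa_gt0 df dc f_cvx c_cvx Mc0 J_bnd kkt
  (x k w) (u k w) (y k w) (ghat k w) (Jhat k w) (chat k.+1 w)
  r1 (al_gt0 k) (kal k) (ga_itv k).
rewrite /= -!/(lam k w) -!x_step -u_step -!y_step.
exact.
Qed.

Lemma energy_L1 rho : 1 <= rho -> L1 (energy rho k).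
Proof.
move=> r1; have r0 : 0 <= rho := le_trans ler01 r1.
have iB : L1 (fun w => (1 + kappa^-1 * opnorm (invmx D) + rho) * state k w) by exact: L1Z.
apply: (L1_ge0_le _ iB); first exact: fmeas_measurable (sF k) (@energy_measurable rho k).
move=> w; rewrite energy_ge0 //= !mulrDl mul1r.
have [h1 h2 h3] := parts_le_state k w.
rewrite /energy /lyap; apply: lerD; last by rewrite ler_wpM2l.
apply: lerD => //; rewrite -mulrA ler_wpM2l ?invr_ge0 ?(ltW kappa_gt0) //.
apply: (le_trans (wnorm2_le _ _)); rewrite ler_wpM2l ?opnorm_ge0 //.
Qed.

Lemma L1_dstep : L1 (fun w => sqn (dstep k w)).
Proof. exact: (L1_state_le (@Fdstep k) (sqn_dstep_le k)). Qed.

Lemma L1_qdstep : L1 (fun w => q (dstep k w)).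
Proof.
apply: (L1_ge0_le _ (L1Z (opnorm (invmx D)) L1_dstep)).
  by apply: (fmeas_measurable (sF k)); apply: (fmeas_wnorm2 (sFk k)); exact: Fdstep.
by move=> w; rewrite q_ge0 //= wnorm2_le.
Qed.

Lemma dissipation_L1 : L1 (dissipation k).
Proof.
apply: L1D; apply: L1Z; first exact: L1_qdstep.
apply: (L1_state_le (C := 1)); first exact: Fe.
by move=> w; rewrite mul1r; case: (parts_le_state k w).
Qed.

Lemma L1_xs : L1 (fun w => sqn (x k w - xs)).
Proof.
apply: (L1_state_le (C := 1)).
  exact: (mx_measurableBc (sFk k)).
by move=> w; rewrite mul1r; case: (parts_le_state k w).
Qed.

Lemma L1_multiplier : L1 (fun w => sqn (lam k w - us)).
Proof.
apply: (L1_state_le _ (sqn_multiplier_le k)).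
exact: (mx_measurableBc (sFk k)).
Qed.

Lemma L1_pgrad : L1 (fun w => sqn (pgrad k w)).
Proof. exact: (L1_state_le (@Fpgrad k) (sqn_pgrad_le k)). Qed.

(** The one-step inequality integrated over an event known before iteration
    [k]: both noise terms that are linear disappear. *)
Lemma energy_expected rho A : 1 <= rho -> F k A ->
  L1 (energy rho k.+1) /\
  EA A (energy rho k.+1) + EA A (dissipation k) <=
    EA A (energy rho k) + energy_rate rho * step_mass k * EA A (state k).
Proof.
move=> r1 FA; have mA := mF FA; have r0 : 0 <= rho := le_trans ler01 r1.
have Fxs : mx_measurable (F k) (fun w => x k w - xs).
  exact: (mx_measurableBc (sFk k)).
have [i6 e6] := noise_centered Fxs L1_xs L1_lam FA.
have [i4 e4] := noise_le_state FA.
have [i5 e5 i7 e7] := cnoise_centered FA.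
have i1 := energy_L1 r1; have i2 := L1_multiplier; have i3 := L1_pgrad.
have iD := dissipation_L1.
set h := al k ^+ 2 / ga k; have h0 : 0 <= h by rewrite divr_ge0 ?sqr_ge0 // ltW.
set C := 2 + 2 * rho * Mc ^+ 2.
have C0 : 0 <= C by rewrite addr_ge0 ?mulr_ge0 ?sqr_ge0.
pose U1 w := energy rho k w + 2 * h * sqn (lam k w - us).
pose U2 w := U1 w + C * h * (sqn (pgrad k w) + sqn (noise k w)).
pose U3 w := U2 w + rho * ga k ^+ 2 * sqn (cnoise k w).
pose U4 w := U3 w - 2 * al k * dotcv (x k w - xs) (noise k w).
pose U w := U4 w + 2 * rho * ga k * (1 - ga k) * dotcv (drift k w) (cnoise k w).
have i34 := L1D i3 i4.
have j2 : L1 (fun w => 2 * h * sqn (lam k w - us)) by exact: L1Z.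
have j34 : L1 (fun w => C * h * (sqn (pgrad k w) + sqn (noise k w))) by exact: L1Z.
have j5 : L1 (fun w => rho * ga k ^+ 2 * sqn (cnoise k w)) by exact: L1Z.
have j6 : L1 (fun w => 2 * al k * dotcv (x k w - xs) (noise k w)) by exact: L1Z.
have j7 : L1 (fun w => 2 * rho * ga k * (1 - ga k) *
    dotcv (drift k w) (cnoise k w)) by exact: L1Z.
have iU1 : L1 U1 by exact: L1D.
have iU2 : L1 U2 by exact: L1D.
have iU3 : L1 U3 by exact: L1D.
have iU4 : L1 U4 by exact: L1B.
have iU : L1 U by exact: L1D.
have path w : energy rho k.+1 w + dissipation k w <= U w by exact: energy_pathwise.
have iE : L1 (energy rho k.+1).
  apply: (L1_ge0_le _ iU).
    exact: fmeas_measurable (sF k.+1) (@energy_measurable rho k.+1).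
  move=> w; rewrite energy_ge0 //=; apply: le_trans (path w).
  by rewrite lerDl dissipation_ge0.
split; first exact: iE.
rewrite -(EAD mA iE iD).
have lhs : EA A (fun w => energy rho k.+1 w + dissipation k w) <= EA A U.
  by apply: EA_le => //; exact: L1D.
apply: (le_trans lhs).
have -> : EA A U = EA A (energy rho k) + 2 * h * EA A (fun w => sqn (lam k w - us))
   + C * h * (EA A (fun w => sqn (pgrad k w)) + EA A (fun w => sqn (noise k w)))
   + rho * ga k ^+ 2 * EA A (fun w => sqn (cnoise k w)).
  rewrite /U (EAD mA iU4 j7) (EAZ mA _ i7) e7 mulr0 addr0.
  rewrite /U4 (EAB mA iU3 j6) (EAZ mA _ i6) e6 mulr0 subr0.
  rewrite /U3 (EAD mA iU2 j5) (EAZ mA _ i5) /U2 (EAD mA iU1 j34) (EAZ mA _ i34).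
  by rewrite (EAD mA i3 i4) /U1 (EAD mA i1 j2) (EAZ mA _ i2).
set E := EA A (state k).
have E0 : 0 <= E by exact: EA_ge0.
have b2 : EA A (fun w => sqn (lam k w - us)) <= Cg * E.
  rewrite -EAZ //; apply: EA_le => //; first exact: L1Z.
  by move=> w _; exact: sqn_multiplier_le.
have b3 : EA A (fun w => sqn (pgrad k w)) <= Cg * E.
  rewrite -EAZ //; apply: EA_le => //; first exact: L1Z.
  by move=> w _; exact: sqn_pgrad_le.
have b5 : EA A (fun w => sqn (cnoise k w)) <= sc2 * E.
  exact: le_trans e5 (ler_wpM2l sc2_ge0 (Pr_le_state FA)).
have hg0 : 0 <= ga k ^+ 2 by exact: sqr_ge0.
have t1 := ler_wpM2l (mulr_ge0 (ler0n R 2) h0) b2.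
have t2 := ler_wpM2l (mulr_ge0 C0 h0) (lerD b3 e4).
have t3 := ler_wpM2l (mulr_ge0 r0 hg0) b5.
have z1 : 0 <= (2 * Cg + C * (Cg + Cx)) * (ga k ^+ 2 * E).
  apply: mulr_ge0; last exact: mulr_ge0.
  by apply: addr_ge0; [exact: mulr_ge0|apply: mulr_ge0 => //; exact: addr_ge0].
have z2 : 0 <= rho * sc2 * (h * E) by apply: mulr_ge0; exact: mulr_ge0.
exact: energy_arith t1 t2 t3 z1 z2.
Qed.

End Integrable.

(** The initial moment bounds [y 0] rather than the tracking error, and
    [c (x 0)] grows at most linearly. *)
Lemma state0_L1 : L1 (state 0).
Proof.
pose Q w := sqn (x 0 w) + sqn (u 0 w) + sqn (y 0 w).
have Q0 w : 0 <= Q w by rewrite !addr_ge0 ?sqn_ge0.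
have FQ : fmeas (F 0) Q.
  apply: (fmeasD (sFk 0)); last exact: (fmeas_sqn (sFk 0)).
  by apply: (fmeasD (sFk 0)); exact: (fmeas_sqn (sFk 0)).
have iQ : L1 Q.
  apply/integrableP; split.
    by apply/measurable_EFinP; exact: fmeas_measurable (sF 0) FQ.
  have := obs_init_moment obs; rewrite expectation.unlock; apply: le_lt_trans.
  rewrite le_eqVlt; apply/orP; left; apply/eqP; apply: eq_integral => w _ /=.
  by rewrite ger0_norm // /Q !sqn_enorm.
pose B := 1 + 2 * sqn xs + 2 * sqn us + 4 * sqn (c xs) + 8 * Mc ^+ 2 * sqn xs.
have m0 : 0 <= Mc ^+ 2 by exact: sqr_ge0.
have iB : L1 (fun w => B + (4 + 8 * Mc ^+ 2) * Q w).
  by apply: L1D; [exact: L1_cst|exact: L1Z].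
apply: (L1_ge0_le _ iB); first exact: fmeas_measurable (sF 0) (@state_measurable 0).
move=> w; rewrite state_ge0 /=.
have h1 := sqnB_le (x 0 w) xs; have h2 := sqnB_le (u 0 w) us.
have h3 := sqnB_le (y 0 w) (c (x 0 w)).
have h4 := sqn_c_le dc Mc0 J_bnd xs 0 (x 0 w) 0 0.
have px := sqn_ge0 (x 0 w); have pu := sqn_ge0 (u 0 w); have py := sqn_ge0 (y 0 w).
have h5 := ler_wpM2l m0 h1.
have h6 : 0 <= Mc ^+ 2 * sqn (u 0 w) by exact: mulr_ge0.
have h7 : 0 <= Mc ^+ 2 * sqn (y 0 w) by exact: mulr_ge0.
rewrite /dist subrr !sqn0 !addr0 in h4.
rewrite /state /dist /tracking_error /B /Q; lra.
Qed.

Lemma state_L1 k : L1 (state k).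
Proof.
elim: k => [|k IH]; first exact: state0_L1.
have [iE _] := energy_expected IH (lexx 1) (FT k).
have iB : L1 (fun w => Cd * (1 + energy 1 k.+1 w)).
  by apply: L1Z; apply: L1D => //; exact: L1_cst.
apply: (L1_ge0_le _ iB).
  exact: fmeas_measurable (sF k.+1) (@state_measurable k.+1).
by move=> w; rewrite state_ge0 /= state_le_energy.
Qed.

Variable Mh : R.
Hypothesis step_mass_sum : forall N, \sum_(k < N) step_mass k <= Mh.
Hypothesis al_div : forall M, exists N, M <= \sum_(k < N) al k.
Hypothesis ga_div : forall M, exists N, M <= \sum_(k < N) ga k.

Lemma EA_state_le rho k A : 1 <= rho -> F k A ->
  EA A (state k) <= Cd * (Pr A + EA A (energy rho k)).
Proof.
move=> r1 FA; have mA := mF FA; have iE := energy_L1 (state_L1 k) r1.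
have iE1 : L1 (fun w => 1 + energy rho k w) by apply: L1D => //; exact: L1_cst.
rewrite -[Pr A]mul1r -(EA_cst P mA) -EAD //; last exact: L1_cst.
rewrite -EAZ //; apply: EA_le => //; [exact: state_L1|exact: L1Z|].
by move=> w _; exact: state_le_energy.
Qed.

(** The error term of [energy_expected] is relative to the state, and the energy
    controls the state. *)
Lemma energy_convergence rho : 1 <= rho ->
  [/\ cvgn (fun k => EA setT (energy rho k)),
      exists B, forall k, EA setT (energy rho k) <= B,
      exists B, forall N, \sum_(k < N) EA setT (dissipation k) <= B &
      {ae P, forall w, cvgn (fun k => energy rho k w)}].
Proof.
move=> r1; have rt := energy_rate_ge0 r1; have Cd0 := le_trans ler01 Cd1.
pose eta k := energy_rate rho * Cd * step_mass k.
have eta0 k : 0 <= eta k.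
  by apply: mulr_ge0; [exact: mulr_ge0|exact: step_mass_ge0].
have etaM N : \sum_(k < N) eta k <= energy_rate rho * Cd * Mh.
  by rewrite -mulr_sumr; apply: ler_wpM2l; [exact: mulr_ge0|].
apply: (robbins_siegmund sF F_nd eta0 etaM).
- by move=> k; exact: energy_measurable.
- by move=> k; apply: energy_L1 => //; exact: state_L1.
- by move=> k w; exact: energy_ge0.
- by move=> k w; exact: dissipation_ge0.
move=> k A FA; have [_ h] := energy_expected (state_L1 k) r1 FA.
have h2 := EA_state_le r1 FA.
have h3 := ler_wpM2l (mulr_ge0 rt (step_mass_ge0 k)) h2.
exact: relative_arith h h3.
Qed.

Lemma state_bounded : exists B, forall k, EA setT (state k) <= B.
Proof.
have [_ [B hB] _ _] := energy_convergence (lexx 1).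
exists (Cd * (1 + B)) => k; apply: (le_trans (EA_state_le (lexx 1) (FT k))).
rewrite ler_wpM2l ?(le_trans ler01 Cd1) //; apply: lerD; last exact: hB.
exact: Pr_le1.
Qed.

Lemma tracking_sqn_L1 k : L1 (fun w => sqn (e k w)).
Proof.
apply: (L1_state_le (state_L1 k) (C := 1)); first exact: Fe.
by move=> w; rewrite mul1r; case: (parts_le_state k w).
Qed.

Let energy_diff k w : energy 2 k w - energy 1 k w = sqn (e k w).
Proof. by rewrite /energy /lyap; ring. Qed.

(** The energies with weights [1] and [2] on the tracking error both converge,
    hence so does their difference. *)
Lemma tracking_mean : EA setT (fun w => sqn (e k w)) @[k --> \oo] --> (0 : R).
Proof.
have r2 : (1 : R) <= 2 by rewrite ler1n.
have [c1 _ [B hB] _] := energy_convergence (lexx 1).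
have [c2 _ _ _] := energy_convergence r2.
have meanE k : EA setT (fun w => sqn (e k w)) =
    EA setT (energy 2 k) - EA setT (energy 1 k).
  rewrite -(EAB measurableT (energy_L1 (state_L1 k) r2)
                           (energy_L1 (state_L1 k) (lexx 1))).
  by congr (EA _ _); apply/funext => w; rewrite energy_diff.
apply: frequently_small_cvg0.
- by move=> k; apply: EA_ge0 => w; exact: sqn_ge0.
- move: c1 c2 => /cvg_ex[l1 h1] /cvg_ex[l2 h2].
  by apply/cvg_ex; exists (l2 - l1); rewrite (funext meanE); exact: cvgB h2 h1.
apply: (weighted_sum_frequently_small (al := ga)
  (b := fun k => EA setT (fun w => sqn (e k w)))) => //.
- by move=> k; exact: ltW.
- by move=> k; apply: EA_ge0 => w; exact: sqn_ge0.
move=> delta d0; exists (2 * B) => N.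
apply: (@le_trans _ _ (2 * \sum_(k < N) EA setT (dissipation k))).
  rewrite mulr_sumr; apply: ler_sum => k _.
  rewrite -EAZ //; last exact: tracking_sqn_L1.
  rewrite -EAZ //; last exact: dissipation_L1 (state_L1 k).
  apply: EA_le => //.
  - by apply: L1Z; exact: tracking_sqn_L1.
  - by apply: L1Z; exact: dissipation_L1 (state_L1 k).
  - move=> w _; rewrite /dissipation.
    have : 0 <= al k * q (dstep k w) by rewrite mulr_ge0 ?q_ge0 // ltW.
    lra.
have s0 : 0 <= delta * \sum_(k < N) ga k.
  by rewrite mulr_ge0 ?(ltW d0) // sumr_ge0 // => k _; exact: ltW.
have := hB N; lra.
Qed.

Lemma energy_ae : {ae P, forall w, cvgn (fun k => energy 1 k w) /\
  sqn (e k w) @[k --> \oo] --> (0 : R)}.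
Proof.
have r2 : (1 : R) <= 2 by rewrite ler1n.
have [_ _ _ c1] := energy_convergence (lexx 1).
have [_ _ _ c2] := energy_convergence r2.
have small : {ae P, forall w, forall eps j, 0 < eps ->
    exists2 k, (j <= k)%N & sqn (e k w) < eps}.
  apply: ae_frequently_small.
  - exact: tracking_sqn_L1.
  - by move=> k w; exact: sqn_ge0.
  - move=> eps j eps0; have /cvgrPdist_le /(_ eps eps0) := tracking_mean.
    move=> [N _ hN]; exists (maxn j N); first exact: leq_maxl.
    have := hN (maxn j N) (leq_maxr _ _); rewrite sub0r normrN.
    exact: le_trans (ler_norm _).
apply: filterS3 c1 c2 small => w h1 h2 hs; split=> //.
apply: frequently_small_cvg0.
- by move=> k; exact: sqn_ge0.
- rewrite (_ : (fun k => _) = fun k => energy 2 k w - energy 1 k w).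
    exact: is_cvgB.
  by apply/funext => k; rewrite energy_diff.
- by move=> eps j eps0; have [k jk /ltW h] := hs eps j eps0; exists k.
Qed.

Section Localization.
Variable N : R.
Hypothesis N0 : 0 <= N.

(** The constraint values are bounded only as long as the states are; the levels
    are known events, decrease with [k], and exhaust the almost sure event that
    the energy converges. *)
Fixpoint level k : set T := match k with
  | 0 => [set w | state 0 w <= N]
  | k'.+1 => level k' `&` [set w | state k'.+1 w <= N]
  end.

Lemma level_F k : F k (level k).
Proof.
elim: k => [|k IH]; first by apply: fmeas_le; exact: state_measurable.
apply: (sigma_algebra_setI (sFk k.+1)); first exact: F_nd.
by apply: fmeas_le; exact: state_measurable.
Qed.

Lemma level_le k w : level k w -> state k w <= N.
Proof. by case: k => [|k] //= [_]. Qed.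

Lemma level_all k w : (forall j, state j w <= N) -> level k w.
Proof. by move=> h; elim: k => [|k IH] /=; [exact: h|split=> //; exact: h]. Qed.

Definition lagr k w := lagrangian f c (x k w) (u k w).

Lemma lagr_measurable k : fmeas (F k) (lagr k).
Proof.
apply: (fmeasD (sFk k)); last exact: (fmeas_dotcv (sFk k)).
exact: (fmeas_continuous (sFk k)).
Qed.

Variable Cl : R.
Hypothesis Cl0 : 0 <= Cl.
Hypothesis lagrC : forall z v b, `|lagrangian f c z v| <= Cl * (1 + dist xs us z v b).

Lemma lagr_L1 k : L1 (lagr k).
Proof.
apply: (L1_le _ (L1Z Cl (state_L1 k))).
  exact: fmeas_measurable (sF k) (@lagr_measurable k).
by move=> w; exact: lagrC.
Qed.

(** Nonnegative, by the quadratic bound on the Lagrangian. *)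
Definition shifted k w := lagr k w + Cl * Cd * (1 + energy 1 k w).

Lemma shifted_ge0 k w : 0 <= shifted k w.
Proof.
have := lagrC (x k w) (u k w) (e k w); rewrite -/(state k w) ler_norml => /andP[h _].
have := ler_wpM2l Cl0 (state_le_energy k w (lexx 1)).
by rewrite /shifted -mulrA /lagr; lra.
Qed.

Lemma shifted_L1 k : L1 (shifted k).
Proof.
apply: L1D; first exact: lagr_L1.
apply: L1Z; apply: L1D; first exact: L1_cst.
by apply: energy_L1 => //; exact: state_L1.
Qed.

Let CG := 2 * Cg + 2 * (Mc ^+ 2 * (2 * Cg + 2)).

(** The two gradients differ by the Jacobian applied to the dual step. *)
Lemma sqn_lgrad_le k w : sqn (lgrad k w) <= CG * state k w.
Proof.
have -> : lgrad k w = pgrad k w - (J (x k w))^T *m dstep k w.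
  rewrite /lgrad /pgrad /dstep mulmxBr opprB -addrA; congr (_ + _).
  by rewrite addrC subrK.
apply: (le_trans (sqnB_le _ _)); have h1 := sqn_pgrad_le k w.
have h2 := sqn_JT Mc0 J_bnd (x k w) (dstep k w).
have h3 := ler_wpM2l (sqr_ge0 Mc) (sqn_dstep_le k w).
rewrite /CG; lra.
Qed.

Lemma L1_lgrad k : L1 (fun w => sqn (lgrad k w)).
Proof. exact: (L1_state_le (state_L1 k) (@Flgrad k) (sqn_lgrad_le k)). Qed.

Lemma EA_state_level k : EA (level k) (state k) <= N.
Proof.
have mA := mF (@level_F k); apply: le_trans (EA_cst_le P mA N0).
apply: EA_le => //; [exact: state_L1|exact: L1_cst|].
by move=> w; exact: level_le.
Qed.

Variable delta : R.
Hypothesis delta0 : 0 < delta.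

Let Bc0 := 2 * sqn (c xs) + 2 * Mc ^+ 2 * N + 1.
(* The weight of Young's inequality for which the part with [sqn (c x)] costs at
   most [delta] while the state is below [N]. *)
Let tt := kappa / 2 * Bc0 / delta.
Let C1 := Mc ^+ 2 / 2 + kappa / 2 * tt + kappa / 2.
Let C2 := Lf + LJ * (1 + 2 * sqn us + 2 * N) + Mc ^+ 2 / 2.

Let Bc0_gt0 : 0 < Bc0.
Proof.
have h : 0 <= Mc ^+ 2 * N by rewrite mulr_ge0 ?sqr_ge0.
by have := sqn_ge0 (c xs); rewrite /Bc0; lra.
Qed.

Let tt_gt0 : 0 < tt.
Proof. by rewrite divr_gt0 // mulr_gt0 // divr_gt0. Qed.

Let C1_ge0 : 0 <= C1.
Proof.
have h := mulr_gt0 kappa_gt0 tt_gt0; have h2 := sqr_ge0 Mc.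
by have h3 := kappa_gt0; rewrite /C1; lra.
Qed.

Let C2_ge0 : 0 <= C2.
Proof.
have s0 := sqn_ge0 us; apply: addr_ge0; last by rewrite divr_ge0 ?sqr_ge0.
apply: addr_ge0 => //; apply: mulr_ge0 => //; have := N0; lra.
Qed.

Lemma lagr_pathwise k w : level k w ->
  lagr k.+1 w + al k / 2 * sqn (lgrad k w) <=
  lagr k w - al k * dotcv (lgrad k w) (noise k w) + al k * delta
  + C1 * al k * sqn (dstep k w)
  + C2 * (2 * al k ^+ 2) * (sqn (pgrad k w) + sqn (noise k w)).
Proof.
move=> /level_le Sw; have a0 := ltW (al_gt0 k).
have := lagrangian_step kappa_gt0 df dc Lf0 Mc0 LJ0 f_lip J_bnd J_lip
  (x k w) (u k w) (lam k w) (ghat k w) (Jhat k w) (al_gt0 k) (kal k) tt_gt0.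
have [xE uE _] := iter_xuy k w.
rewrite /= -/(lam k w) -xE -uE -/(dstep k w) -/(lagr k w) -/(lagr k.+1 w).
rewrite -/(lgrad k w) -/(pgrad k w) -/(noise k w) => h.
have hd : dist xs us (x k w) (u k w) (e k w) <= N.
  by move: Sw; rewrite /state; lra.
have hc := sqn_c_le dc Mc0 J_bnd xs us (x k w) (u k w) (e k w).
have hcN := ler_wpM2l (sqr_ge0 Mc) hd.
have hu := sqn_u_le xs us (x k w) (u k w) (e k w).
have eu : enorm (u k w) <= 1 + 2 * sqn us + 2 * N.
  have := enorm_ge0 (u k w); have := sqn_enorm (u k w); nra.
have cB : kappa / 2 * tt^-1 * sqn (c (x k w)) <= delta.
  have -> : delta = kappa / 2 * tt^-1 * Bc0.
    by rewrite /tt; field; rewrite !gt_eqF.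
  apply: ler_wpM2l; last by rewrite /Bc0; lra.
  by rewrite mulr_ge0 ?invr_ge0 ?(ltW tt_gt0) // divr_ge0 // ltW.
have t1 := ler_wpM2l a0 cB.
have eC : Lf + LJ * enorm (u k w) + Mc ^+ 2 / 2 <= C2.
  by rewrite /C2 lerD2r lerD2l ler_wpM2l.
have sn0 : 0 <= 2 * al k ^+ 2 * (sqn (pgrad k w) + sqn (noise k w)).
  by rewrite !mulr_ge0 ?sqr_ge0 // addr_ge0 ?sqn_ge0.
have t2 := ler_wpM2r sn0 eC.
have := lagr_arith h t1 t2; rewrite -/C1 !mulrA; exact.
Qed.

Let C3 := C1 * opnorm D + 2 * C2 * (Cg + Cx) * N + Cl * Cd * energy_rate 1 * N.

Let C3_ge0 : 0 <= C3.
Proof.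
have h1 := mulr_ge0 C1_ge0 (opnorm_ge0 D).
have h2 : 0 <= C2 * (Cg + Cx) * N.
  by apply: mulr_ge0 => //; apply: mulr_ge0 => //; exact: addr_ge0.
have h3 : 0 <= Cl * Cd * energy_rate 1 * N.
  apply: mulr_ge0 => //; apply: mulr_ge0; last exact: energy_rate_ge0.
  by apply: mulr_ge0 => //; exact: le_trans ler01 Cd1.
rewrite /C3; lra.
Qed.

Lemma shifted_step k :
  EA (level k.+1) (shifted k.+1) + al k / 2 * EA (level k) (fun w => sqn (lgrad k w))
  <= EA (level k) (shifted k) + al k * delta
     + C3 * (EA setT (dissipation k) + step_mass k).
Proof.
have FA := @level_F k; have mA := mF FA; have a0 := ltW (al_gt0 k).
have iS := state_L1 k.
have sub : EA (level k.+1) (shifted k.+1) <= EA (level k) (shifted k.+1).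
  apply: EA_subset => //; first exact: mF (@level_F k.+1).
  - by move=> w [].
  - exact: shifted_L1.
  - by move=> w; exact: shifted_ge0.
have [iN hN] := noise_le_state iS FA.
have [i6 e6] := noise_centered (@Flgrad k) (L1_lgrad k) (L1_lam iS) FA.
have [iE1 hE] := energy_expected iS (lexx 1) FA.
have iE := energy_L1 iS (lexx 1).
have iL := lagr_L1 k; have iL1 := lagr_L1 k.+1.
have iG := L1_lgrad k; have iD := L1_dstep iS; have iP := L1_pgrad iS.
have iC z : L1 (fun _ => z) by exact: L1_cst.
have iPN := L1D iP iN.
set E := EA (level k) (state k).
have EN : E <= N by exact: EA_state_level.
have lag : EA (level k) (lagr k.+1) + al k / 2 * EA (level k) (fun w => sqn (lgrad k w))
  <= EA (level k) (lagr k) + al k * delta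
     + C1 * al k * EA (level k) (fun w => sqn (dstep k w))
     + C2 * (2 * al k ^+ 2) * ((Cg + Cx) * N).
  have j6 := L1Z (al k) i6; have jG := L1Z (al k / 2) iG.
  have jD := L1Z (C1 * al k) iD.
  have jP := L1Z (C2 * (2 * al k ^+ 2)) iPN.
  have k1 := L1B iL j6; have k2 := L1D k1 (iC (al k * delta)).
  have k3 := L1D k2 jD; have k4 := L1D k3 jP.
  have := EA_le mA (L1D iL1 jG) k4 (@lagr_pathwise k).
  rewrite (EAD mA iL1 jG) (EAZ mA _ iG) (EAD mA k3 jP) (EAZ mA _ iPN).
  rewrite (EAD mA k2 jD) (EAZ mA _ iD) (EAD mA k1 (iC _)) (EAB mA iL j6).
  rewrite (EAZ mA _ i6) e6 mulr0 subr0 (EAD mA iP iN) => h; apply: (le_trans h).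
  have d1 : EA (level k) (fun=> al k * delta) <= al k * delta.
    by apply: EA_cst_le => //; rewrite mulr_ge0 // ltW.
  have p1 : EA (level k) (fun w => sqn (pgrad k w)) <= Cg * E.
    rewrite -EAZ //; apply: EA_le => //; first exact: L1Z.
    by move=> w _; exact: sqn_pgrad_le.
  have p2 : EA (level k) (fun w => sqn (pgrad k w)) +
      EA (level k) (fun w => sqn (noise k w)) <= (Cg + Cx) * N.
    rewrite mulrDl; apply: lerD.
      by apply: (le_trans p1); exact: ler_wpM2l.
    by apply: (le_trans hN); exact: ler_wpM2l.
  apply: lerD; first by rewrite lerD2r lerD2l.
  apply: ler_wpM2l => //; rewrite !mulr_ge0 ?sqr_ge0 //.
have dn : EA (level k) (fun w => sqn (dstep k w)) <=
    opnorm D * EA setT (fun w => q (dstep k w)).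
  apply: (@le_trans _ _ (EA setT (fun w => sqn (dstep k w)))).
    by apply: EA_subset => // w; exact: sqn_ge0.
  rewrite -EAZ //; last exact: L1_qdstep iS.
  apply: EA_le => //; first by apply: L1Z; exact: L1_qdstep iS.
  by move=> w _; exact: sqn_le_q.
have qd : al k * EA setT (fun w => q (dstep k w)) <= EA setT (dissipation k).
  rewrite -EAZ //; last exact: L1_qdstep iS.
  apply: EA_le => //; first by apply: L1Z; exact: L1_qdstep.
    exact: dissipation_L1 iS.
  by move=> w _; rewrite lerDl mulr_ge0 ?sqn_ge0 // divr_ge0 // ltW.
have sh j : L1 (energy 1 j) -> L1 (lagr j) -> EA (level k) (shifted j) =
    EA (level k) (lagr j) + Cl * Cd * (Pr (level k) + EA (level k) (energy 1 j)).
  move=> ie il; have i1 := L1D (iC 1) ie.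
  rewrite /shifted (EAD mA il (L1Z _ i1)) (EAZ mA _ i1) (EAD mA (iC 1) ie).
  by rewrite EA_cst // mul1r.
rewrite (sh k.+1) // in sub; rewrite (sh k) //.
have D0 : 0 <= EA (level k) (dissipation k).
  by apply: EA_ge0 => w; exact: dissipation_ge0.
have am : al k ^+ 2 <= step_mass k.
  rewrite /step_mass; have g2 := sqr_ge0 (ga k).
  have am : al k ^+ 2 <= al k ^+ 2 / ga k.
    by rewrite ler_peMr ?sqr_ge0 // -invr1 lef_pV2 ?posrE.
  by apply: (le_trans am); rewrite lerDl.
have m0 := step_mass_ge0 k.
have cc0 : 0 <= Cl * Cd by apply: mulr_ge0 => //; exact: le_trans ler01 Cd1.
have r0 := energy_rate_ge0 (lexx 1).
have D1 : 0 <= EA setT (dissipation k).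
  by apply: EA_ge0 => w; exact: dissipation_ge0.
have CN0 : 0 <= (Cg + Cx) * N by apply: mulr_ge0 => //; exact: addr_ge0.
have t1 := ler_wpM2l cc0 (lerD (lexx (Pr (level k))) hE).
have t2 := ler_wpM2l (mulr_ge0 cc0 (mulr_ge0 r0 m0)) EN.
have t3 := ler_wpM2l (mulr_ge0 C1_ge0 a0) dn.
have t4 := ler_wpM2l (mulr_ge0 C1_ge0 (opnorm_ge0 D)) qd.
have t5 := ler_wpM2l (mulr_ge0 C2_ge0 CN0) am.
have t6 := mulr_ge0 cc0 D0.
have u1 := mulr_ge0 (mulr_ge0 C1_ge0 (opnorm_ge0 D)) m0.
have u2 : 0 <= 2 * C2 * (Cg + Cx) * N * EA setT (dissipation k).
  by apply: mulr_ge0 => //; rewrite -mulrA; apply: mulr_ge0 => //; exact: mulr_ge0.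
have u3 : 0 <= Cl * Cd * energy_rate 1 * N * EA setT (dissipation k).
  by apply: mulr_ge0 => //; apply: mulr_ge0 => //; exact: mulr_ge0.
exact: shifted_arith sub lag t1 t2 t3 t4 t5 t6 u1 u2 u3.
Qed.

Lemma shifted_recursion : exists2 C, 0 <= C & forall k,
  EA (level k.+1) (shifted k.+1) + al k / 2 * EA (level k) (fun w => sqn (lgrad k w))
  <= EA (level k) (shifted k) + al k * delta
     + C * (EA setT (dissipation k) + step_mass k).
Proof. by exists C3; [exact: C3_ge0|exact: shifted_step]. Qed.

End Localization.

Definition stationarity k w := sqn (lgrad k w) + q (dstep k w).

Lemma stationarity_ge0 k w : 0 <= stationarity k w.
Proof. by rewrite addr_ge0 ?sqn_ge0 ?q_ge0. Qed.

Lemma stationarity_L1 k : L1 (stationarity k).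
Proof. by apply: L1D; [exact: L1_lgrad|exact: L1_qdstep (state_L1 k)]. Qed.

Variable Cl : R.
Hypothesis Cl0 : 0 <= Cl.
Hypothesis lagrC : forall z v b, `|lagrangian f c z v| <= Cl * (1 + dist xs us z v b).

(** On the event that the states stay below [N], the step-weighted means of the
    stationarity measure tend to [0]: its weighted sum is bounded by the total
    decrease of the shifted Lagrangian plus [delta * \sum al] for every [delta]. *)
Lemma stationarity_level_small N eps j : 0 <= N -> 0 < eps ->
  exists2 k, (j <= k)%N & EA (level N k) (stationarity k) <= eps.
Proof.
move=> N0; apply: (weighted_sum_frequently_small (al := al)
  (b := fun k => EA (level N k) (stationarity k))) => //.
- by move=> k; exact: ltW.
- by move=> k; apply: EA_ge0 => w; exact: stationarity_ge0.
move=> delta d0; have d2 : 0 < delta / 2 by rewrite divr_gt0.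
have [C C0 hC] := shifted_recursion N0 Cl0 lagrC d2.
have [_ _ [B hB] _] := energy_convergence (lexx 1).
pose v k := EA (level N k) (shifted Cl k).
have v0 k : 0 <= v k by apply: EA_ge0 => w; exact: shifted_ge0.
pose r k := (2 * C + 1) * (EA setT (dissipation k) + step_mass k).
have key k : al k * EA (level N k) (stationarity k) <=
    2 * (v k - v k.+1) + delta * al k + r k.
  have mA := mF (@level_F N k); have a0 := ltW (al_gt0 k).
  have iG := L1_lgrad k; have iq := L1_qdstep (state_L1 k).
  rewrite (EAD mA iG iq).
  have hq : al k * EA (level N k) (fun w => q (dstep k w)) <= EA setT (dissipation k).
    apply: (@le_trans _ _ (al k * EA setT (fun w => q (dstep k w)))).
      by apply: ler_wpM2l => //; apply: EA_subset => // w; exact: q_ge0.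
    rewrite -EAZ //; apply: EA_le => //; first exact: L1Z.
      exact: dissipation_L1 (state_L1 k).
    by move=> w _; rewrite lerDl mulr_ge0 ?sqn_ge0 // divr_ge0 // ltW.
  have h := hC k; rewrite -/(v k) -/(v k.+1) in h.
  have m0 := step_mass_ge0 k; rewrite /r.
  exact: stationarity_arith h hq m0.
exists (2 * v 0 + (2 * C + 1) * (B + Mh)) => M.
apply: (le_trans (telescope_le key M)).
have : \sum_(k < M) r k <= (2 * C + 1) * (B + Mh).
  rewrite -mulr_sumr big_split /=; apply: ler_wpM2l; last exact: (lerD (hB M) (step_mass_sum M)).
  by rewrite addr_ge0 // mulr_ge0.
exact: bound_arith (v0 M).
Qed.

Lemma EA_indic A X : EA setT (fun w => \1_A w * X w) = EA A X.
Proof.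
rewrite /EA [RHS]Rintegral_mkcond; apply: eq_Rintegral => w _.
by rewrite patchE indicE; case: ifP; rewrite ?mul1r ?mul0r.
Qed.

(** Almost surely the energy converges, so the states stay below some integer
    level for ever. *)
Lemma frequently_stationary : {ae P, forall w, forall eps j, 0 < eps ->
  exists2 k, (j <= k)%N & stationarity k w < eps}.
Proof.
have lev (N : nat) : {ae P, forall w, forall eps j, 0 < eps ->
    exists2 k, (j <= k)%N & \1_(level N%:R k) w * stationarity k w < eps}.
  have ind01 k w : 0 <= (\1_(level N%:R k) w : R) <= 1.
    by rewrite indicE; case: (_ \in _); rewrite ?lexx ?ler01.
  apply: ae_frequently_small.
  - move=> k; apply: (L1_ge0_le _ (stationarity_L1 k)).
      apply: measurable_funM; last exact: L1_measurable (stationarity_L1 k).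
      by apply: measurable_indic; exact: mF (@level_F N%:R k).
    move=> w; have /andP[i0 i1] := ind01 k w; have s0 := stationarity_ge0 k w.
    by rewrite mulr_ge0 //= ler_piMl.
  - move=> k w; have /andP[i0 _] := ind01 k w.
    by rewrite mulr_ge0 ?stationarity_ge0.
  - move=> eps j eps0.
    have [k jk h] := stationarity_level_small j (ler0n R N) eps0.
    by exists k => //; rewrite EA_indic.
have lev' := ae_foralln lev.
apply: filterS2 lev' energy_ae => w hlev [hE _] eps j eps0.
have [B hB] := cvgn_bounded hE.
pose N := (Num.truncn (Cd * (1 + B))).+1.
have hN k : state k w <= N%:R.
  apply: (le_trans (state_le_energy k w (lexx 1))).
  apply: (@le_trans _ _ (Cd * (1 + B))).
    by apply: ler_wpM2l; [exact: le_trans ler01 Cd1|rewrite lerD2l].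
  exact/ltW/truncnS_gt.
have [k jk h] := hlev N eps j eps0; exists k => //.
move: h; rewrite indicE mem_set ?mul1r //; exact: level_all.
Qed.

End Reference.

(** The growth constants depend on the reference pair and are eliminated here. *)
Lemma reference_conclusions xs us (Mh : R) : KKT f c K (xs, us) ->
  (forall N, \sum_(k < N) step_mass k <= Mh) ->
  (forall M, exists N, M <= \sum_(k < N) al k) ->
  (forall M, exists N, M <= \sum_(k < N) ga k) ->
  [/\ forall k, L1 (state xs us k),
      exists B, forall k, EA setT (state xs us k) <= B,
      EA setT (fun w => sqn (e k w)) @[k --> \oo] --> (0 : R),
      {ae P, forall w, cvgn (fun k => energy xs us 1 k w) /\
         sqn (e k w) @[k --> \oo] --> (0 : R)} &
      {ae P, forall w, forall eps j, 0 < eps ->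
         exists2 k, (j <= k)%N & stationarity k w < eps}].
Proof.
move=> kkt hM hal hga.
have [C0 C00 hC0] := multiplier_growth spd dc Mc0 J_bnd kkt cK.
have [Cg CCg hCg] := gradient_growth Lf0 Mc0 LJ0 f_lip J_bnd J_lip kkt C00 hC0.
have Cg0 : 0 <= Cg := le_trans C00 CCg.
have hmul z v b : sqn (proj D K (v + D *m b) - us) <= Cg * dist xs us z v (b - c z).
  by apply: (le_trans (hC0 z v b)); rewrite ler_wpM2r ?dist_ge0.
have [Cl Cl0 hCl] := lagrangian_bound df dc Lf0 Mc0 f_lip J_bnd xs us.
split.
- exact: (state_L1 kkt Cg0 hmul hCg).
- exact: (state_bounded kkt Cg0 hmul hCg hM).
- exact: (tracking_mean kkt Cg0 hmul hCg hM hga).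
- exact: (energy_ae kkt Cg0 hmul hCg hM hga).
- exact: (frequently_stationary kkt Cg0 hmul hCg hM hal hga Cl0 hCl).
Qed.

End Process.

(** * Convergence of a single trajectory *)

Section Trajectory.
Context {R : realType} {n m : nat}.

Lemma seq_cvg_unique (g : nat -> R) (l l' : R) :
  g @ \oo --> l -> g @ \oo --> l' -> l = l'.
Proof.
by move=> h h'; rewrite -(cvg_lim (@Rhausdorff R) h) (cvg_lim (@Rhausdorff R) h').
Qed.

Lemma sqn_col_mx (a : 'cV[R]_n) (b : 'cV[R]_m) : sqn (col_mx a b) = sqn a + sqn b.
Proof. by rewrite /sqn /dotcv tr_col_mx mul_row_col mxE. Qed.

(** Pick a point of the set in each rational box that meets it. *)
Lemma dense_sequence (S : set ('cV[R]_n * 'cV[R]_m)) : S !=set0 ->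
  exists2 z : nat -> 'cV[R]_n * 'cV[R]_m, forall i, S (z i) &
    forall p eps, S p -> 0 < eps ->
      exists i, sqn (p.1 - (z i).1) + sqn (p.2 - (z i).2) < eps.
Proof.
move=> [z0 Sz0].
pose I : countType := ('cV[rat]_n * 'cV[rat]_m * nat)%type.
pose B (i : I) := [set p | [/\ S p,
  forall k, `|p.1 k 0 - ratr (i.1.1 k 0)| < i.2.+1%:R^-1 &
  forall k, `|p.2 k 0 - ratr (i.1.2 k 0)| < i.2.+1%:R^-1]].
pose g i := if pselect (B i !=set0) then xget z0 (B i) else z0.
have Sg i : S (g i).
  rewrite /g; case: pselect => // -[p Bp].
  by have [] := @xgetPex _ z0 (B i) (ex_intro _ p Bp).
exists (fun k => if (unpickle k : option I) is Some i then g i else z0).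
  by move=> k; case: unpickle.
move=> p eps Sp eps0.
pose N := (n + m)%:R : R.
have N0 : 0 <= N by exact: ler0n.
pose r := Num.truncn ((N + 1) * (4 / eps)).
have rpos : 0 < r.+1%:R^-1 :> R by rewrite invr_gt0.
set s : R := r.+1%:R^-1 in rpos.
have hs : N * (4 * s) < eps.
  have : (N + 1) * (4 / eps) < r.+1%:R by exact: truncnS_gt.
  move=> h; rewrite mulrA ltr_pdivrMr // in h.
  have : (N + 1) * 4 * s < eps.
    have -> : eps = r.+1%:R * eps * s by rewrite mulrAC /s mulfV ?mul1r ?pnatr_eq0.
    by rewrite ltr_pM2r.
  by have := rpos; lra.
have s1 : s <= 1 by rewrite invf_le1 // ler1n.
have [a ha] := rational_approx p.1 rpos; have [b hb] := rational_approx p.2 rpos.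
exists (pickle ((a, b, r) : I)); rewrite pickleK.
have Bne : B (a, b, r) !=set0 by exists p; split.
have [_ g1 g2] : B (a, b, r) (g (a, b, r)).
  rewrite /g; case: pselect => // -[q Bq].
  exact: (@xgetPex _ z0 (B (a, b, r)) (ex_intro _ q Bq)).
have close l (v v' : 'cV[R]_l) (t : 'cV[rat]_l) :
    (forall k, `|v k 0 - ratr (t k 0)| < s) ->
    (forall k, `|v' k 0 - ratr (t k 0)| < s) -> sqn (v - v') <= l%:R * (4 * s).
  move=> h h'; rewrite sqnE -[l in l%:R]card_ord -sumr_const mulr_suml.
  apply: ler_sum => k _; rewrite mul1r !mxE.
  have := h k; have := h' k; rewrite !ltr_norml => /andP[x1 x2] /andP[x3 x4].
  nra.
have := close _ _ _ _ ha g1; have := close _ _ _ _ hb g2.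
by move: hs; rewrite /N natrD; lra.
Qed.

Variables (f : 'cV[R]_n -> R) (c : 'cV[R]_n -> 'cV[R]_m) (K : set 'cV[R]_m)
  (D : 'M[R]_m) (kappa : R).
Hypothesis cK : closed_convex_cone K.
Hypothesis spd : sym_posdef D.
Hypothesis kappa_gt0 : 0 < kappa.
Hypothesis cc : continuous c.
Hypothesis cgrad : continuous (gradient f).
Hypothesis cJ : continuous (jacobian_cv c).

Local Notation q := (wnorm2 (invmx D)).
Local Notation grad := (gradient f).
Local Notation J := (jacobian_cv c).

Section Limit.
Variables (x : nat -> 'cV[R]_n) (u y : nat -> 'cV[R]_m).
Variables (xb : 'cV[R]_n) (ub : 'cV[R]_m).
Hypothesis xl : x k @[k --> \oo] --> xb.
Hypothesis ul : u k @[k --> \oo] --> ub.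

Lemma cvg_comp_seq p r (g : 'cV[R]_n -> 'M[R]_(p, r)) : continuous g ->
  g (x k) @[k --> \oo] --> g xb.
Proof. by move=> cg; apply: continuous_cvg => //; exact: cg. Qed.

Lemma cvg_multiplier : sqn (y k - c (x k)) @[k --> \oo] --> (0 : R) ->
  proj D K (u k + D *m y k) @[k --> \oo] --> proj D K (ub + D *m c xb).
Proof.
move=> el; apply: (@cvg_proj _ _ D K spd _ _ _ (fun k => u k + D *m y k)).
apply: cvgD => //.
apply: cvg_mulmx; first exact: cvg_cst.
have e0 : (y k - c (x k)) @[k --> \oo] --> (0 : 'cV[R]_m).
  by apply: cvg_sqnP; under eq_fun do rewrite subr0.
rewrite (_ : y = fun k => (y k - c (x k)) + c (x k)); last first.
  by apply/funext => k; rewrite subrK.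
by rewrite -[c xb]add0r; apply: cvgD => //; exact: cvg_comp_seq.
Qed.

Lemma cvg_lgrad (lm : nat -> 'cV[R]_m) (lb : 'cV[R]_m) :
  lm k @[k --> \oo] --> lb ->
  (grad (x k) + (J (x k))^T *m lm k) @[k --> \oo] --> grad xb + (J xb)^T *m lb.
Proof.
move=> ll; apply: cvgD; first exact: cvg_comp_seq.
apply: cvg_mulmx => //; apply: cvg_trmx; exact: cvg_comp_seq.
Qed.

End Limit.

Variables (x : nat -> 'cV[R]_n) (u y : nat -> 'cV[R]_m).
Local Notation lam k := (proj D K (u k + D *m y k)).
Hypothesis e0 : sqn (y k - c (x k)) @[k --> \oo] --> (0 : R).

(** In the limit the gradient of the Lagrangian vanishes and the dual step
    becomes the fixed-point equation of [proj_fixP]. *)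
Lemma cluster_KKT xb ub :
  (forall eps j, 0 < eps -> exists k, [/\ (j <= k)%N,
     sqn (x k - xb) < eps, sqn (u k - ub) < eps &
     sqn (grad (x k) + (J (x k))^T *m u k) + q (lam k - u k) < eps]) ->
  KKT f c K (xb, ub).
Proof.
move=> h; have hj j := h j.+1%:R^-1 j ltac:(by rewrite invr_gt0).
pose phi j := sval (cid (hj j)).
have phiP j : [/\ (j <= phi j)%N, sqn (x (phi j) - xb) < j.+1%:R^-1,
    sqn (u (phi j) - ub) < j.+1%:R^-1 &
    sqn (grad (x (phi j)) + (J (x (phi j)))^T *m u (phi j)) +
      q (lam (phi j) - u (phi j)) < j.+1%:R^-1].
  exact: (svalP (cid (hj j))).
have sq (g : nat -> R) : (forall j, 0 <= g j <= j.+1%:R^-1) ->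
    g @ \oo --> (0 : R).
  move=> hg; apply: (squeeze_cvgr _ (cvg_cst 0) cvg_harmonic).
  by apply: nearW => j; exact: hg.
have xl : x (phi j) @[j --> \oo] --> xb.
  by apply: cvg_sqnP; apply: sq => j; have [_ /ltW -> _ _] := phiP j; rewrite sqn_ge0.
have ul : u (phi j) @[j --> \oo] --> ub.
  by apply: cvg_sqnP; apply: sq => j; have [_ _ /ltW -> _] := phiP j; rewrite sqn_ge0.
have el : sqn (y (phi j) - c (x (phi j))) @[j --> \oo] --> (0 : R).
  apply/cvgrPdist_le => eps eps0; move/cvgrPdist_le : e0 => /(_ eps eps0) [N _ hN].
  exists N => // j Nj; apply: hN => /=; apply: leq_trans Nj _.
  by have [] := phiP j.
have ll := cvg_multiplier xl ul el.
have dl : (lam (phi j) - u (phi j)) @[j --> \oo] --> proj D K (ub + D *m c xb) - ub.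
  exact: cvgB.
have gl : sqn (grad (x (phi j)) + (J (x (phi j)))^T *m u (phi j)) @[j --> \oo] -->
    sqn (grad xb + (J xb)^T *m ub).
  by apply: cvg_sqn; exact: (cvg_lgrad xl ul).
have ql : q (lam (phi j) - u (phi j)) @[j --> \oo] -->
    q (proj D K (ub + D *m c xb) - ub) by exact: cvg_wnorm2 dl.
have z1 : sqn (grad xb + (J xb)^T *m ub) = 0.
  apply: (seq_cvg_unique gl); apply: sq => j; rewrite sqn_ge0 /=.
  have [_ _ _ /ltW] := phiP j; apply: le_trans.
  by rewrite lerDl; exact: spd_ge0 (spd_inv spd).
have z2 : q (proj D K (ub + D *m c xb) - ub) = 0.
  apply: (seq_cvg_unique ql); apply: sq => j.
  rewrite (spd_ge0 _ (spd_inv spd)) /=.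
  have [_ _ _ /ltW] := phiP j; apply: le_trans.
  by rewrite lerDr sqn_ge0.
have fix_ub : proj D K (ub + D *m c xb) = ub.
  apply/eqP; rewrite -subr_eq0; apply/eqP/sqn_eq0/eqP.
  rewrite eq_le sqn_ge0 andbT.
  by have := spd_coercive (proj D K (ub + D *m c xb) - ub) (spd_inv spd);
    rewrite z2 mulr0.
have [k1 k2 k3] := (proj_fixP spd ub (c xb) cK).1 fix_ub.
by split=> //=; exact: sqn_eq0.
Qed.

(** Opial's argument: the energies relative to a dense set of reference pairs
    converge and a cluster point is itself a reference pair, so that the energy
    relative to the cluster point tends to [0]. *)
Lemma trajectory_cvg (z : nat -> 'cV[R]_n * 'cV[R]_m) :
  (forall p eps, KKT f c K p -> 0 < eps ->
     exists i, sqn (p.1 - (z i).1) + sqn (p.2 - (z i).2) < eps) ->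
  (forall i, cvgn (fun k => lyap D kappa (z i).1 (z i).2 1 (x k) (u k) (y k - c (x k)))) ->
  (forall eps j, 0 < eps -> exists2 k, (j <= k)%N &
     sqn (grad (x k) + (J (x k))^T *m u k) + q (lam k - u k) < eps) ->
  exists p, [/\ KKT f c K p, x k @[k --> \oo] --> p.1 & u k @[k --> \oo] --> p.2].
Proof.
move=> dense cvE stat.
pose Cd := 1 + kappa * opnorm D.
have ko0 : 0 <= kappa * opnorm D by rewrite mulr_ge0 ?opnorm_ge0 // ltW.
have Cd1 : 1 <= Cd by rewrite lerDl.
have distE i k : sqn (x k - (z i).1) + sqn (u k - (z i).2) <=
    Cd * lyap D kappa (z i).1 (z i).2 1 (x k) (u k) (y k - c (x k)).
  have := dist_le_lyap spd kappa_gt0 (z i).1 (z i).2 (x k) (u k) (y k - c (x k)) (lexx 1).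
  by rewrite /dist; apply: le_trans; rewrite lerDl sqn_ge0.
pose psi j := sval (cid2 (stat j.+1%:R^-1 j ltac:(by rewrite invr_gt0))).
have psiP j : (j <= psi j)%N /\
   sqn (grad (x (psi j)) + (J (x (psi j)))^T *m u (psi j)) +
     q (lam (psi j) - u (psi j)) < j.+1%:R^-1.
  by rewrite /psi; case: cid2.
have [B hB] : exists B, forall k, enorm (col_mx (x k) (u k)) <= B.
  have [B hB] := cvgn_bounded (cvE 0%N).
  pose B1 := Cd * B.
  have hB1 k : sqn (x k - (z 0%N).1) + sqn (u k - (z 0%N).2) <= B1.
    apply: (le_trans (distE 0%N k)); apply: ler_wpM2l; last exact: hB.
    exact: le_trans ler01 Cd1.
  pose B2 := 2 * sqn (z 0%N).1 + 2 * sqn (z 0%N).2 + 2 * B1.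
  have hB2 k : sqn (x k) + sqn (u k) <= B2.
    have h1 := sqnD_le (z 0%N).1 (x k - (z 0%N).1).
    have h2 := sqnD_le (z 0%N).2 (u k - (z 0%N).2).
    rewrite addrC subrK in h1; rewrite addrC subrK in h2.
    by have := hB1 k; rewrite /B2; lra.
  have B20 : 0 <= B2 by apply: le_trans (hB2 0%N); rewrite addr_ge0 ?sqn_ge0.
  have B21 : 0 <= 1 + B2 by exact: addr_ge0.
  exists (1 + B2) => k; rewrite (enorm_le_sqn _ B21) sqn_col_mx.
  by apply: (le_trans (hB2 k)); nra.
have [p hp] := bounded_seq_cluster (fun j => hB (psi j)).
pose xb := usubmx p; pose ub := dsubmx p.
have near eps j : 0 < eps -> exists k, [/\ (j <= k)%N,
     sqn (x k - xb) < eps, sqn (u k - ub) < eps &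
     sqn (grad (x k) + (J (x k))^T *m u k) + q (lam k - u k) < eps].
  move=> eps0; pose r := Num.truncn eps^-1.
  have rE : r.+1%:R^-1 <= eps.
    rewrite -[leRHS]invrK lef_pV2 ?posrE ?invr_gt0 //; apply: ltW.
    exact: truncnS_gt.
  have [l jl hl] := hp eps (maxn j r) eps0.
  exists (psi l); have [lpsi hst] := psiP l.
  move: jl; rewrite geq_max => /andP[jl rl].
  have : col_mx (x (psi l)) (u (psi l)) - p =
      col_mx (x (psi l) - xb) (u (psi l) - ub).
    by rewrite -[in LHS](vsubmxK p) opp_col_mx add_col_mx.
  move=> E; rewrite E sqn_col_mx in hl.
  have h1 := sqn_ge0 (x (psi l) - xb); have h2 := sqn_ge0 (u (psi l) - ub).
  split; [exact: leq_trans jl lpsi|lra|lra|].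
  apply: (lt_le_trans hst); apply: le_trans rE.
  by rewrite lef_pV2 ?posrE // ler_nat.
have kkt := cluster_KKT near.
suff [hx hu] : x k @[k --> \oo] --> xb /\ u k @[k --> \oo] --> ub.
  by exists (xb, ub); split.
pose k0 := kappa^-1 * opnorm (invmx D).
have k00 : 0 <= k0 by rewrite mulr_ge0 ?opnorm_ge0 // invr_ge0 ltW.
have main : (sqn (x k - xb) + sqn (u k - ub)) @[k --> \oo] --> (0 : R).
  apply/cvgrPdist_le => eps eps0.
  pose C := 2 + 2 * k0 + 1.
  have C1 : 1 <= C by rewrite /C; lra.
  pose del := eps / (2 * Cd * (2 * C + 1) + 2).
  have Cd0 : 0 <= Cd := le_trans ler01 Cd1.
  have C20 : 0 <= 2 * C + 1 by lra.
  have CdC : 0 <= 2 * Cd * (2 * C + 1) by rewrite !mulr_ge0.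
  have del0 : 0 < del by rewrite divr_gt0 // ltr_wpDl.
  have delE : (2 * Cd * (2 * C + 1) + 2) * del = eps.
    by rewrite /del mulrC divfK // gt_eqF // ltr_wpDl.
  have [i hi] := dense _ _ kkt del0; rewrite /= in hi.
  have /cvg_ex[l cvl] := cvE i.
  have e1 := sqn_ge0 (xb - (z i).1); have e2 := sqn_ge0 (ub - (z i).2).
  have ll : l <= 2 * C * del.
    rewrite leNgt; apply/negP => lt.
    have g0 : 0 < l - 2 * C * del by lra.
    have [N1 _ hN1] := ((cvgrPdist_lt _ _).1 cvl) _ g0.
    have [N2 _ hN2] := ((cvgrPdist_lt _ _).1 e0) _ del0.
    have [k [jk hx hu _]] := near del (maxn N1 N2) del0.
    move: jk; rewrite geq_max => /andP[N1k N2k].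
    have := hN1 k N1k; have := hN2 k N2k.
    rewrite sub0r normrN ger0_norm ?sqn_ge0 // => he.
    rewrite ltr_norml => /andP[_ hl].
    have hq : kappa^-1 * q (u k - (z i).2) <= k0 * (2 * sqn (u k - ub) + 2 * sqn (ub - (z i).2)).
      rewrite /k0 -mulrA; apply: ler_wpM2l; first by rewrite invr_ge0 ltW.
      apply: (le_trans (wnorm2_le _ _)); apply: ler_wpM2l; first exact: opnorm_ge0.
      exact: sqn_tri.
    have hx2 := sqn_tri (x k) xb (z i).1.
    have k1 : k0 * (2 * sqn (u k - ub) + 2 * sqn (ub - (z i).2)) <= k0 * (4 * del).
      by apply: ler_wpM2l => //; lra.
    by move: hl; rewrite /lyap mul1r /C; lra.
  have [N1 _ hN1] := ((cvgrPdist_lt _ _).1 cvl) _ del0.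
  exists N1 => // k /= N1k; rewrite sub0r normrN ger0_norm ?addr_ge0 ?sqn_ge0 //.
  have := hN1 k N1k; rewrite ltr_norml => /andP[hl _].
  have hd := distE i k.
  have hL : lyap D kappa (z i).1 (z i).2 1 (x k) (u k) (y k - c (x k)) <=
      (2 * C + 1) * del by lra.
  have h3 := ler_wpM2l Cd0 hL.
  have t1 := sqn_tri (x k) (z i).1 xb; have t2 := sqn_tri (u k) (z i).2 ub.
  rewrite (sqnBC (z i).1) in t1; rewrite (sqnBC (z i).2) in t2.
  rewrite -delE; lra.
have below (g : nat -> R) : (forall k, 0 <= g k <= sqn (x k - xb) + sqn (u k - ub)) ->
    g @ \oo --> (0 : R).
  move=> hg; apply: (squeeze_cvgr _ (cvg_cst 0) main).
  by apply: nearW => k; exact: hg.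
split; apply: cvg_sqnP; apply: below => k.
  by rewrite sqn_ge0 lerDl sqn_ge0.
by rewrite sqn_ge0 lerDr sqn_ge0.
Qed.

End Trajectory.

(** * Almost sure convergence *)

Section Conclusions.
Context {R : realType}.

Lemma enorm_bounded_of_cvg p (g : nat -> 'cV[R]_p) (l : 'cV[R]_p) :
  g k @[k --> \oo] --> l -> exists M, forall k, enorm (g k) <= M.
Proof.
move=> gl; have cv : cvgn (fun k => sqn (g k)).
  by apply/cvg_ex; exists (sqn l); exact: cvg_sqn.
have [B hB] := cvgn_bounded cv.
have B0 : 0 <= B := le_trans (sqn_ge0 _) (hB 0%N).
have B1 : 0 <= 1 + B by exact: addr_ge0.
exists (1 + B) => k; rewrite (enorm_le_sqn _ B1).
by apply: (le_trans (hB k)); nra.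
Qed.

(** The exponents are [2 (3/4 + vt) - (1/2 + vt) = 1 + vt] and [1 + 2 vt]. *)
Lemma power_steps_mass_bounded (alpha0 gamma0 tau0 vt : R) :
  1 <= tau0 -> 0 < alpha0 -> 0 < gamma0 -> 0 < vt ->
  exists Mh, forall N, \sum_(k < N) step_mass
    (power_step alpha0 tau0 (3 / 4 + vt)) (power_step gamma0 tau0 (1 / 2 + vt)) k <= Mh.
Proof.
move=> t1 a0 g0 v0.
have r1 : 1 < 1 + vt by lra.
have r2 : 1 < 1 + 2 * vt by lra.
have c1 : 0 <= alpha0 * alpha0 * gamma0^-1.
  by rewrite !mulr_ge0 ?invr_ge0 ?(ltW a0) ?(ltW g0).
have [M1 h1] := power_step_summable t1 c1 r1.
have [M2 h2] := power_step_summable t1 (mulr_ge0 (ltW g0) (ltW g0)) r2.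
exists (M1 + M2) => N; rewrite big_split /=; apply: lerD.
  apply: le_trans (h1 N); rewrite le_eqVlt; apply/orP; left; apply/eqP.
  apply: eq_bigr => k _; rewrite expr2 power_stepV // !power_stepM //.
  by congr power_step; field.
apply: le_trans (h2 N); rewrite le_eqVlt; apply/orP; left; apply/eqP.
apply: eq_bigr => k _; rewrite expr2 !power_stepM //.
by congr power_step; field.
Qed.

(** An almost sure limit becomes a measurable map once it is fixed to a constant
    on a measurable null set that contains the exceptional outcomes. *)
Lemma mx_measurable_limit (d : measure_display) (T : measurableType d) p
    (X : nat -> T -> 'cV[R]_p) (Xoo : T -> 'cV[R]_p) (N : set T) (v : 'cV[R]_p) :
  measurable N -> (forall k i, measurable_fun setT (fun w => X k w i 0)) ->
  (forall w, N w -> Xoo w = v) ->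
  (forall w, ~ N w -> X k w @[k --> \oo] --> Xoo w) ->
  mx_measurable measurable Xoo.
Proof.
move=> mN mX XN Xl _ [i [j [B mB <-]]]; rewrite ord1 {j}.
suff m : measurable_fun setT (fun w => Xoo w i 0) by exact: m.
pose g k w := \1_N w * v i 0 + (1 - \1_N w) * X k w i 0.
have mg k : measurable_fun setT (g k).
  apply: measurable_funD; apply: measurable_funM => //; apply: measurable_funB => //.
apply: (measurable_fun_cvg mg) => w _.
have [Nw|Nw] := pselect (N w).
  rewrite (_ : g ^~ w = fun=> v i 0); first by rewrite XN //; exact: cvg_cst.
  by apply/funext => k; rewrite /g indicE mem_set // mul1r subrr mul0r addr0.
rewrite (_ : g ^~ w = fun k => X k w i 0); first exact: cvg_coord (Xl w Nw).
by apply/funext => k; rewrite /g indicE memNset // mul0r subr0 mul1r add0r.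
Qed.

End Conclusions.

Section Pointwise.
Context {R : realType} {n m : nat}.
Variables (f : 'cV[R]_n -> R) (c : 'cV[R]_n -> 'cV[R]_m) (K : set 'cV[R]_m)
  (D : 'M[R]_m).
Hypothesis cK : closed_convex_cone K.
Hypothesis spd : sym_posdef D.
Hypothesis cc : continuous c.
Hypothesis cgrad : continuous (gradient f).
Hypothesis cJ : continuous (jacobian_cv c).

Lemma proj_KKT xb ub : KKT f c K (xb, ub) -> proj D K (ub + D *m c xb) = ub.
Proof. by move=> [_ k1 k2 k3]; apply/(proj_fixP spd ub (c xb) cK); split. Qed.

Variables (x : nat -> 'cV[R]_n) (u y : nat -> 'cV[R]_m).
Variables (xb : 'cV[R]_n) (ub : 'cV[R]_m).
Hypothesis kkt : KKT f c K (xb, ub).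
Hypothesis xl : x k @[k --> \oo] --> xb.
Hypothesis ul : u k @[k --> \oo] --> ub.

Lemma cvg_multiplier_KKT : sqn (y k - c (x k)) @[k --> \oo] --> (0 : R) ->
  proj D K (u k + D *m y k) @[k --> \oo] --> ub.
Proof.
by move=> e0; rewrite -(proj_KKT kkt); exact: (cvg_multiplier spd cc xl ul e0).
Qed.

Lemma residual_cvg0 : residual f c K D (x k) (u k) @[k --> \oo] --> (0 : R).
Proof.
have ml : multiplier c K D (x k) (u k) @[k --> \oo] --> ub.
  rewrite -(proj_KKT kkt).
  apply: (cvg_multiplier (y := fun k => c (x k)) spd cc xl ul).
  by under eq_fun do rewrite subrr sqn0; exact: cvg_cst.
have gl : primal_step f c K D (x k) (u k) @[k --> \oo] --> (0 : 'cV[R]_n).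
  have [<- _ _ _] := kkt; exact: (cvg_lgrad cgrad cJ xl ml).
have dl : dual_step c K D (x k) (u k) @[k --> \oo] --> (0 : 'cV[R]_m).
  by rewrite -(subrr ub); apply: cvgB.
rewrite /residual; under eq_fun do rewrite !sqn_enorm.
have gs : sqn (primal_step f c K D (x k) (u k)) @[k --> \oo] --> sqn (0 : 'cV[R]_n).
  exact: cvg_sqn.
have ds : sqn (dual_step c K D (x k) (u k)) @[k --> \oo] --> sqn (0 : 'cV[R]_m).
  exact: cvg_sqn.
have h := cvgD gs ds; rewrite !sqn0 addr0 in h; exact: h.
Qed.

End Pointwise.

Theorem theorem5p3 (R : realType) (n m : nat)
  (n_gt0 : (0 < n)%N) (m_gt0 : (0 < m)%N)
  (f : 'cV[R]_n -> R) (c : 'cV[R]_n -> 'cV[R]_m)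
  (K : set 'cV[R]_m) (K_cone : closed_convex_cone K)
  (D : 'M[R]_m) (D_spd : sym_posdef D) (kappa : R) (kappa_gt0 : 0 < kappa)
  (convex_reg : convex_local_regularity f c K)
  (global_reg : global_regularity f c)
  (vt tau0 alpha0 gamma0 : R)
  (vt_itv : 0 < vt < 1 / 4) (tau0_ge1 : 1 <= tau0)
  (alpha0_itv : 0 < alpha0 <= 1 / kappa) (gamma0_itv : 0 < gamma0 <= 1)
  (d : measure_display) (T : measurableType d) (P : probability T R)
  (Bg BJ Bc : nat) (sigmag sigmaJ sigmac : R) (F : nat -> set (set T))
  (ghat : nat -> T -> 'cV[R]_n) (Jhat : nat -> T -> 'M[R]_(m, n))
  (chat : nat -> T -> 'cV[R]_m)
  (x : nat -> T -> 'cV[R]_n) (u y : nat -> T -> 'cV[R]_m)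
  (obs : conditional_observation P f c K Bg BJ Bc sigmag sigmaJ sigmac
           F ghat Jhat chat x u y)
  (iter_xuy : generated_by_iteration K D kappa
           (power_step alpha0 tau0 (3 / 4 + vt))
           (power_step gamma0 tau0 (1 / 2 + vt)) ghat Jhat chat x u y) :
  let e := tracking_error c x y in
  let lambda := tracked_multiplier K D u y in
  [/\ (ereal_sup (range (fun k => 'E_P[fun w =>
         (enorm (x k w) ^+ 2 + enorm (u k w) ^+ 2 + enorm (e k w) ^+ 2)%R]))
         < +oo)%E,
      {ae P, forall w, exists M : R, forall k,
         [/\ enorm (x k w) <= M, enorm (u k w) <= M & enorm (y k w) <= M]},
      exists (xoo : T -> 'cV[R]_n) (uoo : T -> 'cV[R]_m),
        [/\ mx_measurable measurable xoo, mx_measurable measurable uoo,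
            forall w, KKT f c K (xoo w, uoo w)
          & {ae P, forall w,
               [/\ x k w @[k --> \oo] --> xoo w,
                   u k w @[k --> \oo] --> uoo w,
                   e k w @[k --> \oo] --> (0 : 'cV[R]_m)
                 & lambda k w @[k --> \oo] --> uoo w]}],
      ('E_P[fun w => (enorm (e k w) ^+ 2)%R] @[k --> \oo] --> 0)%E
    & {ae P, forall w, residual f c K D (x k w) (u k w) @[k --> \oo] --> 0}].
Proof.
move=> e lambda.
have [Lf [Mc [LJ [[Lf0 Mc0 LJ0] f_lip J_bnd J_lip]]]] := global_reg.
have [_ [df cgrad] [dc cJ] _ kne] := convex_reg.
have cc : continuous c by move=> v; exact: differentiable_continuous.
have [/andP[vt0 vt1] /andP[a0 a1] /andP[g0 g1]] := And3 vt_itv alpha0_itv gamma0_itv.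
pose al := power_step alpha0 tau0 (3 / 4 + vt).
pose ga := power_step gamma0 tau0 (1 / 2 + vt).
have ra : 0 <= 3 / 4 + vt by lra.
have rg : 0 <= 1 / 2 + vt by lra.
have al_gt0 k : 0 < al k by exact: power_step_gt0.
have kal k : kappa * al k <= 1.
  rewrite mulrC -ler_pdivlMr //; apply: le_trans a1; exact: power_step_le.
have ga_itv k : 0 < ga k <= 1.
  by rewrite power_step_gt0 //=; apply: le_trans g1; exact: power_step_le.
have [Mh hMh] := power_steps_mass_bounded tau0_ge1 a0 g0 vt0.
have al_div M : exists N, M <= \sum_(k < N) al k.
  by apply: power_step_divergent => //; lra.
have ga_div M : exists N, M <= \sum_(k < N) ga k.
  by apply: power_step_divergent => //; lra.
have ref p (kkt : KKT f c K (p.1, p.2)) := reference_conclusions K_cone D_spd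
  kappa_gt0 convex_reg Lf0 Mc0 LJ0 f_lip J_bnd J_lip al_gt0 kal ga_itv obs iter_xuy
  kkt hMh al_div ga_div.
have [z zK zdense] := dense_sequence kne.
have zK' i : KKT f c K ((z i).1, (z i).2) by rewrite -surjective_pairing.
have [iS [B hB] hE _ stat] := ref _ (zK' 0%N).
have mT : measurable [set: T] by exact: measurableT.
have mx_coord p (X : T -> 'cV[R]_p) k i : mx_measurable (F k) X ->
    measurable_fun setT (fun w => X w i 0).
  by move=> /mx_measurableP hX; exact: fmeas_measurable (obs_sigma_algebra obs k) (hX i 0).
have meas k := obs_adapted obs k.
have sqn_meas k : [/\ fmeas (F k) (fun w => sqn (x k w)),
    fmeas (F k) (fun w => sqn (u k w)) & fmeas (F k) (fun w => sqn (e k w))].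
  have [sFk _] := obs_sigma_algebra obs k; have [mx mu my] := meas k.
  split; apply: fmeas_sqn => //; apply: mx_measurableB => //.
  exact: mx_measurable_continuous.
have e_L1 k : L1 P (fun w => sqn (e k w)).
  have [_ _ me] := sqn_meas k.
  apply: (L1_ge0_le (fmeas_measurable (obs_sigma_algebra obs k) me) (iS k)) => w.
  rewrite sqn_ge0 /= /state /dist.
  by rewrite addrA lerDr addr_ge0 // addr_ge0 ?sqn_ge0.
pose good w p := [/\ KKT f c K p, x k w @[k --> \oo] --> p.1,
  u k w @[k --> \oo] --> p.2 & sqn (e k w) @[k --> \oo] --> (0 : R)].
have ae_good : {ae P, forall w, exists p, good w p}.
  have cvE : {ae P, forall w, forall i,
      cvgn (fun k => energy c D kappa x u y (z i).1 (z i).2 1 k w) /\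
      sqn (e k w) @[k --> \oo] --> (0 : R)}.
    by apply: ae_foralln => i; have [] := ref _ (zK' i).
  apply: filterS2 cvE stat => w hcv hst.
  have [_ e0] := hcv 0%N.
  have [p [kkt xl ul]] := trajectory_cvg K_cone D_spd kappa_gt0 cc cgrad cJ e0
    zdense (fun i => (hcv i).1) hst.
  by exists p; split.
have [N [mN PN hN]] := ae_good.
have goodN w : ~ N w -> exists p, good w p.
  by move=> Nw; apply: contrapT => hw; apply: Nw; exact: hN.
have aeN : {ae P, forall w, ~ N w}.
  by exists N; split=> // w /= /contrapT.
split.
- apply: (@le_lt_trans _ _ ((2 + 2 * sqn (z 0%N).1 + 2 * sqn (z 0%N).2) * B)%:E);
    last exact: ltry.
  apply: ge_ereal_sup => _ [k _ <-]; rewrite unlock.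
  set C := 2 + _ + _.
  have C0 : 0 <= C by rewrite !addr_ge0 ?mulr_ge0 ?sqn_ge0.
  have le w : sqn (x k w) + sqn (u k w) + sqn (e k w) <=
      C * state c x u y (z 0%N).1 (z 0%N).2 k w.
    have h1 := sqnD_le (x k w - (z 0%N).1) (z 0%N).1; rewrite subrK in h1.
    have h2 := sqnD_le (u k w - (z 0%N).2) (z 0%N).2; rewrite subrK in h2.
    rewrite /state /dist -/(e k w) /C.
    have hp := sqn_ge0 (x k w - (z 0%N).1); have hr := sqn_ge0 (u k w - (z 0%N).2).
    have he := sqn_ge0 (e k w); have hA := sqn_ge0 (z 0%N).1.
    have hB2 := sqn_ge0 (z 0%N).2.
    have := mulr_ge0 (addr_ge0 hA hB2) (addr_ge0 (addr_ge0 hp hr) he).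
    lra.
  have iC := L1Z C (iS k).
  have [mx mu me] := sqn_meas k.
  have iX : L1 P (fun w => sqn (x k w) + sqn (u k w) + sqn (e k w)).
    have [sFk _] := obs_sigma_algebra obs k.
    apply: (L1_ge0_le _ iC).
      apply: (fmeas_measurable (obs_sigma_algebra obs k)).
      by apply: fmeasD => //; exact: fmeasD.
    by move=> w; rewrite le andbT !addr_ge0 ?sqn_ge0.
  under eq_integral do rewrite /= !sqn_enorm.
  rewrite -(EA_EFin mT iX) lee_fin.
  apply: (le_trans (EA_le mT iX iC (fun w _ => le w))).
  by rewrite EAZ // ler_wpM2l.
- apply: filterS aeN => w /goodN [[xb ub] [kkt xl ul e0]]; rewrite /= in xl ul.
  have yl : y k w @[k --> \oo] --> c xb.
    rewrite (_ : (fun k => y k w) = fun k => e k w + c (x k w)); last first.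
      by apply/funext => k; rewrite /e /tracking_error subrK.
    rewrite -[c xb]add0r; apply: cvgD; last exact: cvg_comp_seq.
    by apply: cvg_sqnP; under eq_fun do rewrite subr0.
  have [M1 h1] := enorm_bounded_of_cvg xl; have [M2 h2] := enorm_bounded_of_cvg ul.
  have [M3 h3] := enorm_bounded_of_cvg yl.
  exists (Num.max M1 (Num.max M2 M3)) => k.
  by split; rewrite !le_max ?h1 ?h2 ?h3 ?orbT.
- pose zoo w := if pselect (N w) then z 0%N else xget (z 0%N) (good w).
  have zooN w : ~ N w -> good w (zoo w).
    by move=> Nw; rewrite /zoo; case: pselect => // ?; exact: xgetPex (goodN w Nw).
  have zooY w : N w -> zoo w = z 0%N by rewrite /zoo; case: pselect.
  exists (fun w => (zoo w).1), (fun w => (zoo w).2); split.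
  + apply: (mx_measurable_limit (X := x) (v := (z 0%N).1) mN).
    * by move=> k i; apply: (@mx_coord _ _ k); case: (meas k).
    * by move=> w /zooY ->.
    * by move=> w /zooN[].
  + apply: (mx_measurable_limit (X := u) (v := (z 0%N).2) mN).
    * by move=> k i; apply: (@mx_coord _ _ k); case: (meas k).
    * by move=> w /zooY ->.
    * by move=> w /zooN[].
  + move=> w; rewrite -surjective_pairing.
    by have [/zooY ->|/zooN[]] := pselect (N w).
  + apply: filterS aeN => w /zooN [kkt xl ul e0].
    split=> //; first by apply: cvg_sqnP; under eq_fun do rewrite subr0.
    rewrite [zoo w]surjective_pairing in kkt.
    exact: (cvg_multiplier_KKT K_cone D_spd cc kkt xl ul e0).
- rewrite (_ : (fun k => _) = EFin \o fun k => EA P setT (fun w => sqn (e k w))).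
    by apply: cvg_EFin; [exact: nearW|exact: hE].
  apply/funext => k /=; rewrite unlock EA_EFin //.
  by apply: eq_integral => w _; rewrite sqn_enorm.
- apply: filterS aeN => w /goodN [[xb ub] [kkt xl ul _]].
  exact: (residual_cvg0 K_cone D_spd cc cgrad cJ kkt xl ul).
Qed.
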